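(* Consider the polynomial Cherkas system $$\dot x=y,\qquad \dot y=P_0(x)+P_1(x)y+P_2(x)y^2,$$ where $P_0(x)=a_0+\cdots+a_nx^n$, $P_1(x)=b_0+\cdots+b_nx^n$, $P_2(x)=c_0+\cdots+c_nx^n$ are real polynomials, $n\ge 0$, $a_n^2+b_n^2+c_n^2\neq 0$, $P_0\not\equiv 0$ and $P_2\not\equiv 0$. Let ${\cal X}^{(0)}$ and (when $c_n\ne 0$) ${\cal Y}^{(0)}$ be the associated vector fields defined in the context. The system is monodromic at infinity if and only if $n$ is odd and one of the following holds: (M1) $c_n=b_n=0$, $a_n<0$, and there is an integer $i_*$ with $0\le i_*\le n-1$ such that: for all $i=0,\dots,i_*-1$ the Newton polygon ${\cal N}({\cal X}^{(i)})$ has exactly one edge $E^{(i)}$, whose height is $2$ and whose width is $2p^{(i)}$ for an integer $p^{(i)}$, and the polynomial $\mathcal{P}_{E^{(i)}}$ has exactly one nonzero real root $\phi^{(i)}$, which is of multiplicity $2$; and ${\cal N}({\cal X}^{(i_* )})$ has exactly one edge $E^{(i_* )}$, whose height is $2$ and whose width is $2p^{(i_* )}$ for an integer $p^{(i_* )}$, and the polynomial $\mathcal{P}_{E^{(i_* )}}$ has no nonzero real roots. Here ${\cal X}^{(i+1)}:={\cal D}({\cal X}^{(i)};p^{(i)},1,\phi^{(i)})$ for all $i=0,\dots,i_*-1$. (M2) $c_n<0$ and $b_n^2-4a_nc_n<0$. (M3) $c_n<0$, $b_n^2-4a_nc_n=0$, and there is an integer $i_*\ge 0$, with $i_*\le n$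 if $b_n\neq 0$ and $i_*\le n+1$ if $b_n=0$, such that: for all $i=0,\dots,i_*-1$ the Newton polygon ${\cal N}({\cal Y}^{(i)})$ has exactly one edge $E^{(i)}$, whose height is $2$ and whose width is $2p^{(i)}$ for an integer $p^{(i)}$, and the polynomial $\mathcal{P}_{E^{(i)}}$ has exactly one nonzero real root $\phi^{(i)}$, which is of multiplicity $2$; and ${\cal N}({\cal Y}^{(i_* )})$ has exactly one edge $E^{(i_* )}$, whose height is $2$ and whose width is $2p^{(i_* )}$ for an integer $p^{(i_* )}$, and $\mathcal{P}_{E^{(i_* )}}$ has no nonzero real roots. Here ${\cal Y}^{(i+1)}:={\cal D}({\cal Y}^{(i)};p^{(i)},1,\phi^{(i)})$ for all $i=0,\dots,i_*-1$.
   Context: Monodromic at infinity: in the Poincaré compactification of the system (extension to the Poincaré sphere, whose equator represents infinity), no orbits of the system in $\mathbb{R}^2$ connect with (tend in forward or backward time to) any equilibrium on the equator. Vector fields. Put $\widetilde P_i(u):=u^nP_i(1/u)$ for $i=0,1,2$ (polynomials in $u$). Define $${\cal X}^{(0)}:=u^{n+2}\frac{\partial}{\partial u}+\big(\widetilde P_0(u)v^3+\widetilde P_1(u)v^2+\widetilde P_2(u)v\big)\frac{\partial}{\partial v},$$ and, when $c_n\neq 0$, with $y_*:=-b_n/(2c_n)$, $${\cal Y}^{(0)}:=-u^{n+2}(y+y_* )\frac{\partial}{\partial u}+\big(\widetilde P_0(u)+\widetilde P_1(u)(y+y_* )+\widetilde P_2(u)(y+y_* )^2\big)\frac{\partial}{\partial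 y}.$$ Newton polygon. Let ${\cal X}=F(u,v)\frac{\partial}{\partial u}+G(u,v)\frac{\partial}{\partial v}$ with $F=\sum f_{i,j}u^iv^j$, $G=\sum g_{i,j}u^iv^j$ (coefficients with a negative index are zero). The support is ${\cal S}({\cal X}):=\{(i,j)\in\mathbb{Z}^2:(f_{i+1,j},g_{i,j+1})\neq(0,0)\}$. The boundary of the convex hull ${\rm conv}\{{\cal S}({\cal X})+\mathbb{R}_+^2\}$ (in the $(u,v)$-plane) consists of a vertical line, a horizontal line and a compact polygon (possibly a single lattice point); this compact polygon is the Newton polygon ${\cal N}({\cal X})$. The height and the width of an edge $E$ are the lengths of its projections on the $v$-axis and on the $u$-axis, respectively. If an edge $E$ lies on the line $qu+pv=\sigma$ with coprime positive integers $p,q$, the polynomial corresponding to $E$ is $$\mathcal{P}_E(v):=\sum_{(i,j)\in E\cap\mathbb{Z}^2}(q\,g_{i,j+1}-p\,f_{i+1,j})v^{j+1}.$$ For a real root $\phi$ of $\mathcal{P}_E$, ${\cal D}({\cal X};p,q,\phi)$ denotes the vector field obtained by the quasi-homogeneous blow-up $u=u_1^{q}$, $v=u_1^{p}(\phi+v_1)$ after removing the common factor $u_1^{\sigma}/q$, that is, $${\cal D}({\cal X};p,q,\phi)=\frac{F(u,v)}{u_1^{\sigma+q-1}}\frac{\partial}{\partial u_1}+\left(\frac{q\,G(u,v)}{u_1^{\sigma+p}}-\frac{p(\phi+v_1)F(u,v)}{u_1^{\sigma+q}}\right)\frac{\partial}{\partial v_1}\quad\text{with } u=u_1^q,\ v=u_1^p(\phi+v_1).$$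 The same notions are used for ${\cal Y}^{(0)}$ with $y$ in the role of $v$. *)

(* Defs.v *)
From HB Require Import structures.
From mathcomp Require Import all_boot all_order all_algebra.
From mathcomp Require Import all_classical all_reals all_analysis.

Set Implicit Arguments.
Unset Strict Implicit.
Unset Printing Implicit Defensive.

Import Order.TTheory GRing.Theory Num.Theory.
Import numFieldNormedType.Exports.

Local Open Scope classical_set_scope.
Local Open Scope ring_scope.

(* A polynomial in two variables is an element of {poly {poly R}}.  The first
   variable (x or u) is the outer variable 'X, and the second one (y or v) is
   the inner variable 'Y = 'X%:P, so the coefficient of u^i v^j is F`_i`_j. *)
Definition vfield (R : realType) : Type :=
  ({poly {poly R}} * {poly {poly R}})%type.

Definition coef2 (R : realType) (F : {poly {poly R}}) (i j : int) : R :=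
  match i, j with
  | Posz i, Posz j => F`_i`_j
  | _, _ => 0
  end.

(* F(U, V), where U and V are themselves polynomials in two variables. *)
Definition subst2 (R : realType) (F U V : {poly {poly R}}) :
    {poly {poly R}} :=
  \sum_(i < size F) \sum_(j < size F`_i)
    (F`_i`_j)%:P%:P * U ^+ i * V ^+ j.

Definition solution_on (R : realType) (X : vfield R) (a b : \bar R)
    (x y : R -> R) : Prop :=
  forall t : R, (a < t%:E < b)%E ->
    is_derive t 1 x (X.1.[x t, y t]) /\ is_derive t 1 y (X.2.[x t, y t]).

Definition total_degree (R : realType) (F : {poly {poly R}}) : nat :=
  \max_(i < size F) \max_(j < size (F`_i)%R | (F`_i`_j != 0)%R) (i + j)%N.

Definition vfield_degree (R : realType) (X : vfield R) : nat :=
  maxn (total_degree X.1) (total_degree X.2).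

(* z3^d F(z1/z3, z2/z3), for d at least the total degree of F *)
Definition homogenize (R : realType) (d : nat) (F : {poly {poly R}})
    (z : R * R * R) : R :=
  let: (z1, z2, z3) := z in
  \sum_(i < size F) \sum_(j < size F`_i)
    F`_i`_j * z1 ^+ i * z2 ^+ j * z3 ^+ (d - (i + j)).

(* The vector field on the sphere z1^2 + z2^2 + z3^2 = 1 which, on the open
   hemisphere z3 > 0, is z3^(d-1) times the image of X under the central
   projection below, where d is the degree of X.  That image is
   z3 ((P, Q, 0) - (z1 P + z2 Q) z), so multiplying by z3^(d-1) turns P and Q
   into their homogenizations, and the result makes sense for z3 = 0. *)
Definition poincare_field (R : realType) (X : vfield R) (z : R * R * R) :
    R * R * R :=
  let: (z1, z2, z3) := z in
  let P := homogenize (vfield_degree X) X.1 z in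
  let Q := homogenize (vfield_degree X) X.2 z in
  let s := z1 * P + z2 * Q in
  (P - z1 * s, Q - z2 * s, - (z3 * s)).

Definition central_projection (R : realType) (x y : R) : R * R * R :=
  let r := Num.sqrt (1 + x ^+ 2 + y ^+ 2) in (x / r, y / r, 1 / r).

Definition equator_equilibrium (R : realType) (X : vfield R) (e : R * R * R) :
    Prop :=
  [/\ e.2 = 0, e.1.1 ^+ 2 + e.1.2 ^+ 2 = 1 & poincare_field X e = (0, 0, 0)].

(* t tends to b (resp. a) inside the interval ]a, b[ *)
Definition to_right_end (R : realType) (a b : \bar R) : set_system R :=
  filter_from [set s : R | (a < s%:E < b)%E]
              (fun s => [set t : R | (s%:E < t%:E < b)%E]).

Definition to_left_end (R : realType) (a b : \bar R) : set_system R :=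
  filter_from [set s : R | (a < s%:E < b)%E]
              (fun s => [set t : R | (a < t%:E < s%:E)%E]).

(* The solution is not required to be maximal: if it tends to a point of the
   equator at an end of its interval, it cannot be extended beyond that end. *)
Definition orbit_connects (R : realType) (X : vfield R) (e : R * R * R) :
    Prop :=
  exists (a b : \bar R) (x y : R -> R),
    [/\ (a < b)%E, solution_on X a b x y &
      ((fun t => central_projection (x t) (y t)) @ to_right_end a b --> e) \/
      ((fun t => central_projection (x t) (y t)) @ to_left_end a b --> e)].

Definition monodromic_at_infinity (R : realType) (X : vfield R) : Prop :=
  forall e : R * R * R, equator_equilibrium X e -> ~ orbit_connects X e.

Definition field_support (R : realType) (X : vfield R) : set (int * int) :=
  [set ij | (coef2 X.1 (ij.1 + 1) ij.2, coef2 X.2 ij.1 (ij.2 + 1)) <> (0, 0)].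

Definition convex_hull (R : realType) (A : set (R * R)) : set (R * R) :=
  smallest (@convex_set R (R^o * R^o)%type) A.

Definition lattice_point (R : realType) (ij : int * int) : R * R :=
  (ij.1%:~R, ij.2%:~R).

Definition newton_region (R : realType) (X : vfield R) : set (R * R) :=
  convex_hull [set z | exists2 ij, field_support X ij &
    (lattice_point R ij).1 <= z.1 /\ (lattice_point R ij).2 <= z.2].

(* The edges of the Newton polygon are the compact one-dimensional faces of the
   region; its other two one-dimensional faces are a vertical and a horizontal
   half-line. *)
Definition newton_edge (R : realType) (X : vfield R) (E : set (R * R)) :
    Prop :=
  [/\ exists a b c : R,
        [/\ (a, b) <> (0, 0),
            (forall z, newton_region X z -> c <= a * z.1 + b * z.2) &
            E = newton_region X `&` [set z | a * z.1 + b * z.2 = c]],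
      compact E &
      exists z w, [/\ E z, E w & z <> w]].

Definition edge_height (R : realType) (E : set (R * R)) : R :=
  sup (snd @` E) - inf (snd @` E).

Definition edge_width (R : realType) (E : set (R * R)) : R :=
  sup (fst @` E) - inf (fst @` E).

Definition lies_on_line (R : realType) (E : set (R * R)) (p q : nat)
    (sigma : int) : Prop :=
  [/\ (0 < p)%N, (0 < q)%N, coprime p q &
      forall z, E z -> q%:R * z.1 + p%:R * z.2 = sigma%:~R].

(* Points of E with j < -1 do not occur, and would have zero coefficient. *)
Definition edge_poly (R : realType) (X : vfield R) (E : set (R * R))
    (p q : nat) : {poly R} :=
  \sum_(ij \in [set ij : int * int | E (lattice_point R ij)])
    ((q%:R * coef2 X.2 ij.1 (ij.2 + 1) - p%:R * coef2 X.1 (ij.1 + 1) ij.2)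
       *: 'X^(`|(ij.2 + 1)%R|%N)).

(* F / u^k; for k >= 0 the terms of F of degree less than k in u are dropped. *)
Definition div_u (R : realType) (k : int) (F : {poly {poly R}}) :
    {poly {poly R}} :=
  match k with
  | Posz k => drop_poly k F
  | Negz k => F * 'X^(k.+1)
  end.

(* The divisions are exact when q i + p j >= sigma on the support of X, which
   is the case if the line q i + p j = sigma carries an edge: a monomial
   u^i v^j of F is transformed into u_1^(q i + p j) (phi + v_1)^j with
   (i - 1, j) in the support, and likewise (i, j - 1) for G. *)
Definition blow_up (R : realType) (X : vfield R) (p q : nat) (sigma : int)
    (phi : R) : vfield R :=
  let V : {poly {poly R}} := phi%:P%:P + 'Y in
  let F := subst2 X.1 'X^q ('X^p * V) in
  let G := subst2 X.2 'X^q ('X^p * V) in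
  (div_u (sigma + q%:Z - 1) F,
   q%:R * div_u (sigma + p%:Z) G - p%:R * V * div_u (sigma + q%:Z) F).

(* An edge of height 2 and width 2p lies on a line u + p v = sigma; thus q = 1
   here. *)
Definition unique_edge (R : realType) (X : vfield R) (E : set (R * R))
    (p : nat) (sigma : int) : Prop :=
  [/\ forall E', newton_edge X E' <-> E' = E,
      edge_height E = 2, edge_width E = 2 * p%:R & lies_on_line E p 1 sigma].

Definition unique_nonzero_root (R : realType) (P : {poly R}) (phi : R) : Prop :=
  phi != 0 /\ forall r : R, r != 0 -> (root P r <-> r = phi).

(* The condition on the successive blow-ups X = X^(0), ..., X^(m), where
   m = i_*. *)
Definition desingularizes_at (R : realType) (X : vfield R) (m : nat) : Prop :=
  exists (Z : nat -> vfield R) (E : nat -> set (R * R)) (p : nat -> nat)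
         (sigma : nat -> int) (phi : nat -> R),
    [/\ Z 0%N = X,
        forall i : nat, (i < m)%N ->
          [/\ unique_edge (Z i) (E i) (p i) (sigma i),
              unique_nonzero_root (edge_poly (Z i) (E i) (p i) 1) (phi i),
              mup (phi i) (edge_poly (Z i) (E i) (p i) 1) = 2%N &
              Z i.+1 = blow_up (Z i) (p i) 1 (sigma i) (phi i)],
        unique_edge (Z m) (E m) (p m) (sigma m) &
        forall r : R, r != 0 -> ~~ root (edge_poly (Z m) (E m) (p m) 1) r].

Definition cherkas (R : realType) (P0 P1 P2 : {poly R}) : vfield R :=
  ('Y, P0^:P + P1^:P * 'Y + P2^:P * 'Y ^+ 2).

(* u^n P(1/u), for P of degree at most n *)
Definition reversal (R : realType) (n : nat) (P : {poly R}) : {poly R} :=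
  \poly_(k < n.+1) P`_(n - k).

Definition fieldX (R : realType) (n : nat) (P0 P1 P2 : {poly R}) : vfield R :=
  ('X^(n.+2),
   (reversal n P0)^:P * 'Y ^+ 3 + (reversal n P1)^:P * 'Y ^+ 2
     + (reversal n P2)^:P * 'Y).

Definition fieldY (R : realType) (n : nat) (P0 P1 P2 : {poly R}) : vfield R :=
  let ystar : R := - P1`_n / (2 * P2`_n) in
  let W : {poly {poly R}} := 'Y + ystar%:P%:P in
  (- 'X^(n.+2) * W,
   (reversal n P0)^:P + (reversal n P1)^:P * W + (reversal n P2)^:P * W ^+ 2).

(* Main.v *)
Require Import Defs.
From HB Require Import structures.
From mathcomp Require Import all_boot all_order all_algebra.
From mathcomp Require Import all_classical all_reals all_analysis.
From mathcomp Require Import ring lra zify.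

Set Implicit Arguments.
Unset Strict Implicit.
Unset Printing Implicit Defensive.

Import Order.TTheory GRing.Theory Num.Theory.
Import numFieldNormedType.Exports.

Local Open Scope ring_scope.

(** Where [y <> 0] the orbits are the graphs of solutions of
    [y y' = P0(x) + P1(x) y + P2(x) y^2], with [' = d/dx].  An orbit that tends to
    a point of the equator is, near that end, the graph of a solution over a
    half-line [s x >= T0], [s = 1] or [s = -1] ([not_monodromic_escaping]).
    Conversely the slope [y / x] of a solution over a half-line has a limit, possibly infinite,
    because [y - k x] has eventually constant sign for each [k]
    ([slope_levels]), the limit direction is an equilibrium, and integrating
    [dt = dx / y] gives an orbit that tends to it ([escaping_not_monodromic]).
    So the system is monodromic at infinity if and only if no solution over a
    half-line exists.

    Solutions over half-lines come from barriers.  If [P0 <= 0] and [Y] has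
    constant sign and satisfies [Y Y' <= P0 + P1 Y + P2 Y^2], there is a solution
    farther from zero than [Y] ([escaping_above]): after removal of the linear
    part the right-hand side is monotone in the unknown, and the supremum of the
    subsolutions is a solution.  Monomial barriers show ([not_escaping_leading])
    that a monodromic system has [P0] and [P2] of odd degrees [d0], [d2] with
    negative leading coefficients [a] and [e], that the degree of [P1] is at most
    [m = (d0 + d2) / 2], and that [b^2 <= 4 a e], where [b] is the coefficient of
    [x^m] in [P1].  Since [n] is one of [d0], [d2], this is the alternative
    between the three cases, except for the condition on the Newton polygons.

    Put [w = y x^(m - d0)]; then [w' = x^d2 (a + b w + e w^2 + ...) / w].  If
    [b^2 < 4 a e], the bracket is negative and bounded away from zero, and [w]
    would reach zero ([leading_nonreal]).  If [b^2 = 4 a e], a solution over a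
    half-line has to tend to the double root ([leading_double]), and one is left
    with the germ of a planar field at that root.

    These germs form a class, [germ N], that is stable under blowing up at a
    double root [phi] of the polynomial of an edge of height 2
    ([germ_blow_up]); [N], the order of the first component, decreases by the
    half-width of the edge.  A barrier fails to exist only if the Newton polygon
    has an edge of height 2 and even width whose polynomial has no two distinct
    real roots, and the blow-up at a double root inherits this property.  So
    either there is a barrier, which can be traced back to a solution over a
    half-line, or after at most [N - 2] blow-ups a polynomial without real roots
    is reached ([barrier_or_desingularized]).  In the second case a solution
    through the germ would have to follow the double roots up to the last edge,
    where nothing is left that it could tend to ([desingularized_no_solution]).

    The bounds on [istar] come from the values of [N]: it is [n + 2] for the field [Y]
    if its base point is not on the line [y = 0]; otherwise it is [n + 2] after a
    first blow-up; and it is [n + 2 - 2 p] with [p >= 1] for the field [X] after a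
    first blow-up. *)

(** * Real analysis *)

Lemma is_derive_continuous (R : realType) (f : R -> R) (x d : R) :
  is_derive x 1 f d -> {for x, continuous f}.
Proof. by move=> [fx _]; exact/differentiable_continuous/derivable1_diffP. Qed.

Lemma le_is_derive (R : realType) (f df : R -> R) (a b : R) :
  a <= b -> (forall x, a <= x <= b -> is_derive x 1 f (df x)) ->
  (forall x, a <= x <= b -> 0 <= df x) -> f a <= f b.
Proof.
move=> ab fd f0; have [|| c cab fE] := @MVT_segment R f df a b ab.
- by move=> x; rewrite in_itv /= => /andP[ax xb]; apply: fd; rewrite !ltW.
- apply: continuous_in_subspaceT => x; rewrite inE /= in_itv /= => xab.
  exact: is_derive_continuous (fd _ xab).
by rewrite -subr_ge0 fE mulr_ge0 ?subr_ge0// f0.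
Qed.

Lemma lt_is_derive (R : realType) (f df : R -> R) (a b : R) :
  a < b -> (forall x, a <= x <= b -> is_derive x 1 f (df x)) ->
  (forall x, a <= x <= b -> 0 < df x) -> f a < f b.
Proof.
move=> ab fd f0; have [|| c cab fE] := @MVT R f df a b ab.
- by move=> x; rewrite in_itv /= => /andP[ax xb]; apply: fd; rewrite !ltW.
- apply: continuous_in_subspaceT => x; rewrite inE /= in_itv /= => xab.
  exact: is_derive_continuous (fd _ xab).
rewrite -subr_gt0 fE mulr_gt0 ?subr_gt0// f0//.
by move: cab; rewrite in_itv /= => /andP[? ?]; rewrite !ltW.
Qed.

Lemma antiderivative (R : realType) (h : R -> R) (a : R) :
  continuous h ->
  exists H, H a = 0 /\ forall x, a <= x -> is_derive x 1 H (h x).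
Proof.
move=> hc; pose mu := @lebesgue_measure R.
pose F x := (\int[mu]_(t in [set` `[a - 1, x]]) h t)%R.
exists (fun x => F x - F a); rewrite subrr; split=> // x ax.
have [] := @continuous_FTC1_closed R h (a - 1) x (x + 1).
- by rewrite ltrDl.
- apply: continuous_compact_integrable; first exact: segment_compact.
  by apply: continuous_subspaceT => y; exact: hc.
- by rewrite ltrBlDr (le_lt_trans ax)// ltrDl.
- exact: hc.
rewrite derive1E => Fd Fe.
rewrite -[h x]subr0; apply: is_deriveB; first by rewrite -Fe; exact/derivableP.
Qed.

Lemma is_derive_gt0_right (R : realType) (f : R -> R) (x d : R) :
  is_derive x 1 f d -> 0 < d ->
  exists2 e, 0 < e & forall y, x < y < x + e -> f x < f y.
Proof.
move=> /is_derive1_caratheodory[g [fE gc gx]] d0.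
have : \forall y \near x, 0 < g y.
  by apply: (cvgr_gt (g x) gc); rewrite gx.
move=> /nbhs_ballP[e /= e0 He]; exists e => // y /andP[xy ye].
rewrite -subr_gt0 fE mulr_gt0 ?subr_gt0//; apply: He.
by rewrite /ball /= distrC gtr0_norm ?subr_gt0// ltrBlDl.
Qed.

Lemma is_derive_gt0_left (R : realType) (f : R -> R) (x d : R) :
  is_derive x 1 f d -> 0 < d ->
  exists2 e, 0 < e & forall y, x - e < y < x -> f y < f x.
Proof.
move=> /is_derive1_caratheodory[g [fE gc gx]] d0.
have : \forall y \near x, 0 < g y.
  by apply: (cvgr_gt (g x) gc); rewrite gx.
move=> /nbhs_ballP[e /= e0 He]; exists e => // y /andP[ye xy].
rewrite -subr_lt0 fE pmulr_rlt0 ?subr_lt0//; apply: He.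
by rewrite /ball /= gtr0_norm ?subr_gt0// ltrBlDl -ltrBlDr.
Qed.

(** A function whose derivative is positive at each of its zeros cannot become
    negative: at the last point where it is nonnegative it would vanish. *)
Lemma ge0_of_zeros_increasing (R : realType) (f df : R -> R) (a b : R) :
  a <= b -> (forall x, a <= x <= b -> is_derive x 1 f (df x)) ->
  (forall x, a <= x <= b -> f x = 0 -> 0 < df x) -> 0 <= f a -> 0 <= f b.
Proof.
move=> ab fd f0 fa0; rewrite leNgt; apply/negP => fb0.
pose S := [set x | a <= x <= b /\ 0 <= f x]%classic.
have Sa : S a by split=> //; rewrite lexx.
have Sb : ubound S b by move=> x [/andP[]].
have supS : has_sup S by split; [exists a | exists b].
set c := sup S.
have cab : a <= c <= b by rewrite (ub_le_sup supS.2 Sa) ge_sup//; exists a.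
have fcc : {for c, continuous f} := is_derive_continuous (fd _ cab).
have fc0 : 0 <= f c.
  rewrite leNgt; apply/negP => fc0.
  have : \forall y \near c, f y < 0 by exact: (cvgr_lt (f c) fcc).
  move=> /nbhs_ballP[e /= e0 He].
  have [y Sy cy] := sup_adherent e0 supS.
  have yc : y <= c by exact: (ub_le_sup supS.2).
  have : f y < 0.
    by apply: He; rewrite /ball /= ger0_norm ?subr_ge0// ltrBlDr -ltrBlDl.
  by case: Sy => _; rewrite leNgt => /negP.
have cb : c < b.
  rewrite lt_neqAle (andP cab).2 andbT; apply: contraTneq fb0 => <-.
  by rewrite -leNgt.
have fc : f c = 0.
  apply/eqP; rewrite eq_le fc0 andbT leNgt; apply/negP => fcgt.
  have : \forall y \near c, 0 < f y by exact: (cvgr_gt (f c) fcc).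
  move=> /nbhs_ballP[e /= e0 He].
  pose y := Num.min (c + e / 2) b.
  have cy : c < y by rewrite lt_min cb ltrDl divr_gt0.
  have : y <= c.
    apply: (ub_le_sup supS.2); split.
      by rewrite (le_trans (andP cab).1 (ltW cy)) /= ge_min lexx orbT.
    apply/ltW/He; rewrite /ball /= distrC gtr0_norm ?subr_gt0// ltrBlDl.
    by rewrite (le_lt_trans (_ : y <= c + e / 2)) ?ge_min ?lexx// ltrD2l gtr_pMr ?invf_lt1 ?ltr1n.
  by rewrite leNgt cy.
have [e e0 He] := is_derive_gt0_right (fd _ cab) (f0 _ cab fc).
pose y := Num.min (c + e / 2) b.
have cy : c < y by rewrite lt_min cb ltrDl divr_gt0.
have : y <= c.
  apply: (ub_le_sup supS.2); split.
    by rewrite (le_trans (andP cab).1 (ltW cy)) /= ge_min lexx orbT.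
  rewrite -fc ltW// He// cy/=.
  by rewrite (le_lt_trans (_ : y <= c + e / 2)) ?ge_min ?lexx// ltrD2l gtr_pMr ?invf_lt1 ?ltr1n.
by rewrite leNgt cy.
Qed.

(** ** Solutions of a scalar equation between two barriers *)

Section BetweenBarriers.
Variables (R : realType) (g : R -> R -> R) (x0 : R).
Variables (al be dal dbe : R -> R).
Let m (x : R) : R := Num.max x0 x.
Hypothesis al_der : forall x, x0 <= x -> is_derive x 1 al (dal x).
Hypothesis be_der : forall x, x0 <= x -> is_derive x 1 be (dbe x).
Hypothesis al_be : forall x, x0 <= x -> al x <= be x.
Hypothesis al_sub : forall x, x0 <= x -> dal x <= g x (al x).
Hypothesis be_super : forall x, x0 <= x -> g x (be x) <= dbe x.
Hypothesis g_mono : forall x z z', x0 <= x -> al x <= z -> z <= z' ->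
  z' <= be x -> g x z <= g x z'.
Hypothesis g_cont : forall z, continuous z ->
  (forall x, x0 <= x -> al x <= z x <= be x) ->
  continuous (fun x => g (m x) (z (m x))).

Let mE x : x0 <= x -> m x = x. Proof. by move=> ?; rewrite /m max_r. Qed.
Let x0m x : x0 <= m x. Proof. by rewrite /m le_max lexx. Qed.
Let m_cont : continuous m.
Proof. by move=> x; apply: (@continuous_max R R (cst x0) id) => //; exact: cvg_cst. Qed.

Let clamp_cont (w dw : R -> R) :
  (forall x, x0 <= x -> is_derive x 1 w (dw x)) -> continuous (w \o m).
Proof.
move=> wd x; apply: continuous_comp; first exact: m_cont.
exact: is_derive_continuous (wd _ (x0m x)).
Qed.

Let rhs (w : R -> R) x := g (m x) (w (m x)).
Let between (w : R -> R) := forall x, x0 <= x -> al x <= w x <= be x.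

Let rhs_le (w w' : R -> R) : between w -> between w' ->
  (forall x, x0 <= x -> w x <= w' x) -> forall x, rhs w x <= rhs w' x.
Proof.
move=> bw bw' ww' x; apply: g_mono => //; last exact: (andP (bw' _ (x0m x))).2.
- exact: (andP (bw _ (x0m x))).1.
- exact: ww'.
Qed.

Let between_al : between al.
Proof. by move=> x xx; rewrite lexx al_be. Qed.
Let between_be : between be.
Proof. by move=> x xx; rewrite lexx al_be. Qed.

Let rhs_cont (w : R -> R) : between w -> continuous (w \o m) -> continuous (rhs w).
Proof.
move=> bw cw; have := g_cont cw; rewrite /rhs.
have -> : (fun x => g (m x) ((w \o m) (m x))) = (fun x => g (m x) (w (m x))).
  by apply/funext => x /=; rewrite (mE (x0m x)).
by apply => x xx /=; rewrite mE// bw.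
Qed.

Let incr_le (f h df dh : R -> R) x x' :
  (forall x, x0 <= x -> is_derive x 1 f (df x)) ->
  (forall x, x0 <= x -> is_derive x 1 h (dh x)) ->
  (forall x, x0 <= x -> df x <= dh x) -> x0 <= x -> x <= x' ->
  f x' - f x <= h x' - h x.
Proof.
move=> fd hd fh xx xx'.
have := @le_is_derive R (h - f) (dh - df) x x' xx'.
have H y : x <= y <= x' -> x0 <= y by move=> /andP[xy _]; exact: le_trans xy.
rewrite !fctE => /(_ (fun y yx => is_deriveB (hd y (H y yx)) (fd y (H y yx)))).
suff E : forall y, x <= y <= x' -> 0 <= (dh - df) y by move=> /(_ E); lra.
by move=> y /H yx; rewrite !fctE subr_ge0 fh.
Qed.

(** The least fixed point of the integral operator exists by the argument of
    Knaster and Tarski: it is the supremum of the subsolutions whose increments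
    are controlled by the two extreme right-hand sides.  That control is what
    makes the supremum continuous, so that it can be integrated again. *)
Lemma solution_between :
  exists z, forall x, x0 <= x ->
    al x <= z x <= be x /\ is_derive x 1 z (g x (z x)).
Proof.
have cal := rhs_cont between_al (clamp_cont al_der).
have cbe := rhs_cont between_be (clamp_cont be_der).
have [A [A0 Ad]] := antiderivative x0 cal.
have [B [B0 Bd]] := antiderivative x0 cbe.
pose incr (w : R -> R) := forall x x', x0 <= x -> x <= x' ->
  A x' - A x <= w x' - w x <= B x' - B x.
have AB x x' : x0 <= x -> x <= x' -> A x' - A x <= B x' - B x.
  move=> xx xx'; apply: (incr_le Ad Bd) => // y _.
  by apply: rhs_le => //; exact: between_be.
have next w : between w -> continuous (rhs w) ->
    exists H, [/\ forall x, x0 <= x -> is_derive x 1 H (rhs w x), H x0 = al x0,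
      between H & incr H].
  move=> bw cw; have [H [H0 Hd]] := antiderivative x0 cw.
  have Hd' x : x0 <= x -> is_derive x 1 (fun x => H x + al x0) (rhs w x).
    by move=> /Hd ?; rewrite -[rhs w x]addr0; apply: is_deriveD.
  exists (fun x => H x + al x0); split => //; first by rewrite H0 add0r.
  - move=> x xx.
    have h1 : al x - al x0 <= (H x + al x0) - (H x0 + al x0).
      apply: (incr_le al_der Hd') => // y yy; rewrite /rhs mE//.
      apply: le_trans (al_sub yy) _; apply: g_mono => //; have /andP[] := bw y yy => //.
    have h2 : (H x + al x0) - (H x0 + al x0) <= be x - be x0.
      apply: (incr_le Hd' be_der) => // y yy; rewrite /rhs mE//.
      apply: le_trans _ (be_super yy); apply: g_mono => //; have /andP[] := bw y yy => //.
    have := al_be (lexx x0); move: h1 h2; rewrite H0; lra.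
  - move=> x x' xx xx'; apply/andP; split.
      by apply: (incr_le Ad Hd') => // y _; apply: rhs_le => // z zz; have /andP[] := bw z zz.
    by apply: (incr_le Hd' Bd) => // y _; apply: rhs_le => // z zz; have /andP[] := bw z zz.
have incr_cont w : incr w -> continuous (w \o m).
  move=> iw x.
  have Bm : continuous (B \o m) := clamp_cont Bd.
  have Am : continuous (A \o m) := clamp_cont Ad.
  apply/cvgrPdist_le => e e0.
  have /cvgrPdist_le /(_ e e0) Bx := Bm x.
  have /cvgrPdist_le /(_ e e0) Ax := Am x.
  near=> y.
  have : `|(B \o m) x - (B \o m) y| <= e by near: y.
  have : `|(A \o m) x - (A \o m) y| <= e by near: y.
  rewrite /= !ler_norml.
  have [xy|/ltW xy] := leP (m x) (m y).
    by have /andP[] := iw _ _ (x0m x) xy; lra.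
  by have /andP[] := iw _ _ (x0m y) xy; lra.
pose S (w : R -> R) := [/\ between w, incr w & exists2 H,
  (forall x, x0 <= x -> is_derive x 1 H (rhs w x)) /\ H x0 = al x0 &
  forall x, x0 <= x -> w x <= H x].
have SP w H : between w -> incr w -> between H ->
   (forall x, x0 <= x -> is_derive x 1 H (rhs w x)) -> H x0 = al x0 -> incr H ->
   (forall x, x0 <= x -> w x <= H x) -> S H.
  move=> bw iw bH Hd H0 iH wH; split=> //.
  have [K [Kd K0 bK iK]] := next H bH (rhs_cont bH (incr_cont _ iH)).
  exists K => // x xx.
  have : H x - H x0 <= K x - K x0 by apply: (incr_le Hd Kd) => // y _; exact: rhs_le.
  by rewrite H0 K0; lra.
have [w0 [w0d w00 bw0 iw0]] := next al between_al cal.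
have Sw0 : S w0.
  split=> //; have [K [Kd K0 bK iK]] := next w0 bw0 (rhs_cont bw0 (incr_cont _ iw0)).
  exists K => // x xx.
  have : w0 x - w0 x0 <= K x - K x0.
    by apply: (incr_le w0d Kd) => // y _; apply: rhs_le => // z zz; have /andP[] := bw0 z zz.
  by rewrite w00 K0; lra.
pose V x := [set w x | w in S]%classic.
pose z x := sup (V x).
have Vsup x : x0 <= x -> has_sup (V x).
  move=> xx; split; first by exists (w0 x); exists w0.
  by exists (be x) => _ [w [bw _ _] <-]; have /andP[] := bw x xx.
have zub w x : S w -> x0 <= x -> w x <= z x.
  by move=> Sw xx; apply: (ub_le_sup (Vsup x xx).2); exists w.
have zle x c : x0 <= x -> (forall w, S w -> w x <= c) -> z x <= c.
  move=> xx H; apply: ge_sup; first by case: (Vsup x xx).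
  by move=> _ [w Sw <-]; exact: H.
have bz : between z.
  move=> x xx; apply/andP; split.
    by apply: le_trans (zub _ _ Sw0 xx); have /andP[] := bw0 x xx.
  by apply: zle => // w [bw _ _]; have /andP[] := bw x xx.
have iz : incr z.
  move=> x x' xx xx'; have xx0 := le_trans xx xx'.
  apply/andP; split.
    rewrite lerBrDl -lerBrDr; apply: zle => // w Sw.
    by have := zub w x' Sw xx0; case: Sw => _ /(_ x x' xx xx')/andP[]; lra.
  rewrite lerBlDr; apply: zle => // w Sw.
  by have := zub w x Sw xx; case: Sw => _ /(_ x x' xx xx')/andP[]; lra.
have [H [Hd H0 bH iH]] := next z bz (rhs_cont bz (incr_cont _ iz)).
have zH x : x0 <= x -> z x <= H x.
  move=> xx; apply: zle => // w Sw; have wz := zub w ^~ Sw.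
  case: Sw => bw _ [K [Kd K0] wK]; apply: le_trans (wK x xx) _.
  have : K x - K x0 <= H x - H x0.
    by apply: (incr_le Kd Hd) => // y _; apply: rhs_le => // t tt; exact: wz.
  by rewrite H0 K0; lra.
have Hz x : x0 <= x -> H x = z x.
  by move=> xx; apply/le_anti; rewrite zH// zub//; exact: (SP z H).
exists H => x xx; split; first exact: bH.
by rewrite Hz//; have := Hd x xx; rewrite /rhs mE.
Unshelve. all: by end_near. Qed.

End BetweenBarriers.

Lemma near_ereal_interval (R : realType) (a b : \bar R) (t : R) :
  (a < t%:E < b)%E -> \forall s \near t, (a < s%:E < b)%E.
Proof.
move=> /andP[at_ tb]; near=> s; apply/andP; split; near: s.
  case: a at_ => [a| |] //= at_; last by near=> s; rewrite ltNyr.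
  by near=> s; rewrite lte_fin; near: s; apply: lt_nbhsr; rewrite -lte_fin.
case: b tb => [b| |] //= tb; last by near=> s; rewrite ltry.
by near=> s; rewrite lte_fin; near: s; apply: lt_nbhsl; rewrite -lte_fin.
Unshelve. all: by end_near. Qed.

Lemma increasing_on_interval (R : realType) (f df : R -> R) (a b : \bar R) :
  (forall t, (a < t%:E < b)%E -> is_derive t 1 f (df t) /\ 0 < df t) ->
  forall s t, (a < s%:E)%E -> (t%:E < b)%E -> s < t -> f s < f t.
Proof.
move=> fd s t as_ tb st.
have H x : s <= x <= t -> (a < x%:E < b)%E.
  move=> /andP[sx xt]; rewrite (lt_le_trans as_) ?lee_fin//=.
  by rewrite (le_lt_trans _ tb) ?lee_fin.
by apply: (@lt_is_derive R f df s t st) => x /H /fd [].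
Qed.

(** The inverse is chosen pointwise: the interval may be unbounded, and only
    its values on the image of [f] matter. *)
Lemma inverse_is_derive (R : realType) (f df : R -> R) (a b : \bar R) :
  (forall t, (a < t%:E < b)%E -> is_derive t 1 f (df t) /\ 0 < df t) ->
  exists g, forall t, (a < t%:E < b)%E ->
    g (f t) = t /\ is_derive (f t) 1 g (df t)^-1.
Proof.
move=> fd; have f_inc := increasing_on_interval fd.
pose g y := xget 0 [set t | (a < t%:E < b)%E /\ f t = y]%classic.
have gf t : (a < t%:E < b)%E -> g (f t) = t.
  move=> tab; rewrite /g; case: xgetP => [s _ [/andP[as_ sb] fst]|/(_ t)]; last first.
    by case.
  case: (ltgtP s t) => // [st|ts].
    by have := f_inc _ _ as_ (andP tab).2 st; rewrite fst ltxx.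
  by have := f_inc _ _ (andP tab).1 sb ts; rewrite fst ltxx.
exists g => t tab; split; first exact: gf.
have [ft df0] := fd t tab.
apply: is_derive_inverse => //; last by rewrite gt_eqF.
- by near=> s; apply: gf; near: s; exact: near_ereal_interval.
- near=> s; have sab : (a < s%:E < b)%E by near: s; exact: near_ereal_interval.
  by have [fs _] := fd s sab; exact: (is_derive_continuous fs).
Unshelve. all: by end_near. Qed.

(** * Solutions of [y y' = Q0 + Q1 y + Q2 y^2] above a barrier *)

Lemma poly_antiderivative (R : realType) (p : {poly R}) :
  exists q : {poly R}, q^`() = p.
Proof.
exists (\poly_(i < (size p).+1) (p`_i.-1 / i%:R)).
apply/polyP => i; rewrite coef_deriv coef_poly ltnS /=.
case: ltnP => [_|ip]; last by rewrite mul0rn nth_default.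
by rewrite -(mulr_natr (_ / _)) divfK// pnatr_eq0.
Qed.

Lemma horner_continuous (R : realType) (p : {poly R}) : continuous (horner p).
Proof. by move=> x; exact: is_derive_continuous. Qed.

Definition cherkas_slope (R : realType) (Q0 Q1 Q2 : {poly R}) (T y : R) : R :=
  (Q0.[T] + Q1.[T] * y + Q2.[T] * y ^+ 2) / y.

(** After removing the linear term by the substitution [y = exp(int Q2) z] the
    right-hand side is increasing in [z], because [Q0 <= 0]. *)
Lemma solution_above (R : realType) (Q0 Q1 Q2 : {poly R}) (T0 : R) (Y dY : R -> R) :
  (forall T, T0 <= T -> [/\ 0 < Y T, is_derive T 1 Y (dY T), Q0.[T] <= 0 &
     Y T * dY T <= Q0.[T] + Q1.[T] * Y T + Q2.[T] * Y T ^+ 2]) ->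
  exists y : R -> R, forall T, T0 <= T ->
    0 < y T /\ is_derive T 1 y (cherkas_slope Q0 Q1 Q2 T (y T)).
Proof.
move=> HY; have [q qE] := poly_antiderivative Q2.
pose e T := expR q.[T].
have ed (T : R) : is_derive T 1 e (Q2.[T] * e T).
  have ? := is_derive_poly q T.
  by apply: is_derive_eq; rewrite qE mulrC.
have e0 T : 0 < e T by exact: expR_gt0.
have ec : continuous e by move=> T; exact: is_derive_continuous (ed T).
have einv (T : R) : is_derive T 1 (fun x => (e x)^-1) (- (Q2.[T] / e T)).
  have := @is_deriveV _ e T _ 1 _ (ed T); rewrite gt_eqF// => /(_ isT) H.
  apply: is_derive_eq; rewrite /GRing.scale /=; field; rewrite gt_eqF//.
pose al T := Y T / e T.
pose dal T := dY T / e T - Y T * (Q2.[T] / e T).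
have ald (T : R) : T0 <= T -> is_derive T 1 al (dal T).
  move=> /HY[_ Yd _ _]; have ? := einv T.
  by apply: is_derive_eq; rewrite /GRing.scale /= /dal; ring.
have al0 T : T0 <= T -> 0 < al T by move=> /HY[? _ _ _]; rewrite divr_gt0.
pose g T z := Q1.[T] / e T + Q0.[T] / (e T ^+ 2 * z).
have als T : T0 <= T -> dal T <= g T (al T).
  move=> TT; have [Y0 _ _ H] := HY T TT.
  have -> : g T (al T) = (Q1.[T] * Y T + Q0.[T]) / (e T * Y T).
    by rewrite /g /al; field; rewrite !gt_eqF.
  have -> : dal T = (Y T * dY T - Q2.[T] * Y T ^+ 2) / (e T * Y T).
    by rewrite /dal; field; rewrite !gt_eqF.
  rewrite ler_pM2r ?invr_gt0 ?mulr_gt0//; lra.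
pose h T := (1 + Q1.[T] ^+ 2) / e T.
have hc : continuous h.
  move=> T; apply: cvgM; last by apply: cvgV; [rewrite gt_eqF | exact: ec].
  apply: cvgD; first exact: cvg_cst.
  by apply: cvgM; exact: horner_continuous.
have gh T z : T0 <= T -> 0 < z -> g T z <= h T.
  move=> /HY[_ _ Q00 _] z0; rewrite /g /h.
  have : Q0.[T] / (e T ^+ 2 * z) <= 0.
    by rewrite mulr_le0_ge0// invr_ge0 mulr_ge0 ?ltW// exprn_gt0.
  have : Q1.[T] / e T <= (1 + Q1.[T] ^+ 2) / e T.
    by rewrite ler_pM2r ?invr_gt0//; nra.
  lra.
have [H [H0 Hd]] := antiderivative T0 hc.
pose be T := H T + al T0.
have bed (T : R) : T0 <= T -> is_derive T 1 be (h T).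
  by move=> /Hd ?; rewrite -[h T]addr0; apply: is_deriveD.
have albe T : T0 <= T -> al T <= be T.
  move=> TT; rewrite -subr_ge0.
  have -> : 0 = be T0 - al T0 by rewrite /be H0 add0r subrr.
  apply: (@le_is_derive R (be - al) (fun T => h T - dal T) _ _ TT) => S /andP[TS _].
    by apply: is_deriveB; [exact: bed | exact: ald].
  by rewrite subr_ge0 (le_trans (als S TS))// gh// al0.
have [|||z zP] := @solution_between R g T0 al be dal h ald bed albe als _ _ _.
- by move=> T TT; apply: gh => //; apply: lt_le_trans (al0 _ TT) (albe _ TT).
- move=> T z z' TT alz zz' z'be; rewrite /g lerD2l.
  have z0 : 0 < z by exact: lt_le_trans (al0 T TT) alz.
  have [_ _ Q00 _] := HY T TT.
  rewrite ler_wnM2l// lef_pV2 ?posrE ?mulr_gt0 ?exprn_gt0// ?(lt_le_trans z0)//.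
  by rewrite ler_pM2l// exprn_gt0.
- move=> z zc zb T.
  have mc : {for T, continuous (fun x : R => Num.max T0 x)}.
    by apply: (@continuous_max R R (cst T0) id) => //; exact: cvg_cst.
  have T0m : T0 <= Num.max T0 T by rewrite le_max lexx.
  have z0 : 0 < z (Num.max T0 T).
    by apply: lt_le_trans (al0 _ T0m) _; have /andP[] := zb _ T0m.
  have cc (p : R -> R) : continuous p -> {for T, continuous (fun x => p (Num.max T0 x))}.
    by move=> pc; apply: continuous_comp; [exact: mc | exact: pc].
  apply: cvgD.
    apply: cvgM; first exact/cc/horner_continuous.
    by apply: cvgV; [rewrite gt_eqF | exact/cc/ec].
  apply: cvgM; first exact/cc/horner_continuous.
  apply: cvgV; first by rewrite gt_eqF// mulr_gt0// exprn_gt0.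
  by apply: cvgM; [apply: cvgM; exact/cc/ec | exact/cc/zc].
exists (fun T => e T * z T) => T TT; have [/andP[alz _] zd] := zP T TT.
have z0 : 0 < z T by exact: lt_le_trans (al0 T TT) alz.
split; first by rewrite mulr_gt0.
have ? := ed T.
by apply: is_derive_eq; rewrite /GRing.scale /= /cherkas_slope /g; field; rewrite !gt_eqF.
Qed.

(** Here [z = (y / exp(int Q2))^2] satisfies an equation whose right-hand side
    increases with [z] because [Q1 >= 0], and constants are subsolutions. *)
Lemma solution_repelled (R : realType) (Q0 Q1 Q2 : {poly R}) (T0 : R) :
  (forall T, T0 <= T -> 0 <= Q0.[T] /\ 0 <= Q1.[T]) ->
  exists y : R -> R, forall T, T0 <= T ->
    0 < y T /\ is_derive T 1 y (cherkas_slope Q0 Q1 Q2 T (y T)).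
Proof.
move=> HQ; have [q qE] := poly_antiderivative Q2.
pose e T := expR q.[T].
have ed (T : R) : is_derive T 1 e (Q2.[T] * e T).
  have ? := is_derive_poly q T.
  by apply: is_derive_eq; rewrite qE mulrC.
have e0 T : 0 < e T by exact: expR_gt0.
have ec : continuous e by move=> T; exact: is_derive_continuous (ed T).
pose h T := 2 * Q0.[T] / e T ^+ 2 + 2 * Q1.[T] / e T.
have h0 T : T0 <= T -> 0 <= h T.
  by move=> /HQ[? ?]; rewrite addr_ge0 ?divr_ge0 ?mulr_ge0// ltW.
have hc : continuous h.
  move=> T; apply: cvgD.
    apply: cvgM; last first.
      by apply: cvgV; [rewrite gt_eqF// exprn_gt0 | apply: cvgM; exact: ec].
    by apply: cvgM; [exact: cvg_cst | exact: horner_continuous].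
  apply: cvgM; last by apply: cvgV; [rewrite gt_eqF | exact: ec].
  by apply: cvgM; [exact: cvg_cst | exact: horner_continuous].
have [H [H0 Hd]] := antiderivative T0 hc.
have Hge0 T : T0 <= T -> 0 <= H T.
  move=> TT; rewrite -H0; apply: (@le_is_derive R H h _ _ TT) => x /andP[xT _].
    exact: Hd.
  exact: h0.
pose g T z := 2 * Q0.[T] / e T ^+ 2 + 2 * Q1.[T] / e T * Num.sqrt z.
pose al (T : R) : R := 1.
pose be (T : R) := expR (H T).
have ald (T : R) : T0 <= T -> is_derive T 1 al 0 by move=> _; exact: is_derive_cst.
have bed (T : R) : T0 <= T -> is_derive T 1 be (h T * be T).
  by move=> /Hd ?; apply: is_derive_eq; rewrite mulrC.
have albe T : T0 <= T -> al T <= be T.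
  move=> /Hge0 H1; have : expR 0 <= expR (H T) by rewrite ler_expR.
  by rewrite expR0.
have [||||z zP] := @solution_between R g T0 al be (fun=> 0) (fun T => h T * be T) ald bed albe _ _ _ _.
- by move=> T /h0; rewrite /g /al sqrtr1 mulr1.
- move=> T TT; rewrite /g /h [leRHS]mulrDl; have [q0 q1] := HQ T TT; have be1 := albe T TT.
  apply: lerD; first by rewrite ler_peMr ?divr_ge0 ?mulr_ge0// ltW// exprn_gt0.
  rewrite ler_wpM2l ?divr_ge0 ?mulr_ge0//; first by rewrite ltW.
  have be0 : 0 <= be T by exact: expR_ge0.
  rewrite -[leRHS]sqr_sqrtr// expr2 ler_peMr ?sqrtr_ge0//.
  by rewrite -[leLHS]sqrtr1 ler_sqrt// expR_gt0.
- move=> T z z' TT z1 zz' _; rewrite /g lerD2l ler_wpM2l//.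
    by have [? ?] := HQ T TT; rewrite divr_ge0 ?mulr_ge0// ltW.
  by rewrite ler_wsqrtr.
- move=> z zc zb T.
  have mc : {for T, continuous (fun x : R => Num.max T0 x)}.
    by apply: (@continuous_max R R (cst T0) id) => //; exact: cvg_cst.
  have cc (p : R -> R) : continuous p -> {for T, continuous (fun x => p (Num.max T0 x))}.
    by move=> pc; apply: continuous_comp; [exact: mc | exact: pc].
  have sc : {for T, continuous (fun x => Num.sqrt (z (Num.max T0 x)))}.
    by apply: continuous_comp; [exact: cc | exact: sqrt_continuous].
  apply: cvgD.
    apply: cvgM; last first.
      apply: cvgV; [by rewrite gt_eqF// exprn_gt0 | apply: cvgM; exact/cc/ec].
    by apply: cvgM; [exact: cvg_cst | exact/cc/horner_continuous].
  apply: cvgM; last exact: sc.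
  apply: cvgM; last by apply: cvgV; [rewrite gt_eqF | exact/cc/ec].
  by apply: cvgM; [exact: cvg_cst | exact/cc/horner_continuous].
exists (fun T => e T * Num.sqrt (z T)) => T TT; have [/andP[alz _] zd] := zP T TT.
have z0 : 0 < z T by exact: lt_le_trans alz.
have sz0 : 0 < Num.sqrt (z T) by rewrite sqrtr_gt0.
split; first by rewrite mulr_gt0.
have ? := ed T; have ? := is_derive1_sqrt z0.
apply: is_derive_eq; rewrite /GRing.scale /= /cherkas_slope /g.
by field; rewrite !gt_eqF.
Qed.

(** The coefficient of [dT] in [P(x) dx] for [x = s T^r]. *)
Definition ramify (R : realType) (s : R) (r : nat) (P : {poly R}) : {poly R} :=
  (s * r%:R) *: ('X^(r.-1) * (P \Po (s *: 'X^r))).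

Lemma horner_ramify (R : realType) (s : R) r (P : {poly R}) T :
  (ramify s r P).[T] = s * r%:R * T ^+ r.-1 * P.[s * T ^+ r].
Proof.
by rewrite /ramify hornerZ hornerM hornerXn horner_comp hornerZ hornerXn mulrA.
Qed.

(** The graph of a solution over a half-line, in the parameter [T] with
    [x = s T^r].  The exponent [r] allows for barriers that are polynomials in a
    root of [1 / x], and [c] only fixes the sign of [y]. *)
Definition escaping (R : realType) (P0 P1 P2 : {poly R}) (s : R) (r : nat) :=
  exists (c T0 : R) (y : R -> R), 0 < T0 /\ forall T, T0 <= T ->
    0 < c * y T /\
    is_derive T 1 y (cherkas_slope (ramify s r P0) (ramify s r P1) (ramify s r P2) T (y T)).

Lemma reflected_solution (R : realType) (Q0 Q1 Q2 : {poly R}) (T0 : R) (y : R -> R) :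
  (forall T, T0 <= T -> 0 < y T /\ is_derive T 1 y (cherkas_slope Q0 (- Q1) Q2 T (y T))) ->
  forall T, T0 <= T -> 0 < -1 * (- y T) /\
    is_derive T 1 (- y) (cherkas_slope Q0 Q1 Q2 T (- y T)).
Proof.
move=> yP T /yP[y0 yd]; rewrite mulN1r opprK; split=> //.
apply: is_derive_eq; rewrite /cherkas_slope hornerN; field.
by rewrite gt_eqF.
Qed.

(** A barrier of negative sign is turned into one of positive sign by the
    symmetry [(y, Q1) -> (- y, - Q1)]. *)
Lemma escaping_above (R : realType) (P0 P1 P2 : {poly R}) s r (c T0 : R) (Y dY : R -> R) :
  (forall T, T0 <= T -> [/\ 0 < c * Y T, is_derive T 1 Y (dY T), (ramify s r P0).[T] <= 0 &
     Y T * dY T <= (ramify s r P0).[T] + (ramify s r P1).[T] * Y T + (ramify s r P2).[T] * Y T ^+ 2]) ->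
  escaping P0 P1 P2 s r.
Proof.
move=> HY; pose T1 := Num.max T0 1.
have T01 : T0 <= T1 by rewrite le_max lexx.
have T10 : 0 < T1 by rewrite lt_max ltr01 orbT.
case: (ltrgt0P c) => [c0|c0|c0]; last first.
- by have [] := HY T0 (lexx _); rewrite c0 mul0r ltxx.
- have [|y yP] := @solution_above R (ramify s r P0) (- ramify s r P1) (ramify s r P2) T1 (- Y) (- dY).
    move=> T T1T; have [Y0 Yd Q0 HYd] := HY T (le_trans T01 T1T); split=> //.
    - by rewrite !fctE; move: Y0; rewrite nmulr_rgt0// oppr_gt0.
    - by apply: is_deriveN.
    - by rewrite !fctE mulrNN hornerN; lra.
  exists (-1), T1, (- y); split=> // T TT.
  exact: reflected_solution yP T TT.
- have [|y yP] := @solution_above R (ramify s r P0) (ramify s r P1) (ramify s r P2) T1 Y dY.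
    move=> T T1T; have [Y0 Yd Q0 HYd] := HY T (le_trans T01 T1T); split=> //.
    by move: Y0; rewrite pmulr_rgt0.
  exists 1, T1, y; split=> // T TT; rewrite mul1r; exact: yP.
Qed.

(** If [P0] pushes away from [y = 0] a solution exists on the side towards
    which [P1] pushes as well. *)
Lemma escaping_repelled (R : realType) (P0 P1 P2 : {poly R}) s r (T0 : R) :
  (forall T, T0 <= T -> 0 <= (ramify s r P0).[T]) ->
  (forall T, T0 <= T -> 0 <= (ramify s r P1).[T]) \/
  (forall T, T0 <= T -> (ramify s r P1).[T] <= 0) ->
  escaping P0 P1 P2 s r.
Proof.
move=> H0 H1; pose T1 := Num.max T0 1.
have T01 : T0 <= T1 by rewrite le_max lexx.
have T10 : 0 < T1 by rewrite lt_max ltr01 orbT.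
case: H1 => H1.
- have [|y yP] := @solution_repelled R (ramify s r P0) (ramify s r P1) (ramify s r P2) T1.
    by move=> T /(le_trans T01) TT; rewrite H0// H1.
  exists 1, T1, y; split=> // T TT; rewrite mul1r; exact: yP.
- have [|y yP] := @solution_repelled R (ramify s r P0) (- ramify s r P1) (ramify s r P2) T1.
    by move=> T /(le_trans T01) TT; rewrite H0//= hornerN oppr_ge0 H1.
  exists (-1), T1, (- y); split=> // T TT.
  exact: reflected_solution yP T TT.
Qed.

(** * Behaviour at infinity *)

Local Open Scope classical_set_scope.

Lemma near_pinfty_from (R : realType) (P : R -> Prop) :
  (\forall T \near +oo, P T) <-> exists T0, forall T, T0 <= T -> P T.
Proof.
split=> [[M [_ MP]]|[T0 TP]].
  by exists (M + 1) => T MT; apply: MP; rewrite (lt_le_trans _ MT)// ltrDl.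
by exists T0; split=> [|T /ltW /TP//]; exact: num_real.
Qed.

Lemma cvg_inv_pinfty (R : realType) : (fun T : R => T^-1) @ +oo --> (0 : R).
Proof.
apply/(@gtr0_cvgV0 _ _ _ _ (fun T : R => T)); last exact: cvg_id.
by apply/near_pinfty_from; exists 1 => T; exact: lt_le_trans.
Qed.

Lemma cvg_divX_pinfty (R : realType) (c : R) (k : nat) : (0 < k)%N ->
  (fun T : R => c / T ^+ k) @ +oo --> (0 : R).
Proof.
move=> k0; have -> : (0 : R) = c * 0 ^+ k by rewrite expr0n gtn_eqF// mulr0.
have -> : (fun T : R => c / T ^+ k) = (fun T : R => c * T^-1 ^+ k).
  by apply/funext => T; rewrite exprVn.
apply: cvgM; first exact: cvg_cst.
case: k k0 => // k _; elim: k => [|k IH].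
  by under eq_fun do rewrite expr1; rewrite expr1; exact: cvg_inv_pinfty.
under eq_fun do rewrite exprS; rewrite exprS.
by apply: cvgM => //; exact: cvg_inv_pinfty.
Qed.

Lemma cvg_horner (R : realType) (F : set_system R) {FF : Filter F} (p : {poly R})
    (f : R -> R) (l : R) :
  f @ F --> l -> (fun T => p.[f T]) @ F --> p.[l].
Proof. by move=> fl; apply: continuous_cvg => //; exact: horner_continuous. Qed.

Lemma horner_reversal (R : realType) (n : nat) (P : {poly R}) (x : R) :
  (size P <= n.+1)%N -> x != 0 -> P.[x] = x ^+ n * (reversal n P).[x^-1].
Proof.
move=> sP x0; rewrite (horner_coef_wide _ sP) horner_poly mulr_sumr.
rewrite (reindex_inj rev_ord_inj) /=; apply: eq_bigr => i _.
have iN : (i <= n)%N by rewrite -ltnS.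
rewrite subSS exprVn mulrCA; congr (_ * _).
by rewrite exprB ?unitfE.
Qed.

Lemma reversal0 (R : realType) (n : nat) (P : {poly R}) : (reversal n P).[0] = P`_n.
Proof. by rewrite horner_coef0 coef_poly /= subn0. Qed.

Lemma poly_eventual_sign (R : realType) (p : {poly R}) :
  p != 0 -> \forall T \near +oo, 0 < lead_coef p * p.[T].
Proof.
move=> p0; pose d := (size p).-1.
have sp : (size p <= d.+1)%N by rewrite /d prednK// size_poly_gt0.
have : (fun T : R => lead_coef p * (reversal d p).[T^-1]) @ +oo -->
    lead_coef p * lead_coef p.
  apply: cvgM; first exact: cvg_cst.
  rewrite lead_coefE -/d -reversal0; apply: cvg_horner; exact: cvg_inv_pinfty.
move=> /cvgr_gt H.
have : \forall T \near +oo, 0 < lead_coef p * (reversal d p).[T^-1].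
  by apply: H; rewrite -expr2 exprn_even_gt0//= lead_coef_eq0.
apply: filter_app; near=> T; move=> HT.
have T0 : 0 < T by near: T; apply/near_pinfty_from; exists 1 => T; exact: lt_le_trans.
by rewrite (horner_reversal sp) ?gt_eqF// mulrCA pmulr_rgt0// exprn_gt0.
Unshelve. all: by end_near. Qed.

Lemma poly_eventually_monotone_sign (R : realType) (p : {poly R}) :
  (\forall T \near +oo, 0 <= p.[T]) \/ (\forall T \near +oo, p.[T] <= 0).
Proof.
have [->|p0] := eqVneq p 0.
  by left; near=> T; rewrite horner0.
have := poly_eventual_sign p0; have : lead_coef p != 0 by rewrite lead_coef_eq0.
rewrite neq_lt => /orP[lp|lp] H.
- right; apply: filter_app H; near=> T.
  by rewrite nmulr_rgt0// => /ltW.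
- left; apply: filter_app H; near=> T.
  by rewrite pmulr_rgt0// => /ltW.
Unshelve. all: by end_near. Qed.

(** The limit is the supremum of the levels that the function eventually
    exceeds. *)
Lemma cvg_of_levels (R : realType) (f : R -> R) (B : R) :
  (forall T, `|f T| <= B) ->
  (forall l, (\forall T \near +oo, l <= f T) \/ (\forall T \near +oo, f T <= l)) ->
  exists L : R, f @ +oo --> L.
Proof.
move=> fB fl; pose S := [set l | \forall T \near +oo, l <= f T].
have SB l : S l -> l <= B.
  move=> /near_pinfty_from[T0 /(_ T0 (lexx _)) lf].
  by apply: le_trans lf _; apply: le_trans (ler_norm _) _.
have supS : has_sup S.
  split; last by exists B => l; exact: SB.
  exists (- B); apply/near_pinfty_from; exists 0 => T _.
  by have := fB T; rewrite ler_norml => /andP[].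
exists (sup S); apply/cvgrPdist_le => e e0.
have [l Sl ll] := sup_adherent e0 supS.
have Sn : ~ S (sup S + e).
  by move=> /(ub_le_sup supS.2); rewrite leNgt ltrDl e0.
case: (fl (sup S + e)) => // fle.
apply: filter_app Sl; apply: filter_app fle; near=> T => h1 h2.
by rewrite ler_norml; apply/andP; split; lra.
Unshelve. all: by end_near. Qed.

Lemma is_derive_monomial (R : realType) (s : R) (r : nat) (T : R) :
  is_derive T 1 (fun T => s * T ^+ r) (s * r%:R * T ^+ r.-1).
Proof.
have -> : (fun T : R => s * T ^+ r) = horner (s *: 'X^r).
  by apply/funext => x; rewrite hornerZ hornerXn.
apply: is_derive_eq; rewrite derivZ derivXn hornerZ hornerMn hornerXn.
by rewrite -[X in _ * X]mulr_natl mulrA.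
Qed.

(** The difference between a solution [y] and a line [k x] satisfies a linear
    equation whose inhomogeneous part is a polynomial over [y], of eventually
    constant sign.  Multiplied by an integrating factor the difference becomes
    eventually monotone, so it has eventually constant sign as well. *)
Lemma slope_levels (R : realType) (P0 P1 P2 : {poly R}) (s c T0 : R) (r : nat)
    (y : R -> R) (k : R) :
  (forall T, T0 <= T -> 0 < c * y T /\ is_derive T 1 y
    (cherkas_slope (ramify s r P0) (ramify s r P1) (ramify s r P2) T (y T))) ->
  (\forall T \near +oo, 0 <= y T - k * (s * T ^+ r)) \/
  (\forall T \near +oo, y T - k * (s * T ^+ r) <= 0).
Proof.
move=> yP.
pose x (T : R) := s * T ^+ r; pose dx (T : R) := s * r%:R * T ^+ r.-1.
have xd (T : R) : is_derive T 1 x (dx T).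
  exact: is_derive_monomial.
have xc : continuous x by move=> T; exact: is_derive_continuous (xd T).
have dxc : continuous dx.
  by move=> T; exact: is_derive_continuous (is_derive_monomial (s * r%:R) r.-1 T).
have y0 T : T0 <= T -> y T != 0.
  by move=> /yP[+ _]; apply: contraTneq => ->; rewrite mulr0 ltxx.
pose N := P0 + k *: ('X * P1) + k ^+ 2 *: ('X^2 * P2) - k ^+ 2 *: 'X.
have NE z : N.[z] = P0.[z] + k * z * P1.[z] + (k * z) ^+ 2 * P2.[z] - k ^+ 2 * z.
  by rewrite /N !hornerE /=; ring.
pose m (T : R) := Num.max T0 T.
have T0m T : T0 <= m T by rewrite /m le_max lexx.
pose ka (T : R) := dx T * (P1.[x T] + P2.[x T] * (y T + k * x T) - k) / y T.
have kac : continuous (fun T => ka (m T)).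
  move=> T.
  have mc : {for T, continuous m}.
    by apply: (@continuous_max R R (cst T0) id) => //; exact: cvg_cst.
  have cc (p : R -> R) : continuous p -> {for T, continuous (fun x => p (m x))}.
    by move=> pc; apply: continuous_comp; [exact: mc | exact: pc].
  have hc (p : {poly R}) : {for T, continuous (fun t => p.[x (m t)])}.
    by apply: continuous_comp; [exact/cc/xc | exact: horner_continuous].
  have yc : {for T, continuous (fun t => y (m t))}.
    by apply: continuous_comp; [exact: mc | exact: is_derive_continuous (yP _ (T0m T)).2].
  apply: cvgM; last by apply: cvgV; [exact: y0 | exact: yc].
  apply: cvgM; first exact/cc/dxc.
  apply: cvgB; last exact: cvg_cst.
  apply: cvgD; first exact: hc.
  apply: cvgM; first exact: hc.
  by apply: cvgD; [exact: yc | apply: cvgM; [exact: cvg_cst | exact/cc/xc]].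
have [K [_ Kd]] := antiderivative T0 kac.
pose D T := y T - k * x T.
pose M T := D T * expR (- K T).
pose dM T := expR (- K T) * (dx T * N.[x T] / y T).
have Md (T : R) : T0 <= T -> is_derive T 1 M (dM T).
  move=> TT; have [_ yd] := yP T TT; have := Kd T TT; have mT : m T = T by rewrite /m max_r.
  rewrite mT => Kd'; have ? := xd T.
  apply: is_derive_eq; rewrite /GRing.scale /= /dM /D /ka /cherkas_slope !horner_ramify NE.
  by rewrite -/(x T) -/(dx T); field; exact: y0.
pose p := ramify s r (c *: N).
have dMp T : T0 <= T -> dM T = expR (- K T) / (c * y T) * p.[T].
  move=> TT; have [cy _] := yP T TT; rewrite /dM /p horner_ramify hornerZ -/(x T) -/(dx T).
  have c0 : c != 0 by apply: contraTneq cy => ->; rewrite mul0r ltxx.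
  by field; rewrite c0 y0.
have e0 T : T0 <= T -> 0 < expR (- K T) / (c * y T).
  by move=> /yP[cy _]; rewrite divr_gt0 ?expR_gt0.
have sM T : 0 <= M T -> 0 <= D T by rewrite /M pmulr_lge0 ?expR_gt0.
have sM' T : M T <= 0 -> D T <= 0 by rewrite /M pmulr_lle0 ?expR_gt0.
case: (poly_eventually_monotone_sign p) => /near_pinfty_from[T1 HT1].
  pose T2 := Num.max T0 T1.
  have T02 : T0 <= T2 by rewrite le_max lexx.
  have T12 : T1 <= T2 by rewrite le_max lexx orbT.
  have Minc S T : T2 <= S -> S <= T -> M S <= M T.
    move=> TS ST; apply: (@le_is_derive R M dM _ _ ST) => t /andP[St _].
      by apply: Md; rewrite (le_trans T02)// (le_trans TS).
    rewrite dMp ?(le_trans T02) ?(le_trans TS)//.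
    rewrite mulr_ge0//; first by rewrite ltW// e0// (le_trans T02)// (le_trans TS).
    by rewrite HT1// (le_trans T12)// (le_trans TS).
  have [[T3 T23 M3]|nex] := pselect (exists2 T3, T2 <= T3 & 0 <= M T3).
    left; apply/near_pinfty_from; exists T3 => T T3T; apply: sM.
    by apply: le_trans M3 _; exact: Minc.
  right; apply/near_pinfty_from; exists T2 => T TT; apply: sM'.
  by rewrite leNgt; apply/negP => MT; apply: nex; exists T => //; exact: ltW.
pose T2 := Num.max T0 T1.
have T02 : T0 <= T2 by rewrite le_max lexx.
have T12 : T1 <= T2 by rewrite le_max lexx orbT.
have Mdec S T : T2 <= S -> S <= T -> M T <= M S.
  move=> TS ST; rewrite -lerN2.
  apply: (@le_is_derive R (- M) (- dM) _ _ ST) => t /andP[St _].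
    by apply: is_deriveN; apply: Md; rewrite (le_trans T02)// (le_trans TS).
  rewrite fctE dMp ?(le_trans T02) ?(le_trans TS)//.
  rewrite oppr_ge0 mulr_ge0_le0//; first by rewrite ltW// e0// (le_trans T02)// (le_trans TS).
  by rewrite HT1// (le_trans T12)// (le_trans TS).
have [[T3 T23 M3]|nex] := pselect (exists2 T3, T2 <= T3 & M T3 <= 0).
  right; apply/near_pinfty_from; exists T3 => T T3T; apply: sM'.
  by apply: le_trans _ M3; exact: Mdec.
left; apply/near_pinfty_from; exists T2 => T TT; apply: sM.
by rewrite leNgt; apply/negP => MT; apply: nex; exists T => //; exact: ltW.
Qed.

(** By [slope_levels] the slope [y / x] cannot oscillate around any level.
    The angle is used because it stays bounded when the slope does not. *)
Lemma angle_cvg (R : realType) (P0 P1 P2 : {poly R}) (s c T0 : R) (r : nat)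
    (y : R -> R) :
  (s = 1 \/ s = -1) ->
  (forall T, T0 <= T -> 0 < c * y T /\ is_derive T 1 y
    (cherkas_slope (ramify s r P0) (ramify s r P1) (ramify s r P2) T (y T))) ->
  exists L : R, (fun T => atan (y T / (s * T ^+ r))) @ +oo --> L.
Proof.
move=> s1 yP; apply: (@cvg_of_levels R _ (pi / 2)).
  move=> T; rewrite ler_norml.
  by have := atan_gtNpi2 (y T / (s * T ^+ r)); have := atan_ltpi2 (y T / (s * T ^+ r)); lra.
move=> l.
have [lpi|lpi] := leP (pi / 2) l.
  by right; near=> T; apply: le_trans lpi; exact/ltW/atan_ltpi2.
have [lpi'|lpi'] := leP l (- (pi / 2)).
  by left; near=> T; apply: le_trans lpi' _; exact/ltW/atan_gtNpi2.
have lE : l = atan (tan l) by rewrite tanK// in_itv /= lpi' lpi.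
have T0' : \forall T \near +oo, (0 : R) < T ^+ r.
  by apply/near_pinfty_from; exists 1 => T T1; rewrite exprn_gt0// (lt_le_trans _ T1).
have E T : 0 < T ^+ r -> y T / (s * T ^+ r) - tan l = s * (y T - tan l * (s * T ^+ r)) / T ^+ r.
  by move=> Tr; case: s1 => ->; field; rewrite ?oppr_eq0 ?oner_eq0 gt_eqF.
have [H|H] := slope_levels (tan l) yP; case: s1 => sE; [left|right|right|left];
  (apply: filter_app H; apply: filter_app T0'; near=> T; move=> Tr H;
   rewrite lE; apply: le_atan).
- rewrite -subr_ge0 E//; move: H; set D := y T - _ => H.
  by rewrite sE mul1r divr_ge0// ltW.
- rewrite -subr_le0 E//; move: H; set D := y T - _ => H.
  by rewrite sE mulN1r mulNr oppr_le0 divr_ge0// ltW.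
- rewrite -subr_le0 E//; move: H; set D := y T - _ => H.
  by rewrite sE mul1r mulr_le0_ge0// invr_ge0 ltW.
- rewrite -subr_ge0 E//; move: H; set D := y T - _ => H.
  by rewrite sE mulN1r mulNr oppr_ge0 mulr_le0_ge0// invr_ge0 ltW.
Unshelve. all: by end_near. Qed.

Lemma cherkas_horner (R : realType) (P0 P1 P2 : {poly R}) (x y : R) :
  (cherkas P0 P1 P2).2.[x, y] = P0.[x] + P1.[x] * y + P2.[x] * y ^+ 2.
Proof.
rewrite /cherkas /= !hornerD !hornerM !horner_map /= !hornerC.
by rewrite !hornerX expr2.
Qed.

Lemma horner2_coef (R : realType) (F : {poly {poly R}}) (x y : R) :
  F.[x, y] = \sum_(i < size F) \sum_(j < size F`_i) F`_i`_j * x ^+ i * y ^+ j.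
Proof.
rewrite (horner_coef F) horner_sum; apply: eq_bigr => i _.
rewrite hornerM -polyC_exp hornerC horner_coef mulr_suml.
by apply: eq_bigr => j _; rewrite mulrAC.
Qed.

Lemma total_degree_coef (R : realType) (F : {poly {poly R}}) (i j : nat) :
  F`_i`_j != 0 -> (i + j <= total_degree F)%N.
Proof.
move=> Fij.
have ij : (j < size (F`_i)%R)%N.
  by rewrite ltnNge; apply: contra Fij => /leq_sizeP ->.
have ii : (i < size F)%N.
  rewrite ltnNge; apply: contra Fij => /leq_sizeP Fi; rewrite Fi ?coef0//.
apply: leq_trans (leq_bigmax (Ordinal ii)).
by apply: (@leq_bigmax_cond _ _ (fun j : 'I__ => (i + j)%N) (Ordinal ij)).
Qed.

Lemma homogenizeE (R : realType) (d : nat) (F : {poly {poly R}}) (x y rho : R) :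
  (total_degree F <= d)%N -> rho != 0 ->
  homogenize d F (x / rho, y / rho, 1 / rho) = F.[x, y] / rho ^+ d.
Proof.
move=> Fd rho0; rewrite /homogenize horner2_coef mulr_suml; apply: eq_bigr => i _.
rewrite mulr_suml; apply: eq_bigr => j _.
have [->|Fij] := eqVneq F`_i`_j 0; first by rewrite !mul0r.
have ijd : (i + j <= d)%N by apply: leq_trans (total_degree_coef Fij) Fd.
rewrite -[in RHS](subnKC ijd) !exprD !expr_div_n expr1n.
by field; rewrite !expf_neq0.
Qed.

Lemma cvg_bigsum (R : realType) (S : set_system R) {FS : Filter S} (I : Type)
    (r : seq I) (f : I -> R -> R) (l : I -> R) :
  (forall i, f i @ S --> l i) ->
  (fun T => \sum_(i <- r) f i T) @ S --> \sum_(i <- r) l i.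
Proof.
move=> fl; elim: r => [|i r IH].
  by rewrite big_nil; under eq_fun do rewrite big_nil; exact: cvg_cst.
by rewrite big_cons; under eq_fun do rewrite big_cons; exact: cvgD.
Qed.

Lemma cvg_homogenize (R : realType) (S : set_system R) {FS : Filter S} (d : nat)
    (F : {poly {poly R}}) (f g h : R -> R) (a b c : R) :
  f @ S --> a -> g @ S --> b -> h @ S --> c ->
  (fun T => homogenize d F (f T, g T, h T)) @ S --> homogenize d F (a, b, c).
Proof.
move=> fa gb hc; rewrite /homogenize.
apply: cvg_bigsum => i; apply: cvg_bigsum => j.
have E (u : R -> R) (l : R) (k : nat) : u @ S --> l -> (fun T => u T ^+ k) @ S --> l ^+ k.
  move=> ul; have := @cvg_horner R S FS 'X^k u l ul; rewrite hornerXn.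
  by under eq_fun do rewrite hornerXn.
apply: cvgM; last exact: E.
apply: cvgM; last exact: E.
by apply: cvgM; [exact: cvg_cst | exact: E].
Qed.

(** Since the first component of the field has degree 1, which is less than
    the total degree, it does not contribute on the equator. *)
Lemma equator_equilibriumP (R : realType) (P0 P1 P2 : {poly R}) (z1 z2 : R) :
  P2 != 0 -> z1 ^+ 2 + z2 ^+ 2 = 1 ->
  let X := cherkas P0 P1 P2 in
  equator_equilibrium X (z1, z2, 0) <->
  z1 * homogenize (vfield_degree X) X.2 (z1, z2, 0) = 0.
Proof.
move=> P20 z12 X; set d := vfield_degree X.
have d2 : (2 <= d)%N.
  apply: leq_trans (leq_maxr _ _).
  have : X.2`_((size P2).-1)`_2 != 0.
    rewrite /X /cherkas /= !coefD.
    rewrite coef_map /= -polyC_exp !coefMC !coef_map /= !coefCM !coefC /=.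
    by rewrite !coefX coefXn /= mulr0 mulr1 !add0r -lead_coefE lead_coef_eq0.
  by move=> /total_degree_coef; apply: leq_trans; rewrite leq_addl.
have Pe : homogenize d X.1 (z1, z2, 0) = 0.
  rewrite /homogenize; apply: big1 => i _; apply: big1 => j _.
  move: (i : nat) (j : nat) => {}i {}j.
  rewrite /X /cherkas /= coefC; case: eqP => [i0|_]; last by rewrite coef0 !mul0r.
  rewrite coefX; case: eqP => [j1|_]; last by rewrite !mul0r.
  by rewrite i0 j1 expr0n subn_eq0 leqNgt d2 mulr0.
rewrite /equator_equilibrium /poincare_field -/d Pe.
set Q := homogenize _ _ _; split=> [[_ _ [E1 E2 _]]|zQ].
  have : z1 * (Q - z2 * (z1 * 0 + z2 * Q)) = 0 by rewrite E2 mulr0.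
  have -> : z1 * (Q - z2 * (z1 * 0 + z2 * Q)) =
    z1 * ((z1 ^+ 2 + z2 ^+ 2) * Q - z2 ^+ 2 * Q) by rewrite z12; ring.
  have -> : z1 * ((z1 ^+ 2 + z2 ^+ 2) * Q - z2 ^+ 2 * Q) = z1 ^+ 2 * (z1 * Q) by ring.
  by move=> /eqP; rewrite mulf_eq0 expf_eq0 => /orP[/= /eqP ->|/eqP ->//]; rewrite mul0r.
split=> //; congr (_, _, _).
- have -> : 0 - z1 * (z1 * 0 + z2 * Q) = - z2 * (z1 * Q) by ring.
  by rewrite zQ mulr0.
- have -> : Q - z2 * (z1 * 0 + z2 * Q) = (z1 ^+ 2 + z2 ^+ 2) * Q - z2 ^+ 2 * Q by rewrite z12; ring.
  have -> : (z1 ^+ 2 + z2 ^+ 2) * Q - z2 ^+ 2 * Q = z1 * (z1 * Q) by ring.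
  by rewrite zQ mulr0.
- by rewrite mul0r oppr0.
Qed.

(** * Orbits at infinity and solutions over a half-line *)

(** In the coordinates [x = s / ep] and [y = x tan th] the central projection
    extends continuously to [ep = 0]. *)
Lemma central_projection_polar (R : realType) (s th ep : R) :
  s = 1 \/ s = -1 -> 0 < ep -> 0 < cos th ->
  let q := Num.sqrt (1 + ep ^+ 2 * cos th ^+ 2) in
  central_projection (s / ep) (s / ep * tan th) =
    (s * cos th / q, s * sin th / q, ep * cos th / q).
Proof.
move=> s1 ep0 c0 q.
have q2 : q ^+ 2 = 1 + ep ^+ 2 * cos th ^+ 2.
  by rewrite sqr_sqrtr// addr_ge0// mulr_ge0 ?sqr_ge0.
have q0 : 0 < q by rewrite sqrtr_gt0 ltr_pwDl// mulr_ge0 ?sqr_ge0.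
have cs : sin th ^+ 2 = 1 - cos th ^+ 2 by rewrite -(cos2Dsin2 th); ring.
have rhoE : Num.sqrt (1 + (s / ep) ^+ 2 + (s / ep * tan th) ^+ 2) = q / (ep * cos th).
  rewrite -[RHS]gtr0_norm ?divr_gt0 ?mulr_gt0// -sqrtr_sqr; congr Num.sqrt.
  have ss : s ^+ 2 = 1 by case: s1 => ->; rewrite ?sqrrN expr1n.
  rewrite !expr_div_n exprMn q2 expr_div_n /tan expr_div_n ss cs exprMn.
  by field; rewrite !gt_eqF.
rewrite /central_projection rhoE /tan; congr (_, _, _).
all: by field; rewrite !gt_eqF.
Qed.

Lemma cvg_central_projection (R : realType) (S : set_system R) {FS : Filter S}
    (s : R) (th ep : R -> R) (L : R) :
  s = 1 \/ s = -1 -> (forall T, 0 < cos (th T)) -> (\forall T \near S, 0 < ep T) ->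
  th @ S --> L -> ep @ S --> (0 : R) ->
  (fun T => central_projection (s / ep T) (s / ep T * tan (th T))) @ S -->
    (s * cos L, s * sin L, (0 : R)).
Proof.
move=> s1 c0 ep0 thL epL.
pose q T := Num.sqrt (1 + ep T ^+ 2 * cos (th T) ^+ 2).
have cL : (fun T => cos (th T)) @ S --> cos L.
  by apply: continuous_cvg => //; exact: continuous_cos.
have sL : (fun T => sin (th T)) @ S --> sin L.
  by apply: continuous_cvg => //; exact: continuous_sin.
have qL : q @ S --> (1 : R).
  have H : (fun T => 1 + ep T ^+ 2 * cos (th T) ^+ 2) @ S --> 1 + 0 * 0 * (cos L * cos L).
    apply: cvgD; first exact: cvg_cst.
    by apply: cvgM; exact: cvgM.
  rewrite !mul0r addr0 in H.
  by rewrite -[X in _ --> X]sqrtr1 /q; apply: continuous_cvg H; exact: sqrt_continuous.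
have E : \forall T \near S, (s * cos (th T) / q T, s * sin (th T) / q T, ep T * cos (th T) / q T) =
    central_projection (s / ep T) (s / ep T * tan (th T)).
  by apply: filter_app ep0; near=> T => epT; rewrite central_projection_polar.
apply: cvg_trans (near_eq_cvg E) _.
have q1 : (1 : R) != 0 by exact: oner_neq0.
have div (f : R -> R) (l : R) : f @ S --> l -> (fun T => f T / q T) @ S --> l.
  by move=> fl; rewrite -[l]divr1; apply: cvgM => //; exact: cvgV.
have H1 : (fun T => s * cos (th T) / q T) @ S --> s * cos L.
  by apply: div; apply: cvgM => //; exact: cvg_cst.
have H2 : (fun T => s * sin (th T) / q T) @ S --> s * sin L.
  by apply: div; apply: cvgM => //; exact: cvg_cst.
have H3 : (fun T => ep T * cos (th T) / q T) @ S --> (0 : R).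
  by apply: div; rewrite -[X in _ --> X](mul0r (cos L)); exact: cvgM.
exact: cvg_pair (cvg_pair H1 H2) H3.
Unshelve. all: by end_near. Qed.

(** Reversing time exchanges the two ends of an orbit. *)
Lemma orbit_connects_of_param (R : realType) (X : vfield R) (e : R * R * R)
    (mu : R) (a b : \bar R) (x y : R -> R) :
  mu = 1 \/ mu = -1 -> (a < b)%E ->
  (forall t : R, (a < t%:E < b)%E ->
    is_derive t 1 x (mu * X.1.[x t, y t]) /\ is_derive t 1 y (mu * X.2.[x t, y t])) ->
  (fun t => central_projection (x t) (y t)) @ to_right_end a b --> e ->
  orbit_connects X e.
Proof.
case=> -> ab xy xye.
  exists a, b, x, y; split=> //; last by left.
  by move=> t /xy; rewrite !mul1r.
have Nab t : (- b < t%:E < - a)%E = (a < (- t)%:E < b)%E.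
  by rewrite EFinN lteNl lteNr andbC.
exists (- b)%E, (- a)%E, (x \o -%R), (y \o -%R); split.
- by rewrite lteN2.
- move=> t; rewrite Nab => /xy[xd yd]; split.
    have := @is_derive1_comp _ x -%R t _ _ xd (is_deriveNid _ _).
    by rewrite !mulN1r mulrN1 opprK.
  have := @is_derive1_comp _ y -%R t _ _ yd (is_deriveNid _ _).
  by rewrite !mulN1r mulrN1 opprK.
- right => A /xye [s /= sab HA]; exists (- s) => /=; first by rewrite Nab opprK.
  move=> t /= /andP[bt ts]; apply: (HA (- t)) => /=.
  by rewrite !lte_fin ltrNr -lte_fin ts /= EFinN lteNl.
Qed.

Lemma cvg_coordinates (R : realType) (S : set_system R) {FS : Filter S}
    (f : R -> R * R * R) (a b c : R) :
  f @ S --> (a, b, c) ->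
  [/\ (fun T => (f T).1.1) @ S --> a, (fun T => (f T).1.2) @ S --> b
    & (fun T => (f T).2) @ S --> c].
Proof.
move=> fl.
have f1 : (fun T => (f T).1) @ S --> (a, b) by apply: (cvg_comp _ _ fl); exact: cvg_fst.
split; first by apply: (cvg_comp _ _ f1); exact: cvg_fst.
  by apply: (cvg_comp _ _ f1); exact: cvg_snd.
by apply: (cvg_comp _ _ fl); exact: cvg_snd.
Qed.

(** If the limit direction were not an equilibrium, the top-degree part of
    [y y'] would make [y^2] grow faster than the square of [x], although the
    slope [y / x] is bounded. *)
Lemma limit_direction_equilibrium (R : realType) (P0 P1 P2 : {poly R}) (s c T0 L : R)
    (r : nat) (y : R -> R) :
  P2 != 0 -> s = 1 \/ s = -1 -> (0 < r)%N ->
  (forall T, T0 <= T -> 0 < c * y T /\ is_derive T 1 y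
    (cherkas_slope (ramify s r P0) (ramify s r P1) (ramify s r P2) T (y T))) ->
  (fun T => central_projection (s * T ^+ r) (y T)) @ +oo --> (s * cos L, s * sin L, (0 : R)) ->
  equator_equilibrium (cherkas P0 P1 P2) (s * cos L, s * sin L, 0).
Proof.
move=> P20 s1 r0 yP proj; set X := cherkas P0 P1 P2; set d := vfield_degree X.
have ss : s ^+ 2 = 1 by case: s1 => ->; rewrite ?sqrrN expr1n.
have n1 : (s * cos L) ^+ 2 + (s * sin L) ^+ 2 = 1.
  by rewrite !exprMn ss !mul1r cos2Dsin2.
apply/(equator_equilibriumP P0 P1 P20 n1); rewrite -/X -/d.
apply/eqP; apply: contraT => zQ.
have [z10 Q0] : s * cos L != 0 /\ homogenize d X.2 (s * cos L, s * sin L, 0) != 0.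
  by move: zQ; rewrite mulf_eq0 negb_or => /andP[].
set Q := homogenize _ _ _ in Q0.
pose x (T : R) := s * T ^+ r.
pose rho T := Num.sqrt (1 + x T ^+ 2 + y T ^+ 2).
have rho2 T : rho T ^+ 2 = 1 + x T ^+ 2 + y T ^+ 2.
  by rewrite sqr_sqrtr// !addr_ge0// sqr_ge0.
have rho0 T : 0 < rho T.
  by rewrite sqrtr_gt0 -addrA ltr_pwDl// addr_ge0// sqr_ge0.
have [c1 c2 c3] : [/\ (fun T => x T / rho T) @ +oo --> s * cos L,
    (fun T => y T / rho T) @ +oo --> s * sin L & (fun T => 1 / rho T) @ +oo --> (0 : R)].
  by have [? ? ?] := cvg_coordinates proj.
have XQ : (fun T => X.2.[x T, y T] / rho T ^+ d) @ +oo --> Q.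
  have H : (fun T => homogenize d X.2 (x T / rho T, y T / rho T, 1 / rho T)) @ +oo --> Q.
    exact: cvg_homogenize.
  apply: cvg_trans H; apply: near_eq_cvg; near=> T.
  rewrite homogenizeE ?gt_eqF//.
  by rewrite /d /vfield_degree leq_maxr.
have d2 : (2 <= d)%N.
  apply: leq_trans (leq_maxr _ _).
  have : X.2`_((size P2).-1)`_2 != 0.
    rewrite /X /cherkas /= !coefD.
    rewrite coef_map /= -polyC_exp !coefMC !coef_map /= !coefCM !coefC /=.
    by rewrite !coefX coefXn /= mulr0 mulr1 !add0r -lead_coefE lead_coef_eq0.
  by move=> /total_degree_coef; apply: leq_trans; rewrite leq_addl.
(* q bounds the size of the top-degree part from below; C bounds y^2 / x^2 *)
pose q := `|Q| / 2.
have q0 : 0 < q by rewrite divr_gt0// normr_gt0.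
pose sg := Num.sg Q.
have sgQ : sg * Q = `|Q| by rewrite normrEsg.
have H1 : \forall T \near +oo, q < sg * (X.2.[x T, y T] / rho T ^+ d).
  have : (fun T => sg * (X.2.[x T, y T] / rho T ^+ d)) @ +oo --> sg * Q.
    by apply: cvgM => //; exact: cvg_cst.
  move=> /cvgr_gt; apply; rewrite sgQ /q ltr_pdivrMr// ltr_pMr ?normr_gt0 ?ltr1n//.
have [C HC] : exists C, \forall T \near +oo, y T ^+ 2 <= C * x T ^+ 2.
  exists ((s * sin L / (s * cos L)) ^+ 2 + 1).
  have : (fun T => (y T / rho T / (x T / rho T)) * (y T / rho T / (x T / rho T))) @ +oo -->
     (s * sin L / (s * cos L)) * (s * sin L / (s * cos L)).
    by apply: cvgM; (apply: cvgM => //; exact: cvgV).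
  rewrite -expr2 => /cvgr_lt /(_ ((s * sin L / (s * cos L)) ^+ 2 + 1)).
  rewrite ltrDl ltr01 => /(_ isT) H.
  have T0' : \forall T \near +oo, (0 : R) < T by apply/near_pinfty_from; exists 1 => T; exact: lt_le_trans.
  apply: filter_app H; apply: filter_app T0'; near=> T => T1 H.
  have x0 : x T != 0 by rewrite mulf_neq0 ?expf_neq0 ?(gt_eqF T1)// -sqrf_eq0 ss oner_neq0.
  rewrite -ler_pdivrMr ?exprn_even_gt0//; apply: le_trans (ltW H).
  by rewrite le_eqVlt; apply/orP; left; apply/eqP; field; rewrite x0 gt_eqF.
have [T1 HT1] := (near_pinfty_from _).1 H1.
have [T2 HT2] := (near_pinfty_from _).1 HC.
pose T3 := Num.max T0 (Num.max 1 (Num.max T1 T2)).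
have [T03 T13 T23 T33] : [/\ T0 <= T3, T1 <= T3, T2 <= T3 & 1 <= T3].
  by rewrite /T3 !le_max !lexx !orbT.
pose a := q / 2.
have a0 : 0 < a by rewrite divr_gt0.
pose f (T : R) := s * sg * y T ^+ 2 - a * T ^+ (3 * r).
have fle T : T3 <= T -> f T3 <= f T.
  move=> TT.
  pose dx (T : R) := s * r%:R * T ^+ r.-1.
  pose df T := s * sg * (2 * (dx T * X.2.[x T, y T])) - a * (3 * r)%:R * T ^+ (3 * r).-1.
  apply: (@le_is_derive R f df _ _ TT) => t /andP[T3t _].
    have [cy yd] := yP t (le_trans T03 T3t).
    have y0 : y t != 0 by apply: contraTneq cy => ->; rewrite mulr0 ltxx.
    have ? := is_derive_monomial a (3 * r) t.
    apply: is_derive_eq; rewrite /GRing.scale /= /df /X cherkas_horner /cherkas_slope !horner_ramify.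
    by rewrite -/(x t) -/(dx t); field.
  have := HT1 t (le_trans T13 T3t); rewrite mulrA ltr_pdivlMr ?exprn_gt0// => H.
  have t0 : 1 <= t by rewrite (le_trans T33).
  have t00 : 0 <= t by rewrite (le_trans ler01).
  have rt : t ^+ r <= rho t.
    rewrite -(@ler_pXn2r _ 2) ?nnegrE ?exprn_ge0 ?(ltW (rho0 t))// rho2 /x exprMn ss mul1r.
    by rewrite (addrC 1) -addrA lerDl addr_ge0 ?sqr_ge0.
  have rd : t ^+ (2 * r) <= rho t ^+ d.
    have r1 : 1 <= rho t by apply: le_trans rt; exact: exprn_ege1.
    apply: le_trans (ler_weXn2l r1 d2); rewrite mulnC exprM.
    by rewrite ler_pXn2r ?nnegrE ?exprn_ge0 ?(ltW (rho0 t)).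
  rewrite /df subr_ge0.
  have -> : s * sg * (2 * (dx t * X.2.[x t, y t])) =
      s ^+ 2 * (2 * r%:R * t ^+ r.-1) * (sg * X.2.[x t, y t]) by rewrite /dx; ring.
  rewrite ss mul1r.
  have k0 : 0 <= 2 * r%:R * t ^+ r.-1 by rewrite !mulr_ge0 ?exprn_ge0.
  have : (2 * r%:R * t ^+ r.-1) * (q * t ^+ (2 * r)) <= (2 * r%:R * t ^+ r.-1) * (sg * X.2.[x t, y t]).
    by rewrite ler_wpM2l// (le_trans _ (ltW H))// ler_wpM2l// ltW.
  apply: le_trans.
  have -> : ((3 * r).-1 = r.-1 + 2 * r)%N by clear -r0; lia.
  rewrite exprD natrM /a.
  have : 0 <= q * r%:R * (t ^+ r.-1 * t ^+ (2 * r)).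
    by rewrite !mulr_ge0 ?exprn_ge0// ltW.
  move: (t ^+ r.-1) (t ^+ (2 * r)) (r%:R : R) (q : R) => A B r' q' {}H; clear -H; lra.
pose T4 := Num.max T3 ((`|C| + `|f T3| + 1) / a).
have T34 : T3 <= T4 by rewrite le_max lexx.
have T41 : 1 <= T4 by exact: le_trans T34.
have aT4 : `|C| + `|f T3| + 1 <= a * T4 ^+ r.
  apply: (@le_trans _ _ (a * T4)); first by rewrite mulrC -ler_pdivrMr// le_max lexx orbT.
  by rewrite ler_pM2l// -[leLHS]expr1 ler_weXn2l.
have := HT2 T4 (le_trans T23 T34); have := fle T4 T34.
have -> : x T4 ^+ 2 = T4 ^+ (2 * r) by rewrite /x exprMn ss mul1r mulnC exprM.
have -> : f T4 = s * sg * y T4 ^+ 2 - T4 ^+ (2 * r) * (a * T4 ^+ r).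
  by rewrite /f mulSn addnC exprD; ring.
have : s * sg * y T4 ^+ 2 <= y T4 ^+ 2.
  rewrite ler_piMl ?sqr_ge0//.
  have : `|s * sg| <= 1.
    rewrite normrM normr_sg (_ : `|s| = 1) ?mul1r ?lern1 ?leq_b1//.
    by case: s1 => ->; rewrite ?normrN normr1.
  by rewrite ler_norml => /andP[].
have A1 : 1 <= T4 ^+ (2 * r) by exact: exprn_ege1.
have := ler_norm C; have := ler_norm (- f T3); rewrite normrN.
move: aT4 A1; set A := T4 ^+ (2 * r); set B := a * T4 ^+ r; set Y := _ ^+ 2 => BC A1 f3 CC h1 h2 h3.
have A0 : 0 <= A by exact: le_trans A1.
have k1 : A * (C - B) <= A * (- (`|f T3| + 1)) by rewrite ler_wpM2l//; clear -BC CC; lra.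
have k2 : `|f T3| + 1 <= A * (`|f T3| + 1) by rewrite ler_peMl// addr_ge0.
move: (f T3) k1 k2 f3 h2 h1 h3 => F; clear; lra.
Unshelve. all: by end_near. Qed.

(** A solution over a half-line is turned into an orbit by integrating
    [dt = dx / y]. *)
Lemma escaping_not_monodromic (R : realType) (P0 P1 P2 : {poly R}) (s : R) (r : nat) :
  P2 != 0 -> s = 1 \/ s = -1 -> (0 < r)%N ->
  escaping P0 P1 P2 s r -> ~ monodromic_at_infinity (cherkas P0 P1 P2).
Proof.
move=> P20 s1 r0 [c [T0 [y [T00 yP]]]] mono.
have [L thL] := angle_cvg s1 yP.
have s0 : s != 0 by case: s1 => ->; rewrite ?oppr_eq0 oner_neq0.
have proj : (fun T => central_projection (s * T ^+ r) (y T)) @ +oo --> (s * cos L, s * sin L, (0 : R)).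
  have T0' : \forall T \near +oo, (0 : R) < T by apply/near_pinfty_from; exists 1 => T; exact: lt_le_trans.
  have H : (fun T : R => central_projection (s / (1 / T ^+ r))
      (s / (1 / T ^+ r) * tan (atan (y T / (s * T ^+ r))))) @ +oo --> (s * cos L, s * sin L, (0 : R)).
    apply: cvg_central_projection => //.
    - by move=> T; rewrite cos_atan invr_gt0 sqrtr_gt0 ltr_pwDl// sqr_ge0.
    - by apply: filter_app T0'; near=> T => T1; rewrite divr_gt0// exprn_gt0.
    - exact: cvg_divX_pinfty.
  apply: cvg_trans H; apply: near_eq_cvg; apply: filter_app T0'; near=> T => T1.
  rewrite atanK; congr central_projection; field; rewrite ?s0 ?oner_neq0 expf_neq0 ?(gt_eqF T1)//.
apply: (mono (s * cos L, s * sin L, 0)).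
  exact: limit_direction_equilibrium r0 yP proj.
have c0 : c != 0.
  by have [+ _] := yP T0 (lexx _); apply: contraTneq => ->; rewrite mul0r ltxx.
have [sg [sg1 sgy]] : exists sg : R, (sg = 1 \/ sg = -1) /\ forall T, T0 <= T -> 0 < sg * s * y T.
  have ss : s * s = 1 by case: s1 => ->; rewrite ?mulrNN mulr1.
  have [cp|cn|c_0] := ltrgtP 0 c; last by rewrite c_0 eqxx in c0.
    exists s; split => // T /yP[+ _]; by rewrite ss mul1r pmulr_rgt0.
  exists (- s); split; first by case: s1 => ->; [right|left; rewrite opprK].
  by move=> T /yP[+ _]; rewrite mulNr ss mulN1r oppr_gt0 nmulr_rgt0.
have sg2 : sg * sg = 1 by case: sg1 => ->; rewrite ?mulrNN mulr1.
have ss : s * s = 1 by case: s1 => ->; rewrite ?mulrNN mulr1.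
have y0 T : T0 <= T -> y T != 0.
  by move=> /yP[+ _]; apply: contraTneq => ->; rewrite mulr0 ltxx.
pose m (T : R) := Num.max T0 T.
have T0m T : T0 <= m T by rewrite /m le_max lexx.
have mE T : T0 <= T -> m T = T by rewrite /m => ?; rewrite max_r.
pose h (T : R) := r%:R * T ^+ r.-1 / (sg * s * y T).
have h0 T : T0 <= T -> 0 < h T.
  move=> TT; rewrite divr_gt0 ?sgy// mulr_gt0 ?ltr0n// exprn_gt0//.
  exact: lt_le_trans TT.
have hc : continuous (fun T => h (m T)).
  move=> T.
  have mc : {for T, continuous m}.
    by apply: (@continuous_max R R (cst T0) id) => //; exact: cvg_cst.
  have mcp : {for T, continuous (fun T => r%:R * m T ^+ r.-1)}.
    apply: (@continuous_comp _ _ _ m (fun T => r%:R * T ^+ r.-1)); first exact: mc.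
    exact: is_derive_continuous (is_derive_monomial r%:R r.-1 (m T)).
  have yc : {for T, continuous (fun t => y (m t))}.
    by apply: continuous_comp; [exact: mc | exact: is_derive_continuous (yP _ (T0m T)).2].
  apply: cvgM; first exact: mcp.
  apply: cvgV; first by rewrite gt_eqF// sgy.
  by apply: cvgM; [exact: cvg_cst | exact: yc].
have [Th [Th0 Thd']] := antiderivative T0 hc.
have Thd (T : R) : T0 <= T -> is_derive T 1 Th (h T) by move=> TT; rewrite -{2}(mE T TT); exact: Thd'.
have Thlt S T : T0 <= S -> S < T -> Th S < Th T.
  move=> SS ST; apply: (@lt_is_derive R Th h _ _ ST) => x /andP[Sx _].
    by apply: Thd; exact: le_trans Sx.
  by apply: h0; exact: le_trans Sx.
have [|g gP] := @inverse_is_derive R Th h T0%:E +oo%E.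
  by move=> t /andP[]; rewrite lte_fin => /ltW Tt _; split; [exact: Thd | exact: h0].
pose b := ereal_sup [set (Th T)%:E | T in [set T | T0 < T]].
have Thb T : T0 < T -> ((Th T)%:E < b)%E.
  move=> TT; apply: (@lt_le_trans _ _ (Th (T + 1))%:E).
    by rewrite lte_fin Thlt ?ltrDl// ltW.
  by apply: ereal_sup_ubound; exists (T + 1) => //=; rewrite (lt_trans TT)// ltrDl.
have Thsurj (t : R) : (0%:E < t%:E < b)%E -> exists2 T, T0 < T & Th T = t.
  move=> /andP[t0 tb].
  have [T1 T1T tT] : exists2 T1, T0 < T1 & t < Th T1.
    apply: contrapT => H; move: tb; rewrite ltNge => /negP; apply.
    apply: ge_ereal_sup => _ [T /= TT <-]; rewrite lee_fin leNgt; apply/negP => tT.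
    by apply: H; exists T.
  have [||T] := @IVT R Th T0 T1 t (ltW T1T).
  - apply: continuous_in_subspaceT => x; rewrite inE /= in_itv /= => /andP[xT _].
    exact: is_derive_continuous (Thd x xT).
  - by rewrite Th0 ge_min le_max (ltW tT) orbT ltW.
  rewrite in_itv /= => /andP[TT _] TE; exists T => //.
  rewrite lt_neqAle TT andbT; apply: contraTneq t0 => T0T.
  by rewrite -TE -T0T Th0 ltxx.
apply: (@orbit_connects_of_param R _ _ sg 0%:E b (fun t => s * g t ^+ r) (y \o g)) => //.
- apply: lt_trans (Thb (T0 + 1) _); last by rewrite ltrDl.
  by rewrite lte_fin -Th0 Thlt// ltrDl.
- move=> t /Thsurj[T TT TE]; have TT' := ltW TT.
  have [gT gd] : g (Th T) = T /\ is_derive (Th T) 1 g (h T)^-1.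
    by apply: gP; rewrite lte_fin TT ltry.
  have yg : (y \o g) (Th T) = y T by rewrite /= gT.
  rewrite -TE yg gT; split.
    have xd := is_derive_monomial s r (g (Th T)).
    have := is_derive1_comp xd gd; rewrite gT.
    congr is_derive; rewrite /h.
    have T1 : T != 0 by rewrite gt_eqF// (lt_trans T00).
    have r1 : (r%:R : R) != 0 by rewrite pnatr_eq0 -lt0n.
    have E : s * r%:R * T ^+ r.-1 / (r%:R * T ^+ r.-1 / (sg * s * y T)) = (s * s) * sg * y T.
      by field; rewrite r1 expf_neq0//= s0 y0// (_ : sg != 0)//; case: sg1 => ->; rewrite ?oppr_eq0 oner_neq0.
    by rewrite E ss mul1r [_.1]/= hornerC hornerX.
  have yd := (yP T TT').2; rewrite -{1}gT in yd.
  have := is_derive1_comp yd gd.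
  congr is_derive; rewrite cherkas_horner /cherkas_slope !horner_ramify /h.
  have T1 : T != 0 by rewrite gt_eqF// (lt_trans T00).
  have r1 : (r%:R : R) != 0 by rewrite pnatr_eq0 -lt0n.
  set A := P0.[_]; set B := P1.[_]; set C := P2.[_].
  have E : (s * r%:R * T ^+ r.-1 * A + s * r%:R * T ^+ r.-1 * B * y T + s * r%:R * T ^+ r.-1 * C * y T ^+ 2) / y T
     / (r%:R * T ^+ r.-1 / (sg * s * y T)) = (s * s) * sg * (A + B * y T + C * y T ^+ 2).
    by field; rewrite r1 expf_neq0//= s0 y0// (_ : sg != 0)//; case: sg1 => ->; rewrite ?oppr_eq0 oner_neq0.
  by rewrite E ss mul1r.
- move=> A /proj [M [_ MA]].
  pose M' := Num.max M T0 + 1.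
  have MM : M < M' by rewrite /M' (le_lt_trans (_ : M <= Num.max M T0)) ?ltrDl// le_max lexx.
  have TM : T0 < M' by rewrite /M' (le_lt_trans (_ : T0 <= Num.max M T0)) ?ltrDl// le_max lexx orbT.
  exists (Th M') => /=; first by rewrite lte_fin -Th0 Thlt//= Thb.
  move=> t /= /andP[]; rewrite lte_fin => Mt tb.
  have [|T TT TE] := Thsurj t.
    by rewrite tb lte_fin (lt_trans _ Mt)// -Th0 Thlt.
  have [gT _] : g (Th T) = T /\ is_derive (Th T) 1 g (h T)^-1.
    by apply: gP; rewrite lte_fin TT ltry.
  rewrite /= -TE gT; apply: MA; apply: lt_trans MM _.
  rewrite ltNge; apply/negP; rewrite le_eqVlt => /orP[/eqP TM'|TM'].
    by rewrite TM' in TE; rewrite TE ltxx in Mt.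
  by have := Thlt T M' (ltW TT) TM'; rewrite TE ltNge (ltW Mt).
Unshelve. all: by end_near. Qed.

Lemma ereal_dense (R : realType) (s : R) (b : \bar R) :
  (s%:E < b)%E -> exists t : R, (s%:E < t%:E < b)%E.
Proof.
case: b => [b| |] //= sb; last by exists (s + 1); rewrite ltry lte_fin ltrDl ltr01.
rewrite lte_fin in sb; exists ((s + b) / 2); rewrite !lte_fin; apply/andP; split; lra.
Qed.

Lemma ereal_interval_inhabited (R : realType) (a b : \bar R) : (a < b)%E ->
  exists s : R, (a < s%:E < b)%E.
Proof.
case: a => [a| |] ab; first exact: ereal_dense.
  by case: b ab.
case: b ab => [b| |] //= _; last by exists 0; rewrite ltNyr ltry.
by exists (b - 1); rewrite ltNyr lte_fin ltrBlDr ltrDl ltr01.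
Qed.

Lemma to_right_end_filter (R : realType) (a b : \bar R) : (a < b)%E ->
  ProperFilter (to_right_end a b).
Proof.
move=> ab.
have [s sab] := ereal_interval_inhabited ab.
apply: filter_from_proper.
  apply: filter_from_filter; first by exists s.
  move=> i j /= iab jab; exists (Num.max i j).
    by case: (leP i j).
  move=> t /= /andP[ijt tb]; split; rewrite /= tb andbT; apply: le_lt_trans ijt.
    by rewrite lee_fin le_max lexx.
  by rewrite lee_fin le_max lexx orbT.
move=> i /= /andP[_ ib]; have [t tib] := ereal_dense ib.
by exists t.
Qed.

Lemma at_most_one_zero (R : realType) (f df : R -> R) (a b : R) :
  a < b -> (forall x, a <= x <= b -> is_derive x 1 f (df x)) ->
  (forall x, a <= x <= b -> f x = 0 -> 0 < df x) -> f a = 0 -> f b <> 0.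
Proof.
move=> ab fd f0 fa fb.
have aab : a <= a <= b by rewrite lexx ltW.
have bab : a <= b <= b by rewrite lexx ltW.
have [e1 e10 H1] := is_derive_gt0_right (fd a aab) (f0 a aab fa).
have [e2 e20 H2] := is_derive_gt0_left (fd b bab) (f0 b bab fb).
pose d := Num.min ((b - a) / 3) (Num.min (e1 / 2) (e2 / 2)).
have d0 : 0 < d by rewrite !lt_min !divr_gt0// subr_gt0.
have d1 : d <= (b - a) / 3 by rewrite ge_min lexx.
have d2 : d <= e1 / 2 by rewrite !ge_min lexx !orbT.
have d3 : d <= e2 / 2 by rewrite !ge_min lexx !orbT.
have ad : 0 < f (a + d) by rewrite -fa H1//; apply/andP; split; lra.
have bd : f (b - d) < 0 by rewrite -fb H2//; apply/andP; split; lra.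
have : 0 <= f (b - d).
  apply: (@ge0_of_zeros_increasing R f df (a + d)); last exact: ltW.
  - lra.
  - by move=> x /andP[ax xb]; apply: fd; apply/andP; split; lra.
  - by move=> x /andP[ax xb]; apply: f0; apply/andP; split; lra.
by rewrite leNgt bd.
Qed.

Lemma constant_sign (R : realType) (f : R -> R) (a b : \bar R) : (a < b)%E ->
  (forall t, (a < t%:E < b)%E -> {for t, continuous f} /\ f t != 0) ->
  exists c : R, (c = 1 \/ c = -1) /\ forall t, (a < t%:E < b)%E -> 0 < c * f t.
Proof.
move=> ab fP.
have [s sab] := ereal_interval_inhabited ab.
exists (Num.sg (f s)); have [fsc fs0] := fP s sab.
have sgs : Num.sg (f s) * f s = `|f s| by rewrite normrEsg.
split.
  by move: fs0; rewrite neq_lt => /orP[/ltr0_sg|/gtr0_sg] ->; [right|left].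
move=> t tab; rewrite ltNge; apply/negP => H.
have H0 : 0 < Num.sg (f s) * f s by rewrite sgs normr_gt0.
have between x : Num.min s t <= x <= Num.max s t -> (a < x%:E < b)%E.
  move=> /andP[x1 x2]; apply/andP; split.
    apply: lt_le_trans (_ : ((Num.min s t)%:E <= _)%E); last by rewrite lee_fin.
    by case: (leP s t) => _; [case/andP: sab | case/andP: tab].
  apply: le_lt_trans (_ : (_ <= (Num.max s t)%:E)%E) _; first by rewrite lee_fin.
  by case: (leP s t) => _; [case/andP: tab | case/andP: sab].
have [|||x xs /eqP] := @IVT R (fun x => Num.sg (f s) * f x) (Num.min s t) (Num.max s t) 0.
- by case: (leP s t) => [|/ltW].
- apply: continuous_in_subspaceT => x; rewrite inE /= in_itv /= => xst.
  by apply: cvgM; [exact: cvg_cst | exact: (fP x (between x xst)).1].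
- by case: (leP s t) => _; rewrite ge_min le_max H (ltW H0) ?orbT.
have := (fP x (between x xs)).2.
by move=> fx0; rewrite mulf_eq0 sgr_eq0 (negbTE fs0) (negbTE fx0).
Qed.

Lemma poly_bounded (R : realType) (p : {poly R}) (B : R) :
  exists C, forall x, `|x| <= B -> `|p.[x]| <= C.
Proof.
exists (\sum_(i < size p) `|p`_i| * B ^+ i) => x xB.
rewrite horner_coef; apply: le_trans (ler_norm_sum _ _ _) _.
apply: ler_sum => i _; rewrite normrM normrX ler_wpM2l//.
by rewrite lerXn2r ?nnegrE// (le_trans _ xB).
Qed.

Lemma param_of_orbit_connects (R : realType) (X : vfield R) (e : R * R * R) :
  orbit_connects X e -> exists (mu : R) (a b : \bar R) (x y : R -> R),
  [/\ mu = 1 \/ mu = -1, (a < b)%E,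
  forall t : R, (a < t%:E < b)%E ->
    is_derive t 1 x (mu * X.1.[x t, y t]) /\ is_derive t 1 y (mu * X.2.[x t, y t]) &
  (fun t => central_projection (x t) (y t)) @ to_right_end a b --> e].
Proof.
move=> [a [b [x [y [ab xy [xye|xye]]]]]].
  exists 1, a, b, x, y; split=> //; first by left.
  by move=> t /xy; rewrite !mul1r.
have Nab t : (- b < t%:E < - a)%E = (a < (- t)%:E < b)%E.
  by rewrite EFinN lteNl lteNr andbC.
exists (-1), (- b)%E, (- a)%E, (x \o -%R), (y \o -%R); split.
- by right.
- by rewrite lteN2.
- move=> t; rewrite Nab => /xy[xd yd]; split.
    have := @is_derive1_comp _ x -%R t _ _ xd (is_deriveNid _ _).
    by rewrite mulrN1 mulN1r.
  have := @is_derive1_comp _ y -%R t _ _ yd (is_deriveNid _ _).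
  by rewrite mulrN1 mulN1r.
- move=> A /xye [s /= sab HA]; exists (- s) => /=; first by rewrite Nab opprK.
  move=> t /= /andP[bt ts]; apply: (HA (- t)) => /=.
  by rewrite !lte_fin ltrNl -lte_fin bt andbT EFinN lteNr.
Qed.

Lemma normr_between (R : realType) (A D M : R) :
  A <= D -> D <= M -> `|D| <= `|M| + `|A|.
Proof.
move=> h1 h2; have := ler_norm M; have := ler_norm (- A); rewrite normrN.
by have := normr_ge0 M; have := normr_ge0 A; rewrite ler_norml => *; apply/andP; split; lra.
Qed.

Section OrbitToInfinity.
Variables (R : realType) (P0 P1 P2 : {poly R}) (mu : R) (a b : \bar R) (x y : R -> R).
Variables (z1 z2 : R).
Hypothesis P00 : P0 != 0.
Hypothesis mu1 : mu = 1 \/ mu = -1.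
Hypothesis ab : (a < b)%E.
Let F (t : R) := P0.[x t] + P1.[x t] * y t + P2.[x t] * y t ^+ 2.
Hypothesis xd : forall t : R, (a < t%:E < b)%E -> is_derive t 1 x (mu * y t).
Hypothesis yd : forall t : R, (a < t%:E < b)%E -> is_derive t 1 y (mu * F t).
Let rho (t : R) := Num.sqrt (1 + x t ^+ 2 + y t ^+ 2).
Hypothesis z12 : z1 ^+ 2 + z2 ^+ 2 = 1.
Hypothesis xz : (fun t => x t / rho t) @ to_right_end a b --> z1.
Hypothesis yz : (fun t => y t / rho t) @ to_right_end a b --> z2.
Hypothesis oz : (fun t => 1 / rho t) @ to_right_end a b --> (0 : R).

Let rho2 t : rho t ^+ 2 = 1 + x t ^+ 2 + y t ^+ 2.
Proof. by rewrite sqr_sqrtr// !addr_ge0// sqr_ge0. Qed.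
Let rho0 t : 0 < rho t.
Proof. by rewrite sqrtr_gt0 -addrA ltr_pwDl// addr_ge0// sqr_ge0. Qed.

#[local] Instance right_end_proper : ProperFilter (to_right_end a b) :=
  to_right_end_filter ab.

Let rho_large (M : R) : exists2 t0 : R, (a < t0%:E < b)%E &
  forall t : R, (t0%:E < t%:E < b)%E -> M < rho t.
Proof.
pose M' := Num.max M 1.
have M0 : 0 < M' by rewrite lt_max ltr01 orbT.
have : \forall t \near to_right_end a b, 1 / rho t < 1 / M'.
  by move: oz => /cvgr_lt; apply; rewrite divr_gt0.
move=> [t0 /= t0ab H]; exists t0 => // t /H /=.
rewrite !div1r ltf_pV2 ?posrE//; apply: le_lt_trans.
by rewrite le_max lexx.
Qed.

(** If [z1 <> 0], then [x] is large, and at the zeros of [y] its derivative has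
    the constant sign of [mu P0(x)], so that there is at most one zero. *)
Let y_nonzero : exists2 t0 : R, (a < t0%:E < b)%E &
  forall t : R, (t0%:E < t%:E < b)%E -> y t != 0.
Proof.
have [z10|z10] := eqVneq z1 0.
  have z2n : z2 != 0.
    by apply: contra_eqN z12 => /eqP ->; rewrite z10 expr0n addr0 eq_sym oner_eq0.
  have : \forall t \near to_right_end a b, 0 < z2 * (y t / rho t).
    have : (fun t => z2 * (y t / rho t)) @ to_right_end a b --> z2 * z2.
      by apply: cvgM => //; exact: cvg_cst.
    by move=> /cvgr_gt; apply; rewrite -expr2 exprn_even_gt0.
  move=> [t0 /= t0ab H]; exists t0 => // t /H /=.
  by apply: contraTneq => ->; rewrite mul0r mulr0 ltxx.
pose s := Num.sg z1.
have s1 : s = 1 \/ s = -1.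
  by move: z10; rewrite neq_lt /s => /orP[/ltr0_sg|/gtr0_sg] ->; [right|left].
pose p := P0 \Po (s *: 'X).
have sX2 : size (s *: 'X : {poly R}) = 2%N.
  by rewrite size_scale ?size_polyX//; case: s1 => ->; rewrite ?oppr_eq0 oner_eq0.
have p0 : p != 0.
  by rewrite -size_poly_eq0 size_comp_poly2// size_poly_eq0.
have pE u : p.[u] = P0.[s * u] by rewrite /p horner_comp hornerZ hornerX.
have ss : s * s = 1 by case: s1 => ->; rewrite ?mulrNN mulr1.
have [X0 HX0] := (near_pinfty_from _).1 (poly_eventual_sign p0).
have sz1 : s * z1 = `|z1| by rewrite normrEsg.
have : \forall t \near to_right_end a b, `|z1| / 2 < s * (x t / rho t).
  have : (fun t => s * (x t / rho t)) @ to_right_end a b --> s * z1.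
    by apply: cvgM => //; exact: cvg_cst.
  by move=> /cvgr_gt; apply; rewrite sz1 ltr_pdivrMr// ltr_pMr ?normr_gt0// ltr1n.
move=> [t0 /= t0ab H].
have zz : 0 < `|z1| / 2 by rewrite divr_gt0 ?normr_gt0.
have [t1 t1ab H1] := rho_large (`|X0| / (`|z1| / 2)).
pose t2 := Num.max t0 t1.
have t2ab : (a < t2%:E < b)%E by rewrite /t2; case: (leP t0 t1).
have sxX t : (t2%:E < t%:E < b)%E -> X0 <= s * x t.
  move=> /andP[t2t tb].
  have h0 := H t; have h1 := H1 t.
  rewrite /= tb andbT in h0; rewrite tb andbT in h1.
  have {}h0 : `|z1| / 2 < s * (x t / rho t).
    by apply: h0; apply: le_lt_trans t2t; rewrite lee_fin le_max lexx.
  have {}h1 : `|X0| / (`|z1| / 2) < rho t.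
    by apply: h1; apply: le_lt_trans t2t; rewrite lee_fin le_max lexx orbT.
  apply: le_trans (ler_norm _) _.
  rewrite ltr_pdivrMr// in h1.
  rewrite mulrA ltr_pdivlMr// in h0.
  by apply/ltW/(lt_trans h1); rewrite mulrC.
pose la := lead_coef p.
have zero_sign t : (t2%:E < t%:E < b)%E -> y t = 0 -> 0 < la * F t.
  move=> tb yt; rewrite /F yt expr0n !mulr0 !addr0.
  by have := HX0 _ (sxX t tb); rewrite pE mulrA ss mul1r.
have [[t3 t3b yt3]|nex] := pselect (exists2 t3 : R, (t2%:E < t3%:E < b)%E & y t3 = 0); last first.
  by exists t2 => // t tb; apply/eqP => yt; apply: nex; exists t.
have at3 : (a < t3%:E)%E by apply: lt_trans (andP t3b).1; case/andP: t2ab.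
exists t3; first by rewrite at3; case/andP: t3b.
move=> t /andP[t3t tb]; apply/eqP.
have mm : mu * mu = 1 by case: mu1 => ->; rewrite ?mulrNN mulr1.
have inab u : t3 <= u <= t -> (a < u%:E < b)%E.
  move=> /andP[u1 u2]; rewrite (lt_le_trans at3) ?lee_fin//=.
  by rewrite (le_lt_trans _ tb)// lee_fin.
suff : la * mu * y t <> 0 by move=> + yt; rewrite yt mulr0.
apply: (@at_most_one_zero R (fun t => la * mu * y t) (fun t => la * F t) t3).
- by rewrite -lte_fin.
- move=> u /inab uab; have ? := yd uab.
  by apply: is_derive_eq; rewrite -[RHS]mulr1 -mm /GRing.scale /=; ring.
- move=> u u3t /eqP; rewrite mulf_eq0 mulf_eq0 lead_coef_eq0 (negbTE p0)/=.
  have -> /= : mu == 0 = false by apply/negbTE; case: mu1 => ->; rewrite ?oppr_eq0 oner_eq0.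
  move=> /eqP; apply: zero_sign; apply/andP; split; last by case/andP: (inab u u3t).
  by apply: (lt_le_trans (andP t3b).1); rewrite lee_fin; case/andP: u3t.
- by rewrite yt3 mulr0.
Qed.

(** While [x] stays bounded [y] grows at most exponentially in [x], so an orbit
    cannot reach the equator over a bounded set of [x]. *)
Let x_unbounded (t0 c : R) : (a < t0%:E < b)%E -> c = 1 \/ c = -1 ->
  (forall t : R, (t0%:E < t%:E < b)%E -> 0 < c * y t) ->
  forall M, exists2 t : R, (t0%:E < t%:E < b)%E & M < mu * c * x t.
Proof.
move=> t0ab c1 cy M; apply: contrapT => nM.
have {}nM t : (t0%:E < t%:E < b)%E -> mu * c * x t <= M.
  by move=> tb; rewrite leNgt; apply/negP => H; apply: nM; exists t.
have inab u : (t0%:E < u%:E < b)%E -> (a < u%:E < b)%E.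
  by move=> /andP[tu ->]; rewrite andbT; apply: lt_trans tu; case/andP: t0ab.
have mm : mu * mu = 1 by case: mu1 => ->; rewrite ?mulrNN mulr1.
have cc : c * c = 1 by case: c1 => ->; rewrite ?mulrNN mulr1.
have nmu : `|mu| = 1 by case: mu1 => ->; rewrite ?normrN normr1.
have nc : `|c| = 1 by case: c1 => ->; rewrite ?normrN normr1.
have [t1 t1b] := ereal_dense (andP t0ab).2.
have t1ab := inab _ t1b.
have X_inc u v : t1 <= u -> u <= v -> (v%:E < b)%E -> mu * c * x u <= mu * c * x v.
  move=> t1u uv vb; apply: (@le_is_derive R (fun t => mu * c * x t) (fun t => c * y t) _ _ uv).
    move=> w /andP[uw wv].
    have wb : (a < w%:E < b)%E.
      apply/andP; split; first by apply: (lt_le_trans (andP t1ab).1); rewrite lee_fin (le_trans t1u).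
      by apply: le_lt_trans vb; rewrite lee_fin.
    by have ? := xd wb; apply: is_derive_eq; rewrite -[RHS]mulr1 -mm /GRing.scale /=; ring.
  move=> w /andP[uw wv]; apply/ltW/cy/andP; split.
    by apply: (lt_le_trans (andP t1b).1); rewrite lee_fin (le_trans t1u).
  by apply: le_lt_trans vb; rewrite lee_fin.
pose B := `|M| + `|mu * c * x t1|.
have xB t : t1 <= t -> (t%:E < b)%E -> `|x t| <= B.
  move=> t1t tb.
  have -> : `|x t| = `|mu * c * x t| by rewrite !normrM nmu nc !mul1r.
  have h1 := X_inc t1 t (lexx _) t1t tb.
  have h2 : mu * c * x t <= M.
    by apply: nM; rewrite tb andbT; apply: (lt_le_trans (andP t1b).1); rewrite lee_fin.
  exact: normr_between.
have [C0 HC0] := poly_bounded P0 B.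
have [C1 HC1] := poly_bounded P1 B.
have [C2 HC2] := poly_bounded P2 B.
pose C := C0 + C1 + C2.
have [t2 t2ab H2] := rho_large (B + 2).
have B0 : 0 <= B by rewrite addr_ge0.
pose t3 := Num.max t1 t2.
have t3b : (t3%:E < b)%E by rewrite /t3; case: (leP t1 t2) => _; [case/andP: t2ab|case/andP: t1b].
have [t4 t4b] := ereal_dense t3b.
have t34 : t3 < t4 by case/andP: t4b.
have t14 : t1 < t4 by apply: le_lt_trans t34; rewrite le_max lexx.
have t24 : t2 < t4 by apply: le_lt_trans t34; rewrite le_max lexx orbT.
have y1 t : t4 <= t -> (t%:E < b)%E -> 1 <= c * y t.
  move=> tt tb.
  have cy0 : 0 < c * y t.
    by apply: cy; rewrite tb andbT; apply: (lt_le_trans (andP t1b).1); rewrite lee_fin (le_trans (ltW t14)).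
  have y2 : (c * y t) ^+ 2 = y t ^+ 2 by rewrite exprMn expr2 cc mul1r.
  have r2 : (B + 2) ^+ 2 < rho t ^+ 2.
    rewrite ltr_pXn2r ?nnegrE ?(ltW (rho0 t)) ?addr_ge0//; apply: H2.
    by rewrite tb andbT lte_fin (lt_le_trans t24).
  have x2 : x t ^+ 2 <= B ^+ 2.
    have xtB := xB t (le_trans (ltW t14) tt) tb.
    by rewrite -(ger0_norm (sqr_ge0 (x t))) normrX lerXn2r ?nnegrE.
  rewrite leNgt; apply/negP => cy1.
  have cy2 : (c * y t) ^+ 2 < 1 by rewrite expr_lt1// ltW.
  rewrite rho2 in r2; rewrite y2 in cy2.
  have : 1 + x t ^+ 2 + y t ^+ 2 < (B + 2) ^+ 2.
    have -> : (B + 2) ^+ 2 = 1 + B ^+ 2 + 1 + (4 * B + 2) by ring.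
    rewrite -[ltLHS]addr0; apply: ltr_leD; last by rewrite addr_ge0// mulr_ge0.
    by apply: ler_ltD => //; rewrite lerD2l.
  by rewrite ltNge (ltW r2).
pose E t := expR (- (2 * C) * (mu * c * x t)).
pose f t := - (y t ^+ 2 * E t).
have f_inc t : t4 <= t -> (t%:E < b)%E -> f t4 <= f t.
  move=> t4t tb.
  pose df t := E t * ((2 * C) * (c * y t) * y t ^+ 2 - 2 * y t * (mu * F t)).
  apply: (@le_is_derive R f df _ _ t4t) => w /andP[w1 w2].
    have wb : (a < w%:E < b)%E.
      apply/andP; split; first by apply: (lt_le_trans (andP t1ab).1); rewrite lee_fin (le_trans (ltW t14)).
      by apply: le_lt_trans tb; rewrite lee_fin.
    have ? := xd wb; have ? := yd wb.
    apply: is_derive_eq; rewrite /df /E /GRing.scale /=.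
    set e := expR _.
    have -> : 2 * C * (c * y w) = 2 * C * (c * y w) * (mu * mu) by rewrite mm mulr1.
    by ring.
  have wb : (w%:E < b)%E by apply: le_lt_trans tb; rewrite lee_fin.
  have := y1 w w1 wb; have := xB w (le_trans (ltW t14) w1) wb => xw.
  have := HC0 _ xw; have := HC1 _ xw; have := HC2 _ xw.
  rewrite /df => h2 h1 h0 hy; rewrite mulr_ge0 ?expR_ge0// subr_ge0.
  set Y := c * y w in hy *.
  have yY : `|y w| = Y.
    have -> : `|y w| = `|Y|.
      by rewrite /Y normrM nc mul1r.
    by rewrite ger0_norm// (le_trans ler01).
  have yY2 : y w ^+ 2 = Y ^+ 2 by rewrite -yY -normrX ger0_norm// sqr_ge0.
  apply: le_trans (ler_norm _) _; rewrite yY2.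
  have -> : `|2 * y w * (mu * F w)| = 2 * Y * `|F w|.
    by rewrite !normrM yY nmu mul1r ger0_norm.
  have FC : `|F w| <= C * Y ^+ 2.
    apply: le_trans (ler_normD _ _) _; apply: le_trans (lerD (ler_normD _ _) (lexx _)) _.
    have -> : `|P2.[x w] * y w ^+ 2| = `|P2.[x w]| * Y ^+ 2.
      by rewrite normrM yY2 (ger0_norm (sqr_ge0 _)).
    have -> : `|P1.[x w] * y w| = `|P1.[x w]| * Y by rewrite normrM yY.
    have Y1 : 1 <= Y ^+ 2 by rewrite exprn_ege1.
    have YY : Y <= Y ^+ 2 by rewrite ler_eXnr.
    rewrite /C !mulrDl; apply: lerD; first apply: lerD.
    - by apply: le_trans h0 _; rewrite ler_peMr// (le_trans (normr_ge0 _) (HC0 _ xw)).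
    - by apply: ler_pM => //; rewrite (le_trans ler01).
    - by rewrite ler_wpM2r ?sqr_ge0.
  have Y0 : 0 <= 2 * Y by rewrite mulr_ge0// (le_trans ler01).
  by apply: le_trans (ler_wpM2l Y0 FC) _; rewrite le_eqVlt (_ : 2 * Y * _ = 2 * C * Y * Y ^+ 2) ?eqxx//; ring.
pose K := y t4 ^+ 2 * E t4 * expR (`|2 * C| * B).
have yK t : t4 <= t -> (t%:E < b)%E -> y t ^+ 2 <= K.
  move=> tt tb; have := f_inc t tt tb; rewrite /f lerN2.
  rewrite -ler_pdivlMr ?expR_gt0// => /le_trans; apply.
  apply: ler_wpM2l; first by rewrite mulr_ge0 ?sqr_ge0 ?expR_ge0.
  rewrite /E -expRN ler_expR.
  rewrite mulNr opprK; apply: le_trans (ler_norm _) _; rewrite normrM ler_wpM2l//.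
  have := xB t (le_trans (ltW t14) tt) tb; apply: le_trans.
  by rewrite !normrM nmu nc !mul1r.
have [t5 t5ab H5] := rho_large (1 + B ^+ 2 + `|K| + 1).
pose t6 := Num.max t4 t5.
have t6b : (t6%:E < b)%E by rewrite /t6; case: (leP t4 t5) => _; [case/andP: t5ab|case/andP: t4b].
have [t7 /andP[t67 t7b]] := ereal_dense t6b.
have t47 : t4 <= t7.
  by apply: ltW; rewrite -lte_fin; apply: le_lt_trans t67; rewrite lee_fin le_max lexx.
have rM : 1 + B ^+ 2 + `|K| + 1 < rho t7.
  apply: H5; rewrite t7b andbT; apply: le_lt_trans t67.
  by rewrite lee_fin le_max lexx orbT.
have k := yK t7 t47 t7b.
have x2 : x t7 ^+ 2 <= B ^+ 2.
  have xtB := xB t7 (le_trans (ltW t14) t47) t7b.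
  by rewrite -(ger0_norm (sqr_ge0 (x t7))) normrX lerXn2r ?nnegrE.
have r1 : 1 <= rho t7.
  apply: le_trans (ltW rM); rewrite -!addrA lerDl !addr_ge0 ?sqr_ge0//.
have : rho t7 <= rho t7 ^+ 2 by rewrite ler_eXnr.
rewrite rho2 leNgt => /negP; apply; apply: le_lt_trans rM.
rewrite -[leLHS]addr0; apply: lerD => //; apply: lerD; first by rewrite lerD2l.
exact: le_trans k (ler_norm _).
Qed.

(** Eventually [y] has constant sign, so [x] is monotone; as it is also
    unbounded, it may serve as the parameter. *)
Lemma orbit_escaping : exists s : R, (s = 1 \/ s = -1) /\ escaping P0 P1 P2 s 1.
Proof.
have [t0 t0ab ynz] := y_nonzero.
have t0b : (t0%:E < b)%E by case/andP: t0ab.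
have inab u : (t0%:E < u%:E < b)%E -> (a < u%:E < b)%E.
  by move=> /andP[tu ->]; rewrite andbT; apply: lt_trans tu; case/andP: t0ab.
have [|c [c1 cy]] := @constant_sign R y t0%:E b t0b.
  by move=> t tb; split; [exact: is_derive_continuous (yd (inab t tb)) | exact: ynz].
have mm : mu * mu = 1 by case: mu1 => ->; rewrite ?mulrNN mulr1.
have cc : c * c = 1 by case: c1 => ->; rewrite ?mulrNN mulr1.
pose s := mu * c; pose f t := s * x t.
have ss : s * s = 1 by rewrite /s mulrACA mm cc mulr1.
have fd (t : R) : (t0%:E < t%:E < b)%E -> is_derive t 1 f (c * y t) /\ 0 < c * y t.
  move=> tb; split; last exact: cy.
  have ? := xd (inab t tb).
  by apply: is_derive_eq; rewrite -[RHS]mulr1 -mm /GRing.scale /= /s; ring.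
have [g gP] := inverse_is_derive fd.
have f_inc := increasing_on_interval fd.
have [t2 t2b] := ereal_dense t0b.
pose T0 := Num.max (f t2) 1.
have surj T : T0 <= T -> exists2 t : R, (t0%:E < t%:E < b)%E & f t = T.
  rewrite ge_max => /andP[fT _].
  have [tM tMb TM] := x_unbounded t0ab c1 cy T.
  have t2M : t2 <= tM.
    rewrite leNgt; apply/negP => Mt.
    have := f_inc _ _ (andP tMb).1 (andP t2b).2 Mt.
    by rewrite ltNge (le_trans fT (ltW TM)).
  have between u : t2 <= u <= tM -> (t0%:E < u%:E < b)%E.
    move=> /andP[u1 u2]; apply/andP; split.
      by apply: (lt_le_trans (andP t2b).1); rewrite lee_fin.
    by apply: le_lt_trans (andP tMb).2; rewrite lee_fin.
  have [||t /between tb ft] := @IVT R f t2 tM T t2M; last by exists t.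
  - apply: continuous_in_subspaceT => u; rewrite inE /= in_itv /= => /between ub.
    exact: is_derive_continuous (fd u ub).1.
  - by rewrite ge_min fT le_max (ltW TM) orbT.
exists s; split.
  by rewrite /s; case: mu1 => ->; case: c1 => ->; rewrite ?mulrNN ?mulN1r ?mul1r; auto.
exists c, T0, (y \o g); split; first by rewrite lt_max ltr01 orbT.
move=> T /surj[t tb <-]; have [gt gd] := gP t tb.
rewrite /= gt; split; first exact: cy.
have yd' := yd (inab t tb); rewrite -gt in yd'.
have := is_derive1_comp yd' gd; congr is_derive.
rewrite gt /cherkas_slope !horner_ramify expr0 expr1 !mulr1.
have -> : s * f t = x t by rewrite /f mulrA ss mul1r.
have y0 : y t != 0 by exact: ynz.
have c0 : c != 0 by case: c1 => ->; rewrite ?oppr_eq0 oner_neq0.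
by rewrite -[X in X * F t]mulr1 -cc /F /s; field; rewrite c0 y0.
Qed.

End OrbitToInfinity.

Lemma not_monodromic_escaping (R : realType) (P0 P1 P2 : {poly R}) :
  P0 != 0 -> P2 != 0 -> ~ monodromic_at_infinity (cherkas P0 P1 P2) ->
  exists s : R, (s = 1 \/ s = -1) /\ escaping P0 P1 P2 s 1.
Proof.
move=> P00 P20 nmono.
have [e [[e0 e1 _] eo]] : exists e, equator_equilibrium (cherkas P0 P1 P2) e /\
    orbit_connects (cherkas P0 P1 P2) e.
  apply: contrapT => H; apply: nmono => e ee eo.
  by apply: H; exists e.
have [mu [a [b [x [y [mu1 ab xy proj]]]]]] := param_of_orbit_connects eo.
case: e e0 e1 proj {eo} => [[z1 z2] z3] /= -> z12 proj.
have FF := to_right_end_filter ab.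
have [c1 c2 c3] := cvg_coordinates proj.
apply: (@orbit_escaping R P0 P1 P2 mu a b x y z1 z2) => //.
  by move=> t /xy[+ _]; rewrite /cherkas /= hornerC hornerX.
by move=> t /xy[_ +]; rewrite cherkas_horner.
Qed.

(** * The leading balance *)

Lemma near_pinfty_gt0 (R : realType) : \forall T \near +oo, (0 : R) < T.
Proof. by apply/near_pinfty_from; exists 1 => T; exact: lt_le_trans. Qed.

Lemma eventually_gt0 (R : realType) (W : {poly R}) (N : nat) :
  (size W <= N.+1)%N -> 0 < W`_N -> \forall T \near +oo, 0 < W.[T].
Proof.
move=> sW WN; have sE : size W = N.+1.
  apply/eqP; rewrite eqn_leq sW /= ltnNge; apply/negP => /leq_sizeP H.
  by rewrite H ?ltxx in WN.
have lW : 0 < lead_coef W by rewrite lead_coefE sE.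
have W0 : W != 0 by rewrite -lead_coef_eq0 gt_eqF.
have := poly_eventual_sign W0; apply: filterS => T.
by rewrite pmulr_rgt0.
Qed.

Lemma size_mulXn_le (R : realType) (P : {poly R}) (k d N : nat) :
  (size P <= d.+1)%N -> (k + d <= N)%N -> (size ('X^k * P)%R <= N.+1)%N.
Proof.
move=> sP kdN; apply: leq_trans (size_polyMleq _ _) _.
by rewrite size_polyXn addSn /= (leq_trans (leq_add (leqnn k) sP))// addnS ltnS.
Qed.

Lemma is_derive_monomial_quotient (R : realType) (c : R) (k1 k2 : nat) (T : R) :
  T != 0 -> is_derive T 1 (fun T => c * T ^+ k1 / T ^+ k2)
    (c * (k1%:R - k2%:R) * T ^+ k1 / T ^+ k2 / T).
Proof.
move=> T0.
have d1 := is_derive_monomial c k1 T.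
have d2 : is_derive T 1 (fun T : R => T ^+ k2) (k2%:R * T ^+ k2.-1).
  have := is_derive_monomial 1 k2 T; rewrite mul1r.
  by under eq_fun do rewrite mul1r.
have d3 : is_derive T 1 (fun T : R => (T ^+ k2)^-1) (- (T ^+ k2) ^- 2 *: (k2%:R * T ^+ k2.-1)).
  by apply: is_deriveV => //; rewrite expf_neq0.
apply: is_derive_eq; rewrite /GRing.scale /=.
have E k : k%:R * T ^+ k.-1 = k%:R * T ^+ k / T.
  by case: k => [|k]; rewrite ?mul0r// exprS [in RHS]mulrCA mulrAC mulfV// mul1r.
by rewrite -(mulrA c) !E; field; rewrite T0 expf_neq0.
Qed.

(** The polynomial [W] is the defect of the barrier [c T^(k1 - k2)], multiplied
    by a power of [T]. *)
Lemma escaping_monomial (R : realType) (P0 P1 P2 : {poly R}) (c : R) (k1 k2 N : nat) :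
  c != 0 -> (\forall T \near +oo, P0.[T] <= 0) ->
  let W := 'X^((2 * k2).+1) * P0 + c *: ('X^((k1 + k2).+1) * P1)
     + c ^+ 2 *: ('X^((2 * k1).+1) * P2) - (c ^+ 2 * (k1%:R - k2%:R)) *: 'X^(2 * k1) in
  (size W <= N.+1)%N -> 0 < W`_N -> escaping P0 P1 P2 1 1.
Proof.
move=> c0 P0neg W sW WN.
have T0p := near_pinfty_gt0 R.
have [T0 HT] : exists T0, forall T, T0 <= T -> [/\ P0.[T] <= 0, 0 < T & 0 < W.[T]].
  apply/near_pinfty_from; have WW := eventually_gt0 sW WN.
  by apply: filterS3 P0neg T0p WW => T.
pose Y (T : R) := c * T ^+ k1 / T ^+ k2.
pose dY (T : R) := c * (k1%:R - k2%:R) * T ^+ k1 / T ^+ k2 / T.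
apply: (@escaping_above R P0 P1 P2 1 1 c T0 Y dY) => T /HT[P0T T1 WT].
have Tn : T != 0 by rewrite gt_eqF.
split.
- have c2 : 0 < c ^+ 2 by rewrite exprn_even_gt0.
  have -> : c * Y T = c ^+ 2 * (T ^+ k1 / T ^+ k2) by rewrite /Y; ring.
  by rewrite pmulr_rgt0// divr_gt0// exprn_gt0.
- exact: is_derive_monomial_quotient.
- by rewrite horner_ramify expr0 expr1 !mul1r.
- rewrite !horner_ramify expr0 expr1 !mul1r.
  have WE : W.[T] = T ^+ (2 * k2).+1 * (P0.[T] + P1.[T] * Y T + P2.[T] * Y T ^+ 2 - Y T * dY T).
    rewrite /W !(hornerD, hornerN, hornerZ, hornerM, hornerXn) /Y /dY !exprS mul2n -addnn mul2n -addnn !exprD.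
    by field; rewrite Tn expf_neq0.
  by move: WT; rewrite WE pmulr_rgt0 ?exprn_gt0// subr_gt0 => /ltW.
Qed.

Lemma lead_coef_reflect (R : realType) (P : {poly R}) :
  lead_coef (P \Po (-1 *: 'X)) = (-1) ^+ (size P).-1 * lead_coef P.
Proof.
rewrite lead_coef_comp; last by rewrite size_scale ?size_polyX// oppr_eq0 oner_eq0.
by rewrite lead_coefZ lead_coefX mulr1 mulrC.
Qed.

Lemma eventual_sign_ramify (R : realType) (P : {poly R}) : P != 0 ->
  (\forall T \near +oo, 0 < lead_coef P * (ramify 1 1 P).[T]) /\
  (\forall T \near +oo, 0 < (-1) ^+ (size P).-1 * lead_coef P * - (ramify (-1) 1 P).[T]).
Proof.
move=> P0; split.
  have := poly_eventual_sign P0; apply: filterS => T.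
  by rewrite horner_ramify expr0 expr1 !mul1r.
have p0 : P \Po (-1 *: 'X) != 0.
  by rewrite -lead_coef_eq0 lead_coef_reflect mulf_neq0 ?signr_eq0 ?lead_coef_eq0.
have := poly_eventual_sign p0; apply: filterS => T.
rewrite lead_coef_reflect horner_ramify expr0 expr1 mulr1 horner_comp hornerZ hornerX.
by rewrite !mulr1 !mulN1r opprK.
Qed.

Lemma ramify11 (R : realType) (P : {poly R}) : ramify 1 1 P = P.
Proof. by rewrite /ramify mul1r scale1r expr0 mul1r scale1r expr1 comp_polyXr. Qed.

Lemma escaping_ramify (R : realType) (P0 P1 P2 : {poly R}) (s : R) (r : nat) :
  escaping (ramify s r P0) (ramify s r P1) (ramify s r P2) 1 1 -> escaping P0 P1 P2 s r.
Proof. by rewrite /escaping !ramify11. Qed.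

Lemma coef_mulXn_top (R : realType) (P : {poly R}) (k d N : nat) :
  N = (k + d)%N -> ('X^k * P)`_N = P`_d.
Proof. by move=> ->; rewrite coefXnM ltnNge leq_addr /= addKn. Qed.

Lemma coef_mulXn_small (R : realType) (P : {poly R}) (k d N : nat) :
  (size P <= d.+1)%N -> (k + d < N)%N -> ('X^k * P)`_N = 0.
Proof.
move=> sP kN; rewrite nth_default//.
by apply: leq_trans (size_mulXn_le sP (leqnn _)) _.
Qed.

Lemma size_barrier (R : realType) (P0 P1 P2 : {poly R}) (c : R) (k1 k2 d0 d1 d2 N : nat) :
  (size P0 <= d0.+1)%N -> (size P1 <= d1.+1)%N -> (size P2 <= d2.+1)%N ->
  ((2 * k2).+1 + d0 <= N)%N -> ((k1 + k2).+1 + d1 <= N)%N ->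
  ((2 * k1).+1 + d2 <= N)%N ->
  (size ('X^((2 * k2).+1) * P0 + c *: ('X^((k1 + k2).+1) * P1)
     + c ^+ 2 *: ('X^((2 * k1).+1) * P2) - (c ^+ 2 * (k1%:R - k2%:R)) *: 'X^(2 * k1))%R <= N.+1)%N.
Proof.
move=> s0 s1 s2 h0 h1 h2.
have add (p q : {poly R}) : (size p <= N.+1)%N -> (size q <= N.+1)%N -> (size (p + q)%R <= N.+1)%N.
  by move=> sp sq; apply: leq_trans (size_polyD _ _) _; rewrite geq_max sp.
have scl (a : R) (p : {poly R}) : (size p <= N.+1)%N -> (size (a *: p)%R <= N.+1)%N.
  by move=> sp; apply: leq_trans (size_scale_leq _ _) _.
have H0 := size_mulXn_le s0 h0.
have H1 := scl c _ (size_mulXn_le s1 h1).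
have H2 := scl (c ^+ 2) _ (size_mulXn_le s2 h2).
have H3 : (size (- ((c ^+ 2 * (k1%:R - k2%:R)) *: 'X^(2 * k1) : {poly R}))%R <= N.+1)%N.
  by rewrite size_polyN; apply: scl; rewrite size_polyXn; lia.
exact: add _ _ (add _ _ (add _ _ H0 H1) H2) H3.
Qed.

(** Without solutions over a half-line the leading terms of [P0] and [P2] must
    pull towards [y = 0], which fixes signs and parities, and [P1] must not
    overcome them. *)
Lemma not_escaping_leading (R : realType) (P0 P1 P2 : {poly R}) (d0 d2 m : nat) :
  size P0 = d0.+1 -> size P2 = d2.+1 -> m = (d0 + d2)./2 ->
  (forall s : R, s = 1 \/ s = -1 -> ~ escaping P0 P1 P2 s 1) ->
  [/\ odd d0 /\ odd d2, lead_coef P0 < 0 /\ lead_coef P2 < 0, (size P1 <= m.+1)%N &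
      P1`_m ^+ 2 <= 4 * lead_coef P0 * lead_coef P2].
Proof.
move=> sP0 sP2 mE nesc.
have P00 : P0 != 0 by rewrite -size_poly_eq0 sP0.
have P20 : P2 != 0 by rewrite -size_poly_eq0 sP2.
have l0 : lead_coef P0 != 0 by rewrite lead_coef_eq0.
have l2 : lead_coef P2 != 0 by rewrite lead_coef_eq0.
have s1 : (1 : R) = 1 \/ (1 : R) = -1 by left.
have s_1 : (-1 : R) = 1 \/ (-1 : R) = -1 by right.
have P0_repel s : s = 1 \/ s = -1 -> ~ \forall T \near +oo, 0 < (ramify s 1 P0).[T].
  move=> ss H; apply: (nesc s ss).
  have := poly_eventually_monotone_sign (ramify s 1 P1).
  have [T0 HT0] := (near_pinfty_from _).1 H.
  case=> /near_pinfty_from[T1 HT1].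
    apply: (@escaping_repelled _ _ _ _ _ _ (Num.max T0 T1)) => [T|].
      by rewrite ge_max => /andP[/HT0/ltW].
    by left=> T; rewrite ge_max => /andP[_ /HT1].
  apply: (@escaping_repelled _ _ _ _ _ _ (Num.max T0 T1)) => [T|].
    by rewrite ge_max => /andP[/HT0/ltW].
  by right=> T; rewrite ge_max => /andP[_ /HT1].
have [e1 e2] := eventual_sign_ramify P00; rewrite sP0 /= in e2.
have lc0 : lead_coef P0 < 0.
  rewrite ltNge le_eqVlt eq_sym (negbTE l0)/=; apply/negP => lp.
  by apply: (P0_repel 1 s1); apply: filterS e1 => T; rewrite pmulr_rgt0.
have od0 : odd d0.
  apply/negPn/negP => ev; apply: (P0_repel (-1) s_1); apply: filterS e2 => T.
  by rewrite -signr_odd (negbTE ev) expr0 mul1r mulrN -mulNr pmulr_rgt0 ?oppr_gt0.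
have P2_grow s : s = 1 \/ s = -1 -> (\forall T \near +oo, (ramify s 1 P0).[T] <= 0) ->
    lead_coef (ramify s 1 P2) <= 0.
  move=> ss H0; rewrite leNgt; apply/negP => H2; apply: (nesc s ss); apply: escaping_ramify.
  set Q0 := ramify s 1 P0 in H0 *; set Q1 := ramify s 1 P1; set Q2 := ramify s 1 P2 in H2 *.
  have [k0 E0] : exists k0, size Q0 = k0 by exists (size Q0).
  have [k1 E1] : exists k1, size Q1 = k1 by exists (size Q1).
  have [d E2] : exists d, size Q2 = d.+1.
    by exists (size Q2).-1; rewrite prednK// size_poly_gt0 -lead_coef_eq0 gt_eqF.
  have [sQ0 sQ1 sQ2] : [/\ (size Q0 <= k0.+1)%N, (size Q1 <= k1.+1)%N & (size Q2 <= d.+1)%N].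
    by rewrite E0 E1 E2 !leqnSn leqnn.
  (* If [Q2] is positive, a sufficiently high power of [T] is a barrier. *)
  pose k := (k0 + k1).+1.
  have [h0 h1 h2 h3] : [/\ ((2 * 0).+1 + k0 < (2 * k).+1 + d)%N,
      ((k + 0).+1 + k1 < (2 * k).+1 + d)%N, (0 <= (2 * k).+1 + d)%N
      & ((2 * k).+1 + d == 2 * k)%N = false].
    by rewrite /k; clear; split; lia.
  apply: (@escaping_monomial R Q0 Q1 Q2 1 k 0 ((2 * k).+1 + d)) => //.
    by apply: (@size_barrier R Q0 Q1 Q2 1 k 0 k0 k1 d) => //; exact: ltnW.
  rewrite !(coefB, coefD, coefZ) (@coef_mulXn_small _ Q0 _ k0)//.
  rewrite (@coef_mulXn_small _ Q1 _ k1)//.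
  rewrite (@coef_mulXn_top _ Q2 _ d)// coefXn h3.
  by rewrite mulr0 !add0r mulr0 subr0 expr1n mul1r; move: H2; rewrite lead_coefE E2.
have H0 s : s = 1 \/ s = -1 -> \forall T \near +oo, (ramify s 1 P0).[T] <= 0.
  case=> ->; [apply: filterS e1 | apply: filterS e2] => T.
    by rewrite nmulr_rgt0// => /ltW.
  by rewrite -signr_odd od0 expr1 mulN1r pmulr_rgt0 ?oppr_gt0// => /ltW.
have lr : lead_coef (ramify (-1) 1 P2) = - (-1) ^+ d2 * lead_coef P2.
  by rewrite /ramify expr0 mul1r expr1 lead_coefZ lead_coef_reflect sP2 mulr1 mulrA mulN1r.
have lc2 : lead_coef P2 < 0.
  by have := P2_grow 1 s1 (H0 1 s1); rewrite ramify11 le_eqVlt (negbTE l2).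
have od2 : odd d2.
  apply/negPn/negP => ev; have := P2_grow (-1) s_1 (H0 (-1) s_1).
  by rewrite lr -signr_odd (negbTE ev) expr0 mulN1r oppr_le0 leNgt lc2.
have m2 : (m + m = d0 + d2)%N.
  by have := odd_double_half (d0 + d2); rewrite oddD od0 od2 /= add0n -addnn mE.
have sP0' : (size P0 <= d0.+1)%N by rewrite sP0.
have sP2' : (size P2 <= d2.+1)%N by rewrite sP2.
have H0' : \forall T \near +oo, P0.[T] <= 0 by have := H0 1 s1; rewrite ramify11.
have P0d : P0`_d0 = lead_coef P0 by rewrite lead_coefE sP0.
have P2d : P2`_d2 = lead_coef P2 by rewrite lead_coefE sP2.
have sP1 : (size P1 <= m.+1)%N.
  rewrite leqNgt; apply/negP => sP1; apply: (nesc 1 s1).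
  have [d1 E1] : exists d1, size P1 = d1.+1 by exists (size P1).-1; case: (size P1) sP1.
  have sP1' : (size P1 <= d1.+1)%N by rewrite E1.
  have d1m : (m < d1)%N by move: sP1; rewrite E1.
  have l1 : lead_coef P1 != 0 by rewrite lead_coef_eq0 -size_poly_eq0 E1.
  have d02 : (0 < d2)%N by case: (d2) od2.
  have [h0 h1 h2 h3] : [/\ ((2 * d1).+1 + d0 < (d0.+1 + d1).+1 + d1)%N,
      ((d0.+1 + d1).+1 + d1 <= (d0.+1 + d1).+1 + d1)%N,
      ((2 * d0.+1).+1 + d2 < (d0.+1 + d1).+1 + d1)%N &
      ((d0.+1 + d1).+1 + d1 == 2 * d0.+1)%N = false].
    by clear -m2 d1m d02; split; lia.
  (* [P1] dominates along [lead_coef P1 * T^(d0 + 1 - d1)]. *)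
  apply: (@escaping_monomial R P0 P1 P2 (lead_coef P1) d0.+1 d1 ((d0.+1 + d1).+1 + d1)) => //.
    by apply: (@size_barrier R P0 P1 P2 _ _ _ d0 d1 d2) => //; exact: ltnW.
  rewrite !(coefB, coefD, coefZ) (@coef_mulXn_small _ P0 _ d0)//.
  rewrite (@coef_mulXn_top _ P1 _ d1)// (@coef_mulXn_small _ P2 _ d2)//.
  rewrite coefXn h3.
  have -> : P1`_d1 = lead_coef P1 by rewrite lead_coefE E1.
  by rewrite !mulr0 add0r addr0 subr0 -expr2 exprn_even_gt0.
split=> //; rewrite leNgt; apply/negP => disc; apply: (nesc 1 s1).
(* The vertex of the leading quadratic, whose value there is positive. *)
pose c := - P1`_m / (2 * lead_coef P2).
have b0 : P1`_m != 0.
  apply: contraTneq disc => ->; rewrite expr0n /= -leNgt.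
  by rewrite -mulrA mulr_ge0// ltW// nmulr_rgt0.
have c0 : c != 0 by rewrite mulf_neq0 ?oppr_eq0// invr_neq0// mulf_neq0// pnatr_eq0.
have d02 : (0 < d2)%N by case: (d2) od2.
have [h1 h2 h3] : [/\ ((2 * m).+1 + d0 = (d0 + m).+1 + m)%N,
    ((2 * m).+1 + d0 = (2 * d0).+1 + d2)%N & ((2 * m).+1 + d0 == 2 * d0)%N = false].
  by clear -m2 d02; split; lia.
apply: (@escaping_monomial R P0 P1 P2 c d0 m ((2 * m).+1 + d0)) => //.
  by apply: (@size_barrier R P0 P1 P2 _ _ _ d0 m d2); rewrite -?h1 -?h2.
rewrite !(coefB, coefD, coefZ) (@coef_mulXn_top _ P0 _ d0)//.
rewrite (@coef_mulXn_top _ P1 _ m)// (@coef_mulXn_top _ P2 _ d2)// coefXn h3.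
rewrite mulr0 subr0 P0d P2d.
have -> : lead_coef P0 + c * P1`_m + c ^+ 2 * lead_coef P2 =
    (4 * lead_coef P0 * lead_coef P2 - P1`_m ^+ 2) / (4 * lead_coef P2).
  by rewrite /c; field; rewrite l2.
by rewrite nmulr_rgt0 ?subr_lt0// invr_lt0 nmulr_llt0.
Qed.

(** The gain [1 + w^2] on the right is what makes the estimate stable under
    perturbations of the three coefficients, uniformly in [w]. *)
Lemma quadratic_gap_nonreal (R : realType) (a b e : R) :
  e < 0 -> b ^+ 2 < 4 * a * e ->
  exists2 d : R, 0 < d & forall w, a + b * w + e * w ^+ 2 <= - (2 * d) * (1 + w ^+ 2).
Proof.
move=> e0 disc.
have a0 : a < 0.
  rewrite ltNge; apply/negP => a0.
  have : a * e <= 0 by rewrite mulr_ge0_le0// ltW.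
  by have := sqr_ge0 b; lra.
have ae : 0 < - (a + e) by rewrite oppr_gt0; lra.
pose d := (4 * a * e - b ^+ 2) / (8 * - (a + e)).
have d0 : 0 < d by rewrite divr_gt0 ?subr_gt0 ?mulr_gt0.
have dE : 8 * d * - (a + e) = 4 * a * e - b ^+ 2.
  by rewrite /d; field; rewrite -(opprK (a + e)) oppr_eq0 gt_eqF.
have ed : e + 2 * d < 0.
  have : 2 * d * - (a + e) < - e * - (a + e).
    have : 0 < e * e by rewrite nmulr_rgt0.
    by have := sqr_ge0 b; lra.
  by rewrite ltr_pM2r//; lra.
exists d => // w.
have H : (e + 2 * d) * (a + b * w + e * w ^+ 2 + 2 * d * (1 + w ^+ 2)) >= 0.
  have -> : (e + 2 * d) * (a + b * w + e * w ^+ 2 + 2 * d * (1 + w ^+ 2)) =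
     ((e + 2 * d) * w + b / 2) ^+ 2 + ((e + 2 * d) * (a + 2 * d) - b ^+ 2 / 4) by field.
  rewrite addr_ge0 ?sqr_ge0//.
  have -> : (e + 2 * d) * (a + 2 * d) - b ^+ 2 / 4 =
     (4 * a * e - b ^+ 2 - 8 * d * - (a + e)) / 4 + 4 * d ^+ 2 by field.
  by rewrite dE subrr mul0r add0r mulr_ge0 ?sqr_ge0.
have : a + b * w + e * w ^+ 2 + 2 * d * (1 + w ^+ 2) <= 0.
  by rewrite -(nmulr_rge0 _ ed).
lra.
Qed.

Lemma quadratic_gap_double (R : realType) (e phi eta : R) :
  e < 0 -> 0 < eta -> exists2 d : R, 0 < d & forall w, eta <= `|w - phi| ->
    e * (w - phi) ^+ 2 <= - (2 * d) * (1 + w ^+ 2).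
Proof.
move=> e0 eta0; pose K := (1 + 2 * phi ^+ 2) / eta ^+ 2 + 2.
have K0 : 0 < K by rewrite addr_gt0// divr_gt0 ?exprn_gt0// ltr_pwDl// mulr_ge0 ?sqr_ge0.
exists (- e / (2 * K)); first by rewrite divr_gt0 ?oppr_gt0// mulr_gt0.
move=> w wphi.
have -> : - (2 * (- e / (2 * K))) * (1 + w ^+ 2) = e * ((1 + w ^+ 2) / K).
  by field; rewrite gt_eqF.
rewrite ler_nM2l// ler_pdivrMr//.
have H : eta ^+ 2 <= (w - phi) ^+ 2.
  by rewrite -(ger0_norm (sqr_ge0 (w - phi))) normrX ler_pXn2r ?nnegrE// ltW.
have H1 : 1 + 2 * phi ^+ 2 <= (w - phi) ^+ 2 * ((1 + 2 * phi ^+ 2) / eta ^+ 2).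
  rewrite [leRHS]mulrCA ler_peMr//; first by rewrite addr_ge0// mulr_ge0 ?sqr_ge0.
  by rewrite ler_pdivlMr ?exprn_gt0// mul1r.
rewrite /K mulrDr; have := sqr_ge0 (w - 2 * phi); move: H1; set Z := _ * (_ / _).
by clearbody Z; clear; lra.
Qed.

Lemma normr_le_1Dsqr (R : realType) (w : R) : `|w| <= 1 + w ^+ 2.
Proof.
have := sqr_ge0 (`|w| - 1); have -> : w ^+ 2 = `|w| ^+ 2 by rewrite -normrX ger0_norm ?sqr_ge0.
by have := normr_ge0 w; have := sqr_ge0 `|w|; move: `|w| => v; nra.
Qed.

Lemma quadratic_perturbation (R : realType) (A B C : R -> R) (a b e d : R) :
  0 < d -> A @ +oo --> a -> B @ +oo --> b -> C @ +oo --> e ->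
  \forall T \near +oo, forall w, a + b * w + e * w ^+ 2 <= - (2 * d) * (1 + w ^+ 2) ->
    A T + B T * w + C T * w ^+ 2 <= - d * (1 + w ^+ 2).
Proof.
move=> d0 /cvgrPdist_le cA /cvgrPdist_le cB /cvgrPdist_le cC.
have d2 : 0 < d / 2 by rewrite divr_gt0.
apply: filterS3 (cA _ d2) (cB _ d2) (cC _ d2) => T hA hB hC w H.
have k1 : A T - a <= d / 2 by rewrite distrC in hA; apply: le_trans (ler_norm _) hA.
have k2 : (B T - b) * w <= d / 2 * `|w|.
  by apply: le_trans (ler_norm _) _; rewrite normrM ler_wpM2r// distrC.
have k3 : (C T - e) * w ^+ 2 <= d / 2 * w ^+ 2.
  by rewrite ler_wpM2r ?sqr_ge0// (le_trans (ler_norm _))// distrC.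
have k4 := normr_le_1Dsqr w.
have k5 : d / 2 * `|w| <= d / 2 * (1 + w ^+ 2) by rewrite ler_pM2l.
move: k1 k2 k3 k5 H; move: (d / 2 * `|w|) => v.
clear; nra.
Qed.

(** The levels [phi - eta] and [phi + eta] can only be crossed upwards. *)
Lemma trapped_or_away (R : realType) (w dw : R -> R) (phi eta T0 : R) :
  0 < eta -> (forall T, T0 <= T -> is_derive T 1 w (dw T)) ->
  (forall T, T0 <= T -> eta <= `|w T - phi| -> 0 < dw T) ->
  (exists2 T1, T0 <= T1 & forall T, T1 <= T -> `|w T - phi| <= eta) \/
  (exists2 T1, T0 <= T1 & forall T, T1 <= T -> eta <= `|w T - phi|).
Proof.
move=> eta0 wd wout.
have barrier c T1 T : T0 <= T1 -> T1 <= T -> eta <= `|c - phi| -> c <= w T1 -> c <= w T.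
  move=> T01 T1T cphi cw; rewrite -subr_ge0.
  apply: (@ge0_of_zeros_increasing R (fun T => w T - c) dw T1) => //.
  - move=> x /andP[x1 _]; have ? := wd x (le_trans T01 x1).
    by rewrite -[dw x]subr0; apply: is_deriveB.
  - move=> x /andP[x1 _] /eqP; rewrite subr_eq0 => /eqP wx.
    by apply: wout; rewrite ?wx// (le_trans T01).
  - by rewrite subr_ge0.
have [[T1 T01 H]|H] := pselect (exists2 T1, T0 <= T1 & phi + eta <= w T1).
  right; exists T1 => // T T1T.
  have := barrier (phi + eta) T1 T T01 T1T.
  have -> : phi + eta - phi = eta by ring.
  rewrite gtr0_norm// => /(_ (lexx _) H) wT.
  by rewrite ger0_norm; lra.
have wlt T : T0 <= T -> w T < phi + eta.
  by move=> TT; rewrite ltNge; apply/negP => wT; apply: H; exists T.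
have [[T1 T01 H1]|H1] := pselect (exists2 T1, T0 <= T1 & phi - eta <= w T1).
  left; exists T1 => // T T1T.
  have := barrier (phi - eta) T1 T T01 T1T.
  have -> : phi - eta - phi = - eta by ring.
  rewrite normrN gtr0_norm// => /(_ (lexx _) H1) wT.
  by have := wlt T (le_trans T01 T1T); rewrite ler_norml => *; apply/andP; split; lra.
right; exists T0 => // T TT; rewrite ler0_norm.
  rewrite leNgt; apply/negP => wT; apply: H1; exists T => //; lra.
rewrite leNgt; apply/negP => wT; apply: H1; exists T => //; lra.
Qed.

Section LeadingBalance.
Variables (R : realType) (P0 P1 P2 : {poly R}) (d0 d2 m : nat) (s c T0 : R) (y : R -> R).
Hypothesis sP0 : size P0 = d0.+1.
Hypothesis sP2 : size P2 = d2.+1.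
Hypothesis sP1 : (size P1 <= m.+1)%N.
Hypothesis m2 : (m + m = d0 + d2)%N.
Hypothesis od0 : odd d0.
Hypothesis od2 : odd d2.
Hypothesis lc2 : lead_coef P2 < 0.
Hypothesis s1 : s = 1 \/ s = -1.
Hypothesis T00 : 0 < T0.
Hypothesis yP : forall T, T0 <= T -> 0 < c * y T /\ is_derive T 1 y
    (cherkas_slope (ramify s 1 P0) (ramify s 1 P1) (ramify s 1 P2) T (y T)).

Let w (T : R) := y T * (1 * T ^+ m / T ^+ d0).
Let A (T : R) := (reversal d0 P0).[s / T].
Let B (T : R) := s ^+ m.+1 * (reversal m P1).[s / T].
Let C (T : R) := (reversal d2 P2).[s / T] - (d0%:R - m%:R) / T ^+ d2.+1.
Let dw (T : R) := T ^+ d2 * (A T + B T * w T + C T * w T ^+ 2) / w T.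
Let b := s ^+ m.+1 * P1`_m.

Let ss : s * s = 1. Proof. by case: s1 => ->; rewrite ?mulrNN mulr1. Qed.
Let sodd k : odd k -> s * s ^+ k = 1.
Proof.
move=> ok; rewrite -exprS; case: s1 => ->; rewrite ?expr1n//.
by rewrite -signr_odd /= ok.
Qed.

Let w_sign T : T0 <= T -> 0 < c * w T.
Proof.
move=> TT; have T1 := lt_le_trans T00 TT; have [cy _] := yP TT.
by rewrite /w mulrA mulr_gt0// mul1r divr_gt0// exprn_gt0.
Qed.

Let w_der (T : R) : T0 <= T -> is_derive T 1 w (dw T).
Proof.
move=> TT; have T1 := lt_le_trans T00 TT; have [cy yd] := yP TT.
have Tn : T != 0 by rewrite gt_eqF.
have qd := is_derive_monomial_quotient 1 m d0 Tn.
have yn : y T != 0 by apply: contraTneq cy => ->; rewrite mulr0 ltxx.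
have sT : s * T != 0 by rewrite mulf_neq0//; apply: contra_eq_neq ss => ->; rewrite mul0r eq_sym oner_neq0.
have sTi : (s * T)^-1 = s / T by rewrite invfM (_ : s^-1 = s)//; case: s1 => ->; rewrite ?invrN invr1.
apply: is_derive_eq; rewrite /GRing.scale /= /dw /C /w /cherkas_slope !horner_ramify expr0 expr1 !mulr1.
rewrite (horner_reversal (n := d0)) ?sP0// (horner_reversal (n := d2) (P := P2)) ?sP2//.
rewrite (horner_reversal sP1)// sTi -/(A T).
set c1 := (reversal m P1).[_]; set c2 := (reversal d2 P2).[_].
have -> : B T = s ^+ m.+1 * c1 by [].
rewrite !exprMn (mulrA s (s ^+ d0 * _)) (mulrA s (s ^+ d0)) sodd// mul1r.
rewrite (mulrA s (s ^+ d2 * _)) (mulrA s (s ^+ d2)) sodd// mul1r.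
have Ed2 : T ^+ d2 = T ^+ m * T ^+ m / T ^+ d0 by rewrite -exprD m2 exprD mulrAC mulfV ?expf_neq0// mul1r.
rewrite (exprS T d2) Ed2 (exprS s m).
by field; rewrite Tn yn !expf_neq0.
Qed.

Let reciprocal_cvg : (fun T : R => s / T) @ +oo --> (0 : R).
Proof. by have := @cvg_divX_pinfty R s 1 isT; under eq_fun do rewrite expr1. Qed.

Let A_cvg : A @ +oo --> lead_coef P0.
Proof.
rewrite lead_coefE sP0 /= -(reversal0 d0); apply: cvg_horner; exact: reciprocal_cvg.
Qed.

Let B_cvg : B @ +oo --> b.
Proof.
rewrite /b -(reversal0 m); apply: cvgM; first exact: cvg_cst.
by apply: cvg_horner; exact: reciprocal_cvg.
Qed.

Let C_cvg : C @ +oo --> lead_coef P2.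
Proof.
rewrite lead_coefE sP2 /= -(reversal0 d2) -[X in _ --> X]subr0; apply: cvgB.
  by apply: cvg_horner; exact: reciprocal_cvg.
exact: cvg_divX_pinfty.
Qed.

(** Where the leading quadratic is negative, [w] moves towards [0] with a speed
    bounded from below, so it cannot stay there. *)
Let away_impossible (Out : R -> Prop) (d : R) : 0 < d ->
  (forall z, Out z -> lead_coef P0 + b * z + lead_coef P2 * z ^+ 2 <= - (2 * d) * (1 + z ^+ 2)) ->
  exists2 T1, T0 <= T1 & (forall T, T1 <= T -> Out (w T) -> Num.sg c * dw T <= - d) /\
    ~ exists2 T2, T1 <= T2 & forall T, T2 <= T -> Out (w T).
Proof.
move=> dp HO.
have [T1' H1] := (near_pinfty_from _).1 (quadratic_perturbation dp A_cvg B_cvg C_cvg).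
pose T1 := Num.max T0 (Num.max 1 T1').
have [T01 T11 T1T1] : [/\ T0 <= T1, 1 <= T1 & T1' <= T1] by rewrite !le_max !lexx !orbT.
have c0 : c != 0 by apply: contraTneq (yP (lexx T0)).1 => ->; rewrite mul0r ltxx.
have sgw T : T0 <= T -> Num.sg c * w T = `|w T|.
  move=> /w_sign cw; rewrite normrEsg; congr (_ * _).
  move: cw; have [cp|cn|cz] := ltrgtP 0 c; last by rewrite cz eqxx in c0.
    by rewrite pmulr_rgt0// => wp; rewrite !gtr0_sg.
  by rewrite nmulr_rgt0// => wp; rewrite !ltr0_sg.
have speed T : T1 <= T -> Out (w T) -> Num.sg c * dw T <= - d.
  move=> TT /HO /(H1 T (le_trans T1T1 TT)); set r := (X in X <= _) => Hr.
  have wn : w T != 0.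
    by apply: contraTneq (w_sign (le_trans T01 TT)) => ->; rewrite mulr0 ltxx.
  have wp : 0 < `|w T| by rewrite normr_gt0.
  have -> : Num.sg c * dw T = T ^+ d2 * r / `|w T|.
    rewrite -(sgw T (le_trans T01 TT)) /dw -/r.
    have sg2 : Num.sg c * Num.sg c = 1 by rewrite -expr2 sqr_sg c0.
    have sgn : Num.sg c != 0 by rewrite sgr_eq0.
    have sgi : (Num.sg c)^-1 = Num.sg c by rewrite -[LHS]mulr1 -sg2 mulrA mulVf ?mul1r.
    by rewrite (invfM (Num.sg c)) sgi mulrCA.
  rewrite ler_pdivrMr//.
  have Td : 1 <= T ^+ d2 by rewrite exprn_ege1// (le_trans T11).
  have q : d * `|w T| <= d * (1 + w T ^+ 2) by rewrite ler_pM2l// normr_le_1Dsqr.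
  have rn : T ^+ d2 * r <= r.
    by rewrite ler_neMl// (le_trans Hr)// mulNr oppr_le0 mulr_ge0 ?(ltW dp)// addr_ge0 ?sqr_ge0.
  by rewrite mulNr; apply: le_trans rn _; apply: le_trans Hr _; rewrite mulNr lerN2.
exists T1 => //; split => // -[T2 T12 HT2].
pose f T := Num.sg c * w T + d * T.
have fdec T : T2 <= T -> f T <= f T2.
  move=> TT; rewrite -lerN2.
  apply: (@le_is_derive R (- f) (fun T => - (Num.sg c * dw T + d)) _ _ TT) => x /andP[x2 _].
    have ? := w_der (le_trans T01 (le_trans T12 x2)).
    by apply: is_deriveN; apply: is_derive_eq; rewrite /GRing.scale /= mulr1.
  rewrite oppr_ge0 -lerBrDr sub0r; apply: speed; last exact: HT2.
  exact: le_trans x2.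
pose T3 := Num.max T2 (f T2 / d + 1).
have T23 : T2 <= T3 by rewrite le_max lexx.
have := fdec T3 T23; rewrite {1}/f leNgt => /negP; apply.
have : f T2 < d * T3.
  have : f T2 / d < T3 by rewrite lt_max ltrDl ltr01 orbT.
  by rewrite ltr_pdivrMr// mulrC.
move=> /lt_le_trans; apply; rewrite lerDr sgw ?normr_ge0//.
exact: le_trans (le_trans T01 T12) T23.
Qed.

Lemma leading_nonreal : b ^+ 2 < 4 * lead_coef P0 * lead_coef P2 -> False.
Proof.
move=> /(quadratic_gap_nonreal lc2)[d dp H].
have [T1 T01 [_]] := @away_impossible (fun=> True) d dp (fun z _ => H z).
by apply; exists T1.
Qed.

(** Outside a neighbourhood of the double root [w] drifts in one direction, so
    by [trapped_or_away] it must end up inside. *)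
Lemma leading_double (phi : R) :
  (forall z, lead_coef P0 + b * z + lead_coef P2 * z ^+ 2 = lead_coef P2 * (z - phi) ^+ 2) ->
  w @ +oo --> phi.
Proof.
move=> qE; apply/cvgrPdist_le => eta eta0.
have [d dp H] := quadratic_gap_double phi lc2 eta0.
have [|T1 T01 [speed away]] := @away_impossible (fun z => eta <= `|z - phi|) d dp.
  by move=> z /H; rewrite qE.
have c0 : c != 0 by apply: contraTneq (yP (lexx T0)).1 => ->; rewrite mul0r ltxx.
have sgn : `|Num.sg c| = 1 by rewrite normr_sg c0.
pose k := - Num.sg c.
have kn T : `|k * w T - k * phi| = `|w T - phi| by rewrite -mulrBr normrM normrN sgn mul1r.
have [||[T2 T12 H2]|[T2 T12 H2]] := @trapped_or_away R (fun T => k * w T) (fun T => k * dw T) (k * phi) eta T1 eta0.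
- by move=> T TT; have ? := w_der (le_trans T01 TT); apply: is_deriveZ.
- move=> T TT; rewrite kn => /(speed T TT); rewrite mulNr oppr_gt0 => /le_lt_trans; apply.
  by rewrite oppr_lt0.
- by apply/near_pinfty_from; exists T2 => T /H2; rewrite kn distrC.
- by case: away; exists T2 => // T /H2; rewrite kn.
Qed.

End LeadingBalance.

(** * Fields in two variables and their blow-ups *)

Lemma poly_ext (R : realType) (p q : {poly R}) : (forall x, p.[x] = q.[x]) -> p = q.
Proof.
move=> pq; apply/eqP; rewrite -subr_eq0; apply: contraT => d0.
have /near_pinfty_from[T0 /(_ T0 (lexx _))] := poly_eventual_sign d0.
by rewrite hornerD hornerN pq subrr mulr0 ltxx.
Qed.

Lemma poly2_ext (R : realType) (F G : {poly {poly R}}) :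
  (forall x y, F.[x, y] = G.[x, y]) -> F = G.
Proof.
move=> FG; apply/eqP; rewrite -subr_eq0 -swapXY_eq0; apply/eqP.
set D := F - G.
have D0 x : D.[x%:P] = 0.
  by apply: poly_ext => y; rewrite hornerD hornerN hornerD hornerN FG subrr horner0.
apply/polyP => j; rewrite coef0; apply: poly_ext => x; rewrite horner0.
have := horner_swapXY (swapXY D) x; rewrite swapXYK D0.
by move=> /(congr1 (fun q : {poly R} => q`_j)); rewrite coef0 coef_map /= /horner_eval => <-.
Qed.

Lemma horner2_mapC (R : realType) (p : {poly R}) (x y : R) : p^:P.[x, y] = p.[x].
Proof. by rewrite horner_map /= hornerC. Qed.

Lemma horner2_X (R : realType) (x y : R) : ('X : {poly {poly R}}).[x, y] = x.
Proof. by rewrite hornerX hornerC. Qed.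

Lemma horner2_Y (R : realType) (x y : R) : ('Y : {poly {poly R}}).[x, y] = y.
Proof. by rewrite hornerC hornerX. Qed.

Lemma horner2_C (R : realType) (c x y : R) : (c%:P%:P : {poly {poly R}}).[x, y] = c.
Proof. by rewrite !hornerC. Qed.

Lemma horner2D (R : realType) (F G : {poly {poly R}}) (x y : R) :
  (F + G).[x, y] = F.[x, y] + G.[x, y].
Proof. by rewrite !hornerD. Qed.

Lemma horner2N (R : realType) (F : {poly {poly R}}) (x y : R) :
  (- F).[x, y] = - F.[x, y].
Proof. by rewrite !hornerN. Qed.

Lemma horner2M (R : realType) (F G : {poly {poly R}}) (x y : R) :
  (F * G).[x, y] = F.[x, y] * G.[x, y].
Proof. by rewrite !hornerM. Qed.

Lemma horner2_exp (R : realType) (F : {poly {poly R}}) (n : nat) (x y : R) :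
  (F ^+ n).[x, y] = F.[x, y] ^+ n.
Proof. by rewrite !horner_exp. Qed.

Lemma horner2_nat (R : realType) (n : nat) (x y : R) :
  (n%:R : {poly {poly R}}).[x, y] = n%:R.
Proof. by rewrite -!polyC_natr horner2_C. Qed.

Definition horner2E := (horner2_mapC, horner2_X, horner2_Y, horner2_C, horner2_nat,
  horner2D, horner2N, horner2M, horner2_exp).

Lemma horner2_subst2 (R : realType) (F U V : {poly {poly R}}) (x y : R) :
  (subst2 F U V).[x, y] = F.[U.[x, y], V.[x, y]].
Proof.
rewrite (horner2_coef F) /subst2 !horner_sum; apply: eq_bigr => i _.
rewrite !horner_sum; apply: eq_bigr => j _.
by rewrite !horner2E.
Qed.

Lemma horner2_0y (R : realType) (F : {poly {poly R}}) (y : R) : F.[0, y] = (F`_0).[y].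
Proof. by rewrite horner_coef0. Qed.

Lemma horner2_00 (R : realType) (F : {poly {poly R}}) : F.[0, 0] = F`_0`_0.
Proof. by rewrite horner2_0y horner_coef0. Qed.

Lemma cvg_horner2 (R : realType) (S : set_system R) {FS : Filter S}
    (F : {poly {poly R}}) (f g : R -> R) (a b : R) :
  f @ S --> a -> g @ S --> b -> (fun T => F.[f T, g T]) @ S --> F.[a, b].
Proof.
move=> fa gb; rewrite horner2_coef.
under eq_fun do rewrite horner2_coef.
apply: cvg_bigsum => i; apply: cvg_bigsum => j.
have E (u : R -> R) (l : R) (k : nat) : u @ S --> l -> (fun T => u T ^+ k) @ S --> l ^+ k.
  move=> ul; have := @cvg_horner R S FS 'X^k u l ul; rewrite hornerXn.
  by under eq_fun do rewrite hornerXn.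
apply: cvgM; last exact: E.
by apply: cvgM; [exact: cvg_cst | exact: E].
Qed.

Lemma split_second_variable (R : realType) (G : {poly {poly R}}) :
  exists g0 g1 : {poly R}, exists g2 : {poly {poly R}},
  [/\ G = g0^:P + g1^:P * 'Y + g2 * 'Y ^+ 2, forall i, g0`_i = G`_i`_0,
      forall i, g1`_i = G`_i`_1 & g2.[0, 0] = G`_0`_2].
Proof.
pose g (k : nat) : {poly R} := \poly_(i < size G) G`_i`_k.
pose g2 : {poly {poly R}} := \poly_(i < size G) drop_poly 2 G`_i.
have gE k i : (g k)`_i = G`_i`_k.
  rewrite coef_poly; case: ltnP => // sG.
  by rewrite [G`_i]nth_default// coef0.
have g2E i : g2`_i = drop_poly 2 G`_i.
  rewrite coef_poly; case: ltnP => // sG.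
  by rewrite [G`_i]nth_default// drop_poly0r.
exists (g 0%N), (g 1%N), g2; split=> //; last first.
  by rewrite horner2_00 g2E coef_drop_poly.
apply/polyP => i; rewrite !coefD -!polyC_exp !coefMC !coef_map /= !gE.
rewrite -[LHS](poly_take_drop 2); congr (_ + _).
apply/polyP => j; rewrite coef_take_poly !coefD coefC coefMX coefC.
by case: j => [|[|j]] //=; rewrite ?addr0 ?add0r.
Qed.

(** [u'] times the defect of the equation [F dv = G du] along a curve [(u, v)]
    with velocity [(u', v')]. *)
Definition gap (R : realType) (X : vfield R) (u du v dv : R) : R :=
  X.2.[u, v] * du - X.1.[u, v] * dv.

Section BlowUp.
Variables (R : realType) (X : vfield R) (p S : nat) (phi : R).
Variables (F' G' : {poly {poly R}}).
Hypothesis FE : forall u v, X.1.[u, u ^+ p * (phi + v)] = u ^+ S.+1 * F'.[u, v].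
Hypothesis GE : forall u v, X.2.[u, u ^+ p * (phi + v)] = u ^+ (S + p) * G'.[u, v].

Lemma blow_upE :
  blow_up X p 1 S phi = ('X * F', G' - p%:R * (phi%:P%:P + 'Y) * F').
Proof.
rewrite /blow_up expr1.
have -> : subst2 X.1 'X ('X^p * (phi%:P%:P + 'Y)) = F' * 'X^(S.+1).
  by apply: poly2_ext => u v; rewrite horner2_subst2 !horner2E FE mulrC.
have -> : subst2 X.2 'X ('X^p * (phi%:P%:P + 'Y)) = G' * 'X^(S + p).
  by apply: poly2_ext => u v; rewrite horner2_subst2 !horner2E GE mulrC.
have -> : (Posz S + Posz 1 - 1 = Posz S)%R by rewrite addrK.
have -> : (Posz S + Posz 1 = Posz S.+1)%R by rewrite -PoszD addn1.
rewrite -PoszD /div_u mul1r !drop_polyMXn_id exprS mulrA.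
by rewrite drop_polyMXn_id (mulrC F').
Qed.

(** A curve in the blown-up plane and its image have defects of the same sign
    up to a power of [u]. *)
Lemma blow_up_gap (u du v dv : R) :
  gap X u du (u ^+ p * (phi + v)) (u ^+ p * dv + p%:R * u ^+ p.-1 * du * (phi + v)) =
  u ^+ (S + p) * gap (blow_up X p 1 S phi) u du v dv.
Proof.
rewrite blow_upE /gap /= FE GE !horner2E.
case: p => [|q]; rewrite ?addn0 ?addnS !exprS; first by ring.
by rewrite exprD; ring.
Qed.

End BlowUp.

(** The germs at the double roots that occur along the sequence of blow-ups:
    the first component has order exactly [N] in [u], and at [u = 0] the second
    one starts with [v^2]. *)
Definition germ (R : realType) (N : nat) (Z : vfield R) : Prop :=
  [/\ exists2 A, Z.1 = 'X^N * A & A.[0, 0] != 0, (Z.2)`_0`_0 = 0, (Z.2)`_0`_1 = 0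
    & (Z.2)`_0`_2 != 0].

(** No point of the support lies below the line [i + p j = p] through [(0, 1)]. *)
Definition edge_condition (R : realType) (Z : vfield R) (p : nat) : Prop :=
  [/\ (0 < p)%N, forall i, (i < 2 * p)%N -> (Z.2)`_i`_0 = 0,
      forall i, (i < p)%N -> (Z.2)`_i`_1 = 0 & forall i, (i <= p)%N -> (Z.1)`_i`_0 = 0].

(** The polynomial of the edge from [(2 p, -1)] to [(0, 1)]. *)
Definition edge_quadratic (R : realType) (Z : vfield R) (p : nat) : {poly R} :=
  (Z.2)`_0`_2 *: 'X^2 + ((Z.2)`_p`_1 - p%:R * (Z.1)`_p.+1`_0) *: 'X
    + ((Z.2)`_(2 * p)`_0)%:P.

Lemma poly_divXn (R : realType) (q : {poly R}) (k : nat) :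
  (forall i, (i < k)%N -> q`_i = 0) -> exists2 h : {poly R}, q = 'X^k * h & h`_0 = q`_k.
Proof.
move=> qk; exists (drop_poly k q); last by rewrite coef_drop_poly.
rewrite -[LHS](poly_take_drop k) mulrC (_ : take_poly k q = 0) ?add0r//.
by apply/polyP => i; rewrite coef_take_poly coef0; case: ifP => // /qk.
Qed.

Lemma coef_germ1 (R : realType) (N i : nat) (A : {poly {poly R}}) :
  ('X^N * A)`_i`_0 = if (i < N)%N then 0 else A`_(i - N)`_0.
Proof. by rewrite coefXnM; case: ifP => //; rewrite coef0. Qed.

Lemma germ_edge_lt (R : realType) (N p : nat) (Z : vfield R) :
  germ N Z -> edge_condition Z p -> (p < N)%N.
Proof.
move=> [[A ZE A0] _ _ _] [_ _ _ H]; rewrite ltnNge; apply/negP => /H.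
by rewrite ZE coef_germ1 ltnn subnn -horner2_00 => /eqP; apply/negP.
Qed.

Lemma edge_decomposition (R : realType) (N p : nat) (Z : vfield R) :
  germ N Z -> edge_condition Z p ->
  exists (A g2 : {poly {poly R}}) (h0 h1 : {poly R}),
  [/\ [/\ Z.1 = 'X^N * A, A.[0, 0] != 0 & (p < N)%N],
      Z.2 = 'X^(2 * p) * h0^:P + 'X^p * h1^:P * 'Y + g2 * 'Y ^+ 2
    & edge_quadratic Z p = g2.[0, 0] *: 'X^2
       + (h1.[0] - p%:R * 0 ^+ (N - p.+1) * A.[0, 0]) *: 'X + h0.[0]%:P].
Proof.
move=> gZ eZ; have pN := germ_edge_lt gZ eZ.
have [[A ZE A0] _ _ _] := gZ; have [_ H0 H1 _] := eZ.
have [g0 [g1 [g2 [GE g0E g1E g2E]]]] := split_second_variable Z.2.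
have [|h0 h0E h00] := @poly_divXn R g0 (2 * p); first by move=> i /H0; rewrite g0E.
have [|h1 h1E h10] := @poly_divXn R g1 p; first by move=> i /H1; rewrite g1E.
exists A, g2, h0, h1; split=> //.
  by rewrite {1}GE h0E h1E !rmorphM /= !map_polyXn.
rewrite /edge_quadratic g2E (horner_coef0 h0) (horner_coef0 h1) h00 h10 g0E g1E ZE coef_germ1.
congr (_ + _ *: _ + _); congr (_ - _); rewrite -mulrA; congr (_ * _).
have [pN'|pN'|pN'] := ltngtP p.+1 N.
- by rewrite expr0n subn_eq0 leqNgt pN' mul0r.
- by rewrite ltnNge pN in pN'.
- by rewrite pN' subnn expr0 mul1r horner2_00.
Qed.

(** Blowing up at a double root of the edge polynomial stays in the same class
    of fields, with a smaller order [N]. *)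
Lemma germ_blow_up (R : realType) (N p : nat) (Z : vfield R) (phi : R) :
  germ N Z -> edge_condition Z p ->
  edge_quadratic Z p = (Z.2)`_0`_2 *: ('X - phi%:P) ^+ 2 ->
  let Z' := blow_up Z p 1 p phi in
  [/\ germ (N - p) Z', (Z'.2)`_0`_2 = (Z.2)`_0`_2
    & forall u du v dv,
      gap Z u du (u ^+ p * (phi + v)) (u ^+ p * dv + p%:R * u ^+ p.-1 * du * (phi + v)) =
      u ^+ (p + p) * gap Z' u du v dv].
Proof.
move=> gZ eZ qE Z'.
have [A [g2 [h0 [h1 [[ZE A0 pN] GE q2]]]]] := edge_decomposition gZ eZ.
have [_ _ _ al0] := gZ; have [p0 _ _ _] := eZ.
pose W : {poly {poly R}} := phi%:P%:P + 'Y.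
pose A' := subst2 A 'X ('X^p * W).
pose F' := 'X^(N - p.+1) * A'.
pose G' := h0^:P + h1^:P * W + subst2 g2 'X ('X^p * W) * W ^+ 2.
have FE u v : Z.1.[u, u ^+ p * (phi + v)] = u ^+ p.+1 * F'.[u, v].
  by rewrite ZE /F' /A' !horner2E horner2_subst2 !horner2E mulrA -exprD subnKC.
have GE' u v : Z.2.[u, u ^+ p * (phi + v)] = u ^+ (p + p) * G'.[u, v].
  rewrite GE /G' !horner2E horner2_subst2 !horner2E mul2n -addnn !exprD; ring.
have al : g2.[0, 0] = (Z.2)`_0`_2.
  have := congr1 (fun q : {poly R} => q`_2) q2; rewrite /edge_quadratic.
  by rewrite !coefD !coefZ !coefXn !coefX !coefC /= !mulr1 !mulr0 !addr0.
have Z'E : Z' = ('X * F', G' - p%:R * W * F') by exact: blow_upE.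
have E0 : (0 : R) ^+ p = 0 by rewrite expr0n gtn_eqF.
have gapE := blow_up_gap FE GE'; rewrite -/Z' in gapE; clearbody Z'.
have Z'0 v : Z'.2.[0, v] = (Z.2)`_0`_2 * v ^+ 2.
  have := congr1 (fun q : {poly R} => q.[phi + v]) q2; rewrite qE.
  rewrite hornerZ horner_exp hornerD hornerN hornerX hornerC addrC addKr => ->.
  rewrite Z'E [_.2]/= /G' /W /F' /A' !horner2E !horner2_subst2 !horner2E E0 !mul0r.
  by rewrite !hornerD !hornerZ hornerC hornerXn hornerX; ring.
have Z'2 : (Z'.2)`_0 = (Z.2)`_0`_2 *: 'X^2.
  by apply: poly_ext => v; rewrite -horner2_0y Z'0 hornerZ hornerXn.
split.
- split; rewrite ?Z'2 ?coefZ ?coefXn /= ?mulr0 ?mulr1//.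
  exists A'.
    by rewrite Z'E /= /F' mulrA -exprS -subSn.
  by rewrite /A' horner2_subst2 !horner2E E0 mul0r.
- by rewrite Z'2 coefZ coefXn mulr1.
- exact: gapE.
Qed.

(** * Newton polygons *)

Lemma convex_setP (R : realType) (K : set (R * R)) :
  @convex_set R (R^o * R^o)%type K <->
  forall x y t, K x -> K y -> 0 <= t -> t <= 1 ->
    K (t * x.1 + (1 - t) * y.1, t * x.2 + (1 - t) * y.2).
Proof.
split=> [cK x y t Kx Ky t0 t1|H x y l /set_mem Kx /set_mem Ky].
  by have := cK x y (Itv01 t0 t1); rewrite !inE => /(_ Kx Ky).
have l0 : 0 <= l%:num by []. 
have l1 : l%:num <= 1 by [].
by apply/mem_set; exact: H x y l%:num Kx Ky l0 l1.
Qed.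

Lemma convex_half_plane (R : realType) (a b c : R) :
  @convex_set R (R^o * R^o)%type [set z : R * R | c <= a * z.1 + b * z.2].
Proof.
apply/convex_setP => x y t /= Kx Ky t0 t1.
have -> : a * (t * x.1 + (1 - t) * y.1) + b * (t * x.2 + (1 - t) * y.2) =
   t * (a * x.1 + b * x.2) + (1 - t) * (a * y.1 + b * y.2) by ring.
have -> : c = t * c + (1 - t) * c by ring.
by apply: lerD; rewrite ler_wpM2l// subr_ge0.
Qed.

Section Region.
Variables (R : realType) (X : vfield R).

Lemma newton_region_sub (K : set (R * R)) :
  @convex_set R (R^o * R^o)%type K ->
  (forall i j z, field_support X (i, j) -> i%:~R <= z.1 -> j%:~R <= z.2 -> K z) ->
  newton_region X `<=` K.
Proof.
move=> cK HK; apply: smallest_sub => // z [[i j] Sij [/= h1 h2]].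
exact: HK Sij h1 h2.
Qed.

Lemma newton_region_point (i j : int) (z : R * R) :
  field_support X (i, j) -> i%:~R <= z.1 -> j%:~R <= z.2 -> newton_region X z.
Proof. by move=> Sij h1 h2; apply: sub_gen_smallest; exists (i, j). Qed.

Lemma newton_region_convex (x y : R * R) (t : R) :
  newton_region X x -> newton_region X y -> 0 <= t -> t <= 1 ->
  newton_region X (t * x.1 + (1 - t) * y.1, t * x.2 + (1 - t) * y.2).
Proof.
move=> Rx Ry t0 t1 K [cK GK]; move/convex_setP: (cK); apply => //.
- by apply: Rx; split.
- by apply: Ry; split.
Qed.

Lemma newton_region_up (z d : R * R) :
  newton_region X z -> 0 <= d.1 -> 0 <= d.2 -> newton_region X (z.1 + d.1, z.2 + d.2).
Proof.
move=> Rz d1 d2; apply: (newton_region_sub (K := [set z | newton_region X (z.1 + d.1, z.2 + d.2)])) Rz.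
  apply/convex_setP => x y t /= Kx Ky t0 t1.
  have := newton_region_convex Kx Ky t0 t1; rewrite /=.
  by congr (newton_region X (_, _)); ring.
move=> i j w Sij h1 h2 /=; apply: newton_region_point Sij _ _ => /=.
  by rewrite (le_trans h1)// lerDl.
by rewrite (le_trans h2)// lerDl.
Qed.

(** An edge, being compact, is supported by a functional that increases along
    both recession directions of the region. *)
Lemma newton_edge_positive (E : set (R * R)) : newton_edge X E ->
  exists a b c : R, [/\ 0 < a, 0 < b,
    forall z, newton_region X z -> c <= a * z.1 + b * z.2,
    E = newton_region X `&` [set z | a * z.1 + b * z.2 = c]
  & exists z w, [/\ E z, E w & z <> w]].
Proof.
move=> [[a [b [c [_ Hc HE]]]] cE [z [w [Ez Ew zw]]]].
have [M [_ HM]] := @compact_bounded R (R^o * R^o)%type E cE.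
have bnd x : E x -> `|x.1| <= `|M| + 1 /\ `|x.2| <= `|M| + 1.
  move=> Ex; have := HM (`|M| + 1) _ x Ex.
  rewrite (le_lt_trans (ler_norm M)) ?ltrDl// => /(_ isT).
  by rewrite /= prod_normE ge_max => /andP[].
have [Rz zc] : newton_region X z /\ a * z.1 + b * z.2 = c by move: Ez; rewrite HE => -[].
have unb (d : R * R) : 0 <= d.1 -> 0 <= d.2 -> 0 <= a * d.1 + b * d.2.
  move=> d1 d2; have := Hc _ (newton_region_up Rz d1 d2); rewrite /= -zc; lra.
have a0 : 0 <= a by have := unb (1, 0); rewrite /= mulr1 mulr0 addr0; apply.
have b0 : 0 <= b by have := unb (0, 1); rewrite /= mulr1 mulr0 add0r; apply.
pose n := 2 * (`|M| + 1) + 1.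
have n0 : 0 <= n by rewrite /n addr_ge0// mulr_ge0// addr_ge0.
have [z1 z2] := bnd z Ez.
exists a, b, c; split=> //; last by exists z, w.
- rewrite lt_neqAle a0 andbT eq_sym; apply/negP => /eqP a00.
  have : E (z.1 + n, z.2 + 0).
    rewrite HE; split; first exact: (@newton_region_up z (n, 0)).
    by rewrite /= -zc a00; ring.
  move=> /bnd[/= + _]; rewrite ler_norml => /andP[_].
  by move: z1; rewrite ler_norml /n => /andP[+ _]; have := normr_ge0 M; lra.
- rewrite lt_neqAle b0 andbT eq_sym; apply/negP => /eqP b00.
  have : E (z.1 + 0, z.2 + n).
    rewrite HE; split; first exact: (@newton_region_up z (0, n)).
    by rewrite /= -zc b00; ring.
  move=> /bnd[_ /=]; rewrite ler_norml => /andP[_].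
  by move: z2; rewrite ler_norml /n => /andP[+ _]; have := normr_ge0 M; lra.
Qed.

End Region.

(** The segment from [(2 p, j0)] to [(0, j0 + 2)]: with height 2 and lower end
    on the line [j = j0], this is the only possible edge. *)
Definition edge_segment (R : realType) (j0 : int) (p : nat) : set (R * R) :=
  [set z | z.1 + p%:R * z.2 = p%:R * (j0%:~R + 2) /\ j0%:~R <= z.2 <= j0%:~R + 2].

Lemma addr_le0_eq0 (R : realType) (x y : R) : 0 <= x -> 0 <= y -> x + y <= 0 -> x = 0 /\ y = 0.
Proof. by move=> x0 y0 xy; split; lra. Qed.

Section UniqueEdge.
Variables (R : realType) (X : vfield R) (j0 : int).
Hypothesis S0 : forall i j, field_support X (i, j) -> 0 <= i /\ j0 <= j.
Hypothesis SA : field_support X (0, j0 + 2).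

Let J : R := j0%:~R.

Let top_region : newton_region X (0, J + 2).
Proof. by apply: newton_region_point SA _ _ => /=; rewrite ?intrD. Qed.

Let region_quadrant z : newton_region X z -> 0 <= z.1 /\ J <= z.2.
Proof.
move=> Rz.
have h1 : 0 <= 1 * z.1 + 0 * z.2.
  apply: (newton_region_sub (convex_half_plane (a := 1) (b := 0) (c := 0)) _ Rz).
  move=> i j w /S0[i0 _] h1 _ /=; rewrite mul1r mul0r addr0.
  by apply: le_trans h1; rewrite ler0z.
have h2 : J <= 0 * z.1 + 1 * z.2.
  apply: (newton_region_sub (convex_half_plane (a := 0) (b := 1) (c := J)) _ Rz).
  move=> i j w /S0[_ jj0] _ h2 /=; rewrite mul1r mul0r add0r.
  by apply: le_trans h2; rewrite ler_int.
by rewrite mul1r mul0r addr0 in h1; rewrite mul1r mul0r add0r in h2.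
Qed.

Let region_combination p t : field_support X ((2 * p)%N%:Z, j0) -> 0 <= t -> t <= 1 ->
  newton_region X (2 * p%:R * (1 - t), J + 2 * t).
Proof.
move=> SB t0 t1.
have RB : newton_region X (2 * p%:R, J).
  by apply: newton_region_point SB _ _ => //=; rewrite -pmulrn natrM.
have := newton_region_convex top_region RB t0 t1.
by congr (newton_region X (_, _)) => /=; ring.
Qed.

Let segment_region p : field_support X ((2 * p)%N%:Z, j0) ->
  edge_segment j0 p `<=` newton_region X.
Proof.
move=> SB [z1 z2] [/= zE /andP[h1 h2]].
have := @region_combination p ((z2 - J) / 2) SB.
have -> : J + 2 * ((z2 - J) / 2) = z2 by field.
have -> : 2 * p%:R * (1 - (z2 - J) / 2) = z1.
  have -> : z1 = p%:R * (J + 2) - p%:R * z2 by rewrite -zE addrK.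
  by field.
by apply; rewrite /J; lra.
Qed.

(** An edge has two distinct points, so its supporting functional is
    proportional to that of the line it lies on.  As the region lies above
    [j = j0] and contains [(0, j0 + 2)], height 2 forces the edge to be the whole
    segment; its lower end must be in the support, since otherwise a steeper
    line would still bound the region from below. *)
Lemma unique_edge_elim (E : set (R * R)) (p : nat) (sigma : int) :
  unique_edge X E p sigma ->
  [/\ (0 < p)%N, sigma = p%:Z * (j0 + 2), field_support X ((2 * p)%N%:Z, j0),
      forall i j, field_support X (i, j) -> p%:Z * (j0 + 2) <= i + p%:Z * j
    & E = edge_segment j0 p].
Proof.
move=> [uE hE _ [p0 _ _ lE]].
have [a [b [c [a0 b0 Hc HE [z [w [Ez Ew zw]]]]]]] := newton_edge_positive ((uE E).2 erefl).
have lineE x : E x -> x.1 + p%:R * x.2 = sigma%:~R by move=> /lE; rewrite mul1r.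
have fE x : E x -> a * x.1 + b * x.2 = c by rewrite HE => -[].
have z1E := lineE _ Ez; have w1E := lineE _ Ew.
have bE : b = a * p%:R.
  have zw2 : z.2 - w.2 != 0.
    apply/negP => /eqP zw2; apply: zw.
    have zw2' : z.2 = w.2 by apply/eqP; rewrite -subr_eq0 zw2.
    case: z w z1E w1E zw2' {Ez Ew zw2} => [z1 z2] [w1 w2] /= + + zw2.
    by rewrite zw2 => <- /addIr ->.
  have h1 := fE _ Ez; have h2 := fE _ Ew.
  apply: (mulIf zw2); apply/eqP; rewrite -subr_eq0; apply/eqP.
  have -> : b * (z.2 - w.2) - a * p%:R * (z.2 - w.2) =
    (a * z.1 + b * z.2) - (a * w.1 + b * w.2) - a * ((z.1 + p%:R * z.2) - (w.1 + p%:R * w.2)) by ring.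
  by rewrite h1 h2 z1E w1E !subrr mulr0 subrr.
have cE : c = a * sigma%:~R by rewrite -(fE _ Ez) -z1E bE; ring.
have Rs x : newton_region X x -> sigma%:~R <= x.1 + p%:R * x.2.
  move=> /Hc; rewrite cE bE -mulrA -mulrDr ler_pM2l//.
have HE' : E = newton_region X `&` [set x | x.1 + p%:R * x.2 = sigma%:~R].
  rewrite HE cE bE; apply/seteqP; split=> x /= [Rx]; rewrite -mulrA -mulrDr.
    by move=> /(mulfI (lt0r_neq0 a0)).
  by move=> ->.
have pp : (0 : R) < p%:R by rewrite ltr0n.
have sigma_le : sigma%:~R <= p%:R * (J + 2) by have := Rs _ top_region; rewrite /= add0r.
have E2 x : E x -> J <= x.2 /\ x.2 <= sigma%:~R / p%:R.
  move=> Ex; have : newton_region X x by move: Ex; rewrite HE' => -[].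
  move=> /region_quadrant[x1 x2]; split=> //.
  by rewrite ler_pdivlMr// mulrC -(lineE _ Ex) lerDr.
have E20 : snd @` E !=set0 by exists z.2; exists z.
have height_le l : (forall x, E x -> l <= x.2) -> 2 <= sigma%:~R / p%:R - l.
  move=> El; rewrite -hE /edge_height; apply: lerB.
    by apply: ge_sup => // _ [x /E2[_ ?] <-].
  by apply: lb_le_inf => // _ [x /El ? <-].
have sE : sigma%:~R = p%:R * (J + 2).
  apply/le_anti; rewrite sigma_le /=.
  have := height_le J (fun x Ex => (E2 x Ex).1).
  by rewrite lerBrDl ler_pdivlMr// mulrC addrC.
have sZ : sigma = p%:Z * (j0 + 2).
  by apply: (@intr_inj R); rewrite sE intrM intrD.
have SH i j : field_support X (i, j) -> p%:Z * (j0 + 2) <= i + p%:Z * j.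
  move=> Sij; have Rij : newton_region X (i%:~R, j%:~R) by apply: newton_region_point Sij _ _.
  have := Rs _ Rij.
  by rewrite -sZ /= -[p%:R]/(p%:Z%:~R) -intrM -intrD ler_int.
(* Otherwise the region lies above the line [i + (p + 1) (j - j0) = 2 p + 1],
   which meets the edge only where [j >= j0 + 1]; its height would be at most 1. *)
have SB : field_support X ((2 * p)%N%:Z, j0).
  apply: contrapT => nSB.
  have Rn x : newton_region X x -> p.+1%:R * J + (2 * p + 1)%:R <= 1 * x.1 + p.+1%:R * x.2.
    apply: (newton_region_sub (convex_half_plane (a := 1) (b := p.+1%:R) (c := _))).
    move=> i j y Sij y1 y2 /=.
    have h : p.+1%:Z * j0 + (2 * p + 1)%N%:Z <= i + p.+1%:Z * j.
      have := SH _ _ Sij; have [i0 jj0] := S0 Sij.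
      have [jE|jE|jE] := ltgtP j (j0 + 1).
      - have {}jE : j = j0 by lia.
        have iE : i <> (2 * p)%N%:Z by move=> iE; apply: nSB; rewrite -iE -jE.
        rewrite jE; nia.
      - have [k kE] : exists k : nat, j = j0 + 2 + k%:Z by exists `|(j - (j0 + 2))%R|%N; lia.
        rewrite kE; nia.
      - by rewrite jE; nia.
    rewrite mul1r; apply: (@le_trans _ _ (i%:~R + p.+1%:R * j%:~R)).
      rewrite /J -[p.+1%:R]/(p.+1%:Z%:~R) -[(2 * p + 1)%:R]/((2 * p + 1)%N%:Z%:~R).
      by rewrite -!intrM -!intrD ler_int.
    by apply: lerD => //; rewrite ler_wpM2l.
  have := height_le (J + 1); rewrite sE mulrAC divff ?gt_eqF// mul1r.
  have nle : ~ (2 <= J + 2 - (J + 1)) by lra.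
  move=> H; apply: nle; apply: H => x Ex.
  have xR : newton_region X x by move: Ex; rewrite HE' => -[].
  have := Rn _ xR; have := lineE _ Ex; rewrite sE mul1r -addn1 natrD natrD natrM.
  by lra.
split=> //.
apply/seteqP; split=> x Ex.
  have xl := lineE _ Ex; split; first by rewrite xl sE.
  have [-> /=] := E2 _ Ex; rewrite sE mulrAC divff ?gt_eqF// mul1r //.
rewrite HE'; split; first exact: segment_region Ex.
by case: Ex; rewrite sE.
Qed.

(** The region is the part of the quadrant above the line, so every point of
    it dominates a point of the segment.  A functional that is positive on both
    axes is therefore minimal on the segment, and it takes its minimum at two
    points only if it is constant there. *)
Lemma unique_edge_intro (p : nat) :
  (0 < p)%N -> field_support X ((2 * p)%N%:Z, j0) ->
  (forall i j, field_support X (i, j) -> p%:Z * (j0 + 2) <= i + p%:Z * j) ->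
  unique_edge X (edge_segment j0 p) p (p%:Z * (j0 + 2)).
Proof.
move=> p0 SB SH.
have pp : (0 : R) < p%:R by rewrite ltr0n.
have RH z : newton_region X z -> p%:R * (J + 2) <= z.1 + p%:R * z.2.
  move=> Rz; rewrite -[z.1]mul1r.
  apply: (newton_region_sub (convex_half_plane (a := 1) (b := p%:R) (c := _)) _ Rz).
  move=> i j y /SH h y1 y2 /=; rewrite mul1r; apply: (@le_trans _ _ (i%:~R + p%:R * j%:~R)).
    by rewrite /J -[p%:R]/(p%:Z%:~R) -[2]/(2%:Z%:~R) -intrD -!intrM -intrD ler_int.
  by apply: lerD => //; rewrite ler_wpM2l.
have segE : edge_segment j0 p =
    newton_region X `&` [set z | 1 * z.1 + p%:R * z.2 = p%:R * (J + 2)].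
  apply/seteqP; split=> z.
    by move=> Ez; split; [exact: segment_region Ez|case: Ez; rewrite /= mul1r].
  move=> [/region_quadrant[z1 z2] /=]; rewrite mul1r => zE; split=> //.
  by apply/andP; split=> //; rewrite -(ler_pM2l pp) -zE lerDr.
have inA : edge_segment j0 p (0, J + 2).
  by split; rewrite /= ?add0r// lexx andbT lerDl.
have inB : edge_segment j0 p (2 * p%:R, J).
  split; rewrite /= -/J; first by ring.
  by rewrite lexx /= lerDl.
have segI : edge_segment j0 p = (fun y => (p%:R * (J + 2) - p%:R * y, y)) @` `[J, J + 2]%classic.
  apply/seteqP; split=> [[z1 z2] [/= zE zI]|_ [y /= + <-]].
    by exists z2; rewrite /= ?in_itv//= -zE addrK.
  by rewrite in_itv /= => yI; split=> //=; rewrite subrK.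
have J2 : J <= J + 2 by rewrite lerDl.
split.
- move=> E'; split; last first.
    move=> ->; split.
    + by exists 1, p%:R, (p%:R * (J + 2)); split=> // [[]/eqP|z /RH]; rewrite ?oner_eq0// mul1r.
    + rewrite segI; apply: continuous_compact; last exact: segment_compact.
      apply: continuous_subspaceT => y; have y1 : (fun y : R => p%:R * (J + 2) - p%:R * y) @ y --> p%:R * (J + 2) - p%:R * y.
        by apply: cvgB; [exact: cvg_cst|apply: cvgM; [exact: cvg_cst|exact: cvg_id]].
      have y2 : (fun y : R => y) @ y --> y by exact: cvg_id.
      exact: cvg_pair y1 y2.
    + exists (0, J + 2), (2 * p%:R, J); split=> // -[_ /eqP].
      by rewrite -subr_eq0 addrC addKr pnatr_eq0.
  move=> /newton_edge_positive[a [b [c [a0 b0 Hc HE [z [w [Ez Ew zw]]]]]]].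
  pose fA := b * (J + 2); pose fB := a * (2 * p%:R) + b * J.
  have fAc : c <= fA by have := Hc _ top_region; rewrite /= mulr0 add0r.
  have fBc : c <= fB by exact: Hc (segment_region SB inB).
  have dec x : E' x -> exists t, [/\ 0 <= t, t <= 1, x = (2 * p%:R * (1 - t), J + 2 * t)
      & t * (fA - c) + (1 - t) * (fB - c) = 0].
    rewrite HE => -[Rx /= fx]; have [x1 x2] := region_quadrant Rx; have xH := RH _ Rx.
    pose t := Num.min 1 ((x.2 - J) / 2).
    have t0 : 0 <= t by rewrite /t le_min ler01 divr_ge0// subr_ge0.
    have t1 : t <= 1 by rewrite /t ge_min lexx.
    have h2 : J + 2 * t <= x.2.
      have : t <= (x.2 - J) / 2 by rewrite /t ge_min lexx orbT.
      by lra.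
    have h1 : 2 * p%:R * (1 - t) <= x.1.
      rewrite /t /Num.min; case: ifP => _; first by rewrite subrr mulr0.
      have -> : 2 * p%:R * (1 - (x.2 - J) / 2) = p%:R * (J + 2) - p%:R * x.2 :> R by field.
      by rewrite lerBlDr.
    have Rt := region_combination SB t0 t1.
    have fE : t * (fA - c) + (1 - t) * (fB - c) = a * (2 * p%:R * (1 - t)) + b * (J + 2 * t) - c.
      by rewrite /fA /fB; ring.
    have H : a * x.1 + b * x.2 <= a * (2 * p%:R * (1 - t)) + b * (J + 2 * t).
      by rewrite fx; exact: Hc Rt.
    have d1 : 0 <= a * (x.1 - 2 * p%:R * (1 - t)) by rewrite mulr_ge0 ?subr_ge0// ltW.
    have d2 : 0 <= b * (x.2 - (J + 2 * t)) by rewrite mulr_ge0 ?subr_ge0// ltW.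
    have dE : a * (x.1 - 2 * p%:R * (1 - t)) + b * (x.2 - (J + 2 * t)) <= 0.
      by move: H; lra.
    have [d10 d20] := addr_le0_eq0 d1 d2 dE.
    exists t; split=> //.
      move/eqP: d10; rewrite mulf_eq0 gt_eqF//= subr_eq0 => /eqP e1.
      move/eqP: d20; rewrite mulf_eq0 gt_eqF//= subr_eq0 => /eqP e2.
      by rewrite -e1 -e2; case: (x).
    rewrite fE -fx.
    have -> : a * (2 * p%:R * (1 - t)) + b * (J + 2 * t) - (a * x.1 + b * x.2) =
       - (a * (x.1 - 2 * p%:R * (1 - t))) - b * (x.2 - (J + 2 * t)) by ring.
    by rewrite d10 d20 subr0 oppr0.
  have [t [t0 t1 zE tE]] := dec _ Ez; have [t' [t0' t1' wE tE']] := dec _ Ew.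
  have tt' : t - t' != 0.
    by rewrite subr_eq0; apply/eqP => tt'; apply: zw; rewrite zE wE tt'.
  have fAB : fA = fB.
    apply/eqP; rewrite -subr_eq0; apply/eqP; apply: (mulfI tt'); rewrite mulr0.
    have -> : (t - t') * (fA - fB) = (t * (fA - c) + (1 - t) * (fB - c)) -
       (t' * (fA - c) + (1 - t') * (fB - c)) by ring.
    by rewrite tE tE' subrr.
  have fAE : fA = c.
    apply/eqP; rewrite -subr_eq0 -tE -fAB; apply/eqP; ring.
  have bE : b = a * p%:R by move: fAB; rewrite /fA /fB; lra.
  rewrite HE segE; congr (_ `&` _); rewrite -fAE /fA bE.
  apply/seteqP; split=> x /=; rewrite mul1r -!mulrA -mulrDr.
    by move=> /(mulfI (lt0r_neq0 a0)).
  by move=> ->.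
- rewrite /edge_height segI image_comp.
  by rewrite (_ : _ @` _ = `[J, J + 2]%classic) ?image_id// sup_itvcc// inf_itvcc// addrC addKr.
- rewrite /edge_width.
  have -> : fst @` edge_segment j0 p = `[0 : R, 2 * p%:R]%classic.
    apply/seteqP; split=> [_ [z [zE /andP[h1 h2]] <-]|x /=]; rewrite /= in_itv /=.
      have -> : z.1 = p%:R * (J + 2) - p%:R * z.2 by rewrite -zE addrK.
      rewrite subr_ge0 ler_pM2l// h2 /= lerBlDr (mulrC 2) -mulrDr ler_pM2l//.
      by rewrite addrC lerD2l.
    move=> /andP[x0 x1]; exists (x, J + 2 - x / p%:R) => //; split=> /=.
      by rewrite mulrBr mulrCA divff ?gt_eqF// mulr1 addrC subrK.
    rewrite lerBlDr lerDl divr_ge0 ?ler0n// andbT lerBrDl -/J (addrC _ J) lerD2l.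
    by rewrite ler_pdivrMr.
  by rewrite sup_itvcc ?inf_itvcc ?subr0// mulr_ge0.
- split=> //; first exact: coprimen1.
  by move=> z [zE _]; rewrite mul1r zE intrM intrD.
Qed.

End UniqueEdge.

(** The only lattice points of the segment are its two ends and its middle. *)
Lemma edge_polyE (R : realType) (X : vfield R) (j0 : int) (p : nat) : (0 < p)%N ->
  edge_poly X (edge_segment j0 p) p 1 =
    (coef2 X.2 (2 * p)%N (j0 + 1) - p%:R * coef2 X.1 ((2 * p)%N%:Z + 1) j0)
      *: 'X^(`|(j0 + 1)%R|%N)
    + (coef2 X.2 p (j0 + 1 + 1) - p%:R * coef2 X.1 (p%:Z + 1) (j0 + 1))
      *: 'X^(`|(j0 + 1 + 1)%R|%N)
    + (coef2 X.2 0 (j0 + 2 + 1) - p%:R * coef2 X.1 (0 + 1) (j0 + 2))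
      *: 'X^(`|(j0 + 2 + 1)%R|%N).
Proof.
move=> p0; rewrite /edge_poly.
pose s : seq (int * int) := [:: ((2 * p)%N%:Z, j0); (p%:Z, j0 + 1); (0, j0 + 2)].
have us : uniq s by rewrite /s /= !inE !xpair_eqE; apply/and3P; split => //; lia.
have -> : [set ij | edge_segment j0 p (lattice_point R ij)] = [set` s].
  apply/seteqP; split=> -[i j].
    move=> [/= iE /andP[h1 h2]].
    have jI : j0 <= j <= j0 + 2.
      by rewrite -!(ler_int R) intrD h1 h2.
    have {}iE : i + p%:Z * j = p%:Z * (j0 + 2).
      apply: (@intr_inj R); rewrite intrD intrM iE intrM intrD//.
    have iE' : i = p%:Z * (j0 + 2 - j) by lia.
    rewrite /= !inE !xpair_eqE.
    have [jE|[jE|jE]] : j = j0 \/ j = j0 + 1 \/ j = j0 + 2 by lia.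
    - by apply/or3P/Or31; rewrite iE' jE eqxx andbT; apply/eqP; lia.
    - by apply/or3P/Or32; rewrite iE' jE eqxx andbT; apply/eqP; lia.
    - by apply/or3P/Or33; rewrite iE' jE eqxx andbT; apply/eqP; lia.
  rewrite /= !inE !xpair_eqE => /or3P[] /andP[/eqP-> /eqP->]; split => /=;
    rewrite ?intrD ?natrM; [ring| |ring| |ring| ]; rewrite ?lexx ?lerDl//= ?lerD2l ?ler1n//.
    by rewrite andbT ler0z.
  by rewrite andbT -intrD ler0z.
rewrite -fsbig_seq//= /s !big_cons big_nil addr0 /= addrA !mul1r.
by [].
Qed.

(** What the analysis of the Newton polygon needs: the support then lies in
    [i >= 0, j >= -1] and contains [(0, 1)].  The second condition excludes a
    contribution of [F] to the edge at [(0, 1)] whenever there is an edge. *)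
Definition pregerm (R : realType) (Z : vfield R) : Prop :=
  [/\ (Z.1)`_0 = 0, (Z.1)`_1`_0 = 0 -> (Z.1)`_1 = 0 & (Z.2)`_0`_2 != 0].

Lemma germ_pregerm (R : realType) (N : nat) (Z : vfield R) :
  (0 < N)%N -> germ N Z -> pregerm Z.
Proof.
move=> N0 [[A ZE A0] _ _ al0]; split=> //.
  by rewrite ZE coefXnM N0.
rewrite ZE coefXnM; case: ifP => [//|N1].
have -> : N = 1%N by case: N N0 N1 {ZE A0} => [|[]].
by rewrite -horner2_00 => /eqP; rewrite (negPf A0).
Qed.

Lemma field_supportE (R : realType) (X : vfield R) (i j : int) :
  field_support X (i, j) <-> coef2 X.1 (i + 1) j != 0 \/ coef2 X.2 i (j + 1) != 0.
Proof.
rewrite /field_support /=; split.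
  move=> H; apply/orP; apply: contraPT H; rewrite negb_or !negbK => /andP[/eqP-> /eqP->].
  by [].
by move=> [/eqP H|/eqP H] [H1 H2].
Qed.

Lemma pregerm_support (R : realType) (Z : vfield R) : pregerm Z ->
  (forall i j, field_support Z (i, j) -> 0 <= i /\ -1 <= j) /\ field_support Z (0, 1).
Proof.
move=> [F0 _ al0]; split; last by apply/field_supportE; right.
move=> i j /field_supportE[]; case: i => [i|[|i]]; case: j => [j|[|j]] //=; rewrite ?eqxx//.
by rewrite subnn F0 coef0 eqxx.
Qed.

Lemma pregerm_unique_edge (R : realType) (Z : vfield R) E p sigma : pregerm Z ->
  unique_edge Z E p sigma <->
  [/\ edge_condition Z p, (edge_quadratic Z p)`_0 != 0, E = edge_segment (-1) p
    & sigma = p].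
Proof.
move=> pZ; have [S0 SA] := pregerm_support pZ; have [F0 F1 al0] := pZ.
have q0 : (edge_quadratic Z p)`_0 = (Z.2)`_(2 * p)`_0.
  by rewrite /edge_quadratic !coefD !coefZ coefXn coefX coefC /= !mulr0 !add0r.
have SBE : field_support Z ((2 * p)%N%:Z, -1) <-> (edge_quadratic Z p)`_0 != 0.
  rewrite field_supportE q0 addNr; split; last by right.
  by move=> [] //; rewrite /= eqxx.
have m12 : (-1 + 2 = 1 :> int) by [].
split=> [/(unique_edge_elim S0 SA)|].
  rewrite m12 mulr1 => -[p0 sE /SBE q00 H ->]; split => //; split=> //.
  - move=> i i2p; apply/eqP; apply: contraT => G0.
    have /H : field_support Z (i%:Z, (-1)) by apply/field_supportE; right; rewrite addNr.
    by lia.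
  - move=> i ip; apply/eqP; apply: contraT => G0.
    have /H : field_support Z (i%:Z, 0) by apply/field_supportE; right; rewrite add0r.
    by lia.
  - move=> [_|i ip]; first by rewrite F0 coef0.
    apply/eqP; apply: contraT => G0.
    have /H : field_support Z (i%:Z, 0) by apply/field_supportE; left; rewrite -PoszD addn1.
    by lia.
move=> [[p0 G0 G1 H0] /SBE SB -> ->].
have := unique_edge_intro S0 SA p0 SB; rewrite m12 mulr1; apply=> i j Sij.
have [] := S0 _ _ Sij; move/field_supportE: Sij; case: i => [i|//]; case: j => [j|[|j]] //=.
- move=> Sij _ _; case: j Sij => [|j] Sij; last by nia.
  rewrite mulr0 addr0 lez_nat leqNgt; apply/negP => ip; move: Sij.
  by rewrite add0n addn1 H0// G1// eqxx => -[].
- rewrite subnn => Sij _ _; have ip : (2 * p <= i)%N.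
    rewrite leqNgt; apply/negP => ip; move: Sij.
    by rewrite G0// eqxx => -[].
  by lia.
Qed.

Lemma pregerm_edge_poly (R : realType) (Z : vfield R) p : pregerm Z -> edge_condition Z p ->
  edge_poly Z (edge_segment (-1) p) p 1 = edge_quadratic Z p.
Proof.
move=> [F0 F1 al0] [p0 _ _ H0].
have F10 : (Z.1)`_1 = 0 by apply: F1; apply: H0.
rewrite edge_polyE// /edge_quadratic.
have -> : -1 + 1 = 0 :> int by [].
have -> : -1 + 2 = 1 :> int by [].
rewrite -!PoszD addn1 /= F10 coef0 !mulr0 !subr0 expr0 expr1 alg_polyC.
by rewrite !addn1 addrC [X in _ + X]addrC addrA.
Qed.

Lemma quadratic_nonroot (R : realType) (a b c : R) : a != 0 ->
  (forall r, ~~ root (a *: 'X^2 + b *: 'X + c%:P) r) <-> b ^+ 2 < 4 * a * c.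
Proof.
move=> a0; have qz z : (a *: 'X^2 + b *: 'X + c%:P).[z] = a * z ^+ 2 + b * z + c.
  by rewrite !hornerD !hornerZ hornerC hornerXn hornerX.
split=> [nr|disc r]; last first.
  rewrite /root qz; apply/negP => /eqP rE.
  have : 0 <= (2 * a * r + b) ^+ 2 by exact: sqr_ge0.
  have -> : (2 * a * r + b) ^+ 2 = 4 * a * (a * r ^+ 2 + b * r + c) + (b ^+ 2 - 4 * a * c) by ring.
  by rewrite rE mulr0 add0r leNgt subr_lt0 disc.
rewrite ltNge; apply/negP => disc; pose D := b ^+ 2 - 4 * a * c.
have D0 : 0 <= D by rewrite subr_ge0.
have /negP := nr ((- b + Num.sqrt D) / (2 * a)); apply; rewrite /root qz; apply/eqP.
have -> : a * ((- b + Num.sqrt D) / (2 * a)) ^+ 2 + b * ((- b + Num.sqrt D) / (2 * a)) + c =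
   (Num.sqrt D ^+ 2 - D) / (4 * a) by rewrite /D; field.
by rewrite sqr_sqrtr// subrr mul0r.
Qed.

Lemma quadratic_double_root (R : realType) (a b c : R) : a != 0 -> c != 0 ->
  b ^+ 2 = 4 * a * c ->
  exists2 phi, phi != 0 & a *: 'X^2 + b *: 'X + c%:P = a *: ('X - phi%:P) ^+ 2.
Proof.
move=> a0 c0 disc; pose phi := - b / (2 * a).
have cE : c = a * phi ^+ 2.
  by apply: (@mulfI _ (4 * a)); [rewrite mulf_neq0|rewrite -disc /phi; field].
exists phi; first by apply: contraNneq c0 => phi0; rewrite cE phi0 expr0n mulr0.
apply: poly_ext => x; rewrite cE !hornerD !hornerZ horner_exp.
by rewrite !hornerE /phi /=; field.
Qed.

Lemma mup_Xn_double (R : realType) (e : nat) (a phi : R) : a != 0 -> phi != 0 ->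
  mup phi ('X^e * (a *: ('X - phi%:P) ^+ 2)) = 2%N.
Proof.
move=> a0 phi0; rewrite mupMr.
  by rewrite -mul_polyC mupMr ?rootC// mup_XsubCX eqxx.
by rewrite /root hornerXn expf_neq0.
Qed.

(** The factor [X^e] does not vanish at the nonzero root, so the multiplicity
    is that of the quadratic factor. *)
Lemma double_root_quadratic (R : realType) (e : nat) (a b c phi : R) :
  let q := a *: 'X^2 + b *: 'X + c%:P in
  a != 0 -> phi != 0 -> mup phi ('X^e * q) = 2%N -> q = a *: ('X - phi%:P) ^+ 2.
Proof.
move=> q a0 phi0; have q2 : q`_2 = a.
  by rewrite /q !coefD !coefZ coefXn coefX coefC /= mulr0 mulr1 !addr0.
have q0 : q != 0 by apply: contraNneq a0 => qE; rewrite -q2 qE coef0.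
have sq : (size q <= 3)%N.
  rewrite /q; apply: (leq_trans (size_polyD _ _)); rewrite geq_max (leq_trans (size_polyC_leq1 _))//.
  rewrite andbT; apply: (leq_trans (size_polyD _ _)); rewrite geq_max.
  by rewrite !(leq_trans (size_scale_leq _ _))// ?size_polyXn ?size_polyX.
rewrite mupMr; last by rewrite /root hornerXn expf_neq0.
move=> m2; have : (2 <= mup phi q)%N by rewrite m2.
rewrite mup_geq// => /dvdpP[r qE].
have s2 : size (('X - phi%:P) ^+ 2) = 3%N by rewrite size_exp_XsubC.
have r0 : r != 0 by apply: contraNneq q0 => rE; rewrite qE rE mul0r.
have sr : (size r <= 1)%N.
  have x0 : ('X - phi%:P) ^+ 2 != 0 by rewrite -size_poly_gt0 s2.
  by move: sq; rewrite qE size_mul// s2 addn3.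
move: qE; rewrite (size1_polyC sr) mul_polyC => qE.
have : (r`_0 *: ('X - phi%:P) ^+ 2)`_2 = a by rewrite -qE q2.
rewrite coefZ; have -> : (('X - phi%:P) ^+ 2)`_2 = 1.
  have := monicP (monic_exp 2 (monicXsubC phi)).
  by rewrite lead_coefE s2.
by rewrite mulr1 => <-.
Qed.

Lemma desingularizes_at0 (R : realType) (Z : vfield R) :
  desingularizes_at Z 0 <->
  exists E p sigma, unique_edge Z E p sigma /\
    forall r : R, r != 0 -> ~~ root (edge_poly Z E p 1) r.
Proof.
split=> [[Y [E [p [s [f [<- _ uE nr]]]]]]|[E [p [s [uE nr]]]]].
  by exists (E 0%N), (p 0%N), (s 0%N).
by exists (fun=> Z), (fun=> E), (fun=> p), (fun=> s), (fun=> 0); split.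
Qed.

(** The first blow-up is separated from the others by a shift of the sequences. *)
Lemma desingularizes_atS (R : realType) (Z : vfield R) (m : nat) :
  desingularizes_at Z m.+1 <->
  exists E p sigma phi, [/\ unique_edge Z E p sigma,
    unique_nonzero_root (edge_poly Z E p 1) phi, mup phi (edge_poly Z E p 1) = 2%N
  & desingularizes_at (blow_up Z p 1 sigma phi) m].
Proof.
split=> [[Y [E [p [s [f [YZ H uE nr]]]]]]|[E [p [s [f [uE r1 r2 [Y [E' [p' [s' [f' [YZ H uE' nr]]]]]]]]]]]].
  exists (E 0%N), (p 0%N), (s 0%N), (f 0%N); have [] := H 0%N isT; rewrite YZ => h1 h2 h3 <-.
  split=> //; exists (Y \o S), (E \o S), (p \o S), (s \o S), (f \o S).
  by split=> // i im; exact: H.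
pose cons T (x : T) (f : nat -> T) i := if i is j.+1 then f j else x.
exists (cons _ Z Y), (cons _ E E'), (cons _ p p'), (cons _ s s'), (cons _ f f'); split=> //.
case=> [|i] im /=; first by rewrite YZ.
exact: H.
Qed.

Section QuadraticStep.
Variables (R : realType) (Z : vfield R) (e : nat) (a : R) (C : nat -> Prop).
Variables (q : nat -> {poly R}) (E0 : nat -> set (R * R)) (sigma0 : nat -> int).
Hypothesis uE : forall E p sigma, unique_edge Z E p sigma <->
  [/\ C p, (q p)`_0 != 0, E = E0 p & sigma = sigma0 p].
Hypothesis pE : forall p, C p -> (q p)`_0 != 0 -> edge_poly Z (E0 p) p 1 = 'X^e * q p.
Hypothesis a0 : a != 0.
Hypothesis qE : forall p, exists b c, q p = a *: 'X^2 + b *: 'X + c%:P.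

Lemma desingularizes_at0_quadratic :
  desingularizes_at Z 0 <-> exists p, C p /\ forall r, ~~ root (q p) r.
Proof.
rewrite desingularizes_at0; split=> [[E [p [s [/uE[Cp q0 -> _] nr]]]]|[p [Cp nr]]].
  exists p; split=> // r; have [->|r0] := eqVneq r 0.
    by rewrite /root horner_coef0.
  by have := nr r r0; rewrite pE// rootM negb_or => /andP[].
have q0 : (q p)`_0 != 0 by rewrite -horner_coef0; exact: nr.
exists (E0 p), p, (sigma0 p); split; first by apply/uE.
move=> r r0; rewrite pE// rootM negb_or nr andbT.
by rewrite /root hornerXn expf_neq0.
Qed.

Lemma desingularizes_atS_quadratic (m : nat) :
  desingularizes_at Z m.+1 <-> exists p phi, [/\ C p, phi != 0,
    q p = a *: ('X - phi%:P) ^+ 2 & desingularizes_at (blow_up Z p 1 (sigma0 p) phi) m].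
Proof.
rewrite desingularizes_atS; split.
  move=> [E [p [s [phi [/uE[Cp q0 -> ->] [phi0 _] mup2 D]]]]]; exists p, phi; split=> //.
  move: mup2; rewrite pE//; have [b [c ->]] := qE p.
  exact: double_root_quadratic.
move=> [p [phi [Cp phi0 qpE D]]].
have q0 : (q p)`_0 != 0.
  rewrite -horner_coef0 qpE hornerZ horner_exp !hornerE/=.
  by rewrite !mulf_neq0 ?oppr_eq0.
exists (E0 p), p, (sigma0 p), phi; split=> //.
- exact/uE.
- split=> // r r0; rewrite pE// qpE rootM; split.
    move=> /orP[]; first by rewrite /root hornerXn expf_eq0 (negPf r0) andbF.
    rewrite /root hornerZ horner_exp mulf_eq0 (negPf a0) /= expf_eq0 /=.
    by rewrite -/(root _ r) root_XsubC => /eqP.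
  by move=> ->; rewrite rootZ// root_exp_XsubC eqxx orbT.
- by rewrite pE// qpE mup_Xn_double.
Qed.

End QuadraticStep.

Section PregermStep.
Variables (R : realType) (Z : vfield R).
Hypothesis pZ : pregerm Z.

Let qE p : exists b c, edge_quadratic Z p = (Z.2)`_0`_2 *: 'X^2 + b *: 'X + c%:P.
Proof. by eexists; eexists. Qed.

Let pE p : edge_condition Z p -> (edge_quadratic Z p)`_0 != 0 ->
  edge_poly Z (edge_segment (-1) p) p 1 = 'X^0 * edge_quadratic Z p.
Proof. by move=> Cp _; rewrite expr0 mul1r pregerm_edge_poly. Qed.

Lemma pregerm_desingularizes_at0 :
  desingularizes_at Z 0 <->
  exists p, edge_condition Z p /\ forall r, ~~ root (edge_quadratic Z p) r.
Proof.
exact: (desingularizes_at0_quadratic (fun E p s => pregerm_unique_edge E p s pZ) pE).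
Qed.

Lemma pregerm_desingularizes_atS (m : nat) :
  desingularizes_at Z m.+1 <-> exists p phi, [/\ edge_condition Z p, phi != 0,
    edge_quadratic Z p = (Z.2)`_0`_2 *: ('X - phi%:P) ^+ 2
  & desingularizes_at (blow_up Z p 1 p phi) m].
Proof.
have [_ _ a0] := pZ.
exact: (desingularizes_atS_quadratic (fun E p s => pregerm_unique_edge E p s pZ) pE a0 qE).
Qed.

End PregermStep.

(** * Solutions through a desingularizable germ *)

(** The derivative of [atan w - c ln T] would be nonnegative, although [atan] is
    bounded and [ln T] is not. *)
Lemma drift_unbounded (R : realType) (w dw : R -> R) (c T0 : R) :
  0 < c -> 0 < T0 -> (forall T, T0 <= T -> is_derive T 1 w (dw T)) ->
  ~ forall T, T0 <= T -> c / T * (1 + w T ^+ 2) <= dw T.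
Proof.
move=> c0 T00 wd H.
have pi0 := pi_ge0 R.
(* Between [T0] and [T1] the function [c ln] increases by [pi + 1]. *)
pose T1 := T0 * expR ((pi + 1) / c).
have e1 : 1 <= expR ((pi + 1) / c).
  by rewrite -expR0 ler_expR; apply: divr_ge0; [exact: addr_ge0|exact: ltW].
have T01 : T0 <= T1 by rewrite ler_peMr// ltW.
pose f T := atan (w T) - c * ln T.
have : f T0 <= f T1.
  apply: (@le_is_derive R f (fun T => (1 + w T ^+ 2)^-1 * dw T - c / T) _ _ T01) => T /andP[TT _];
    have T1p := lt_le_trans T00 TT.
  - have d1 := wd T TT; have d2 : is_derive T 1 (@ln R) T^-1 by exact: is_derive1_ln.
    exact: is_deriveB.
  have w1 : 0 < 1 + w T ^+ 2 by rewrite ltr_pwDl// sqr_ge0.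
  by rewrite subr_ge0 ler_pdivlMl// mulrC H.
rewrite /f /T1 lnM ?posrE ?expR_gt0// expRK.
have a1 := atan_ltpi2 (w T1); have a2 := atan_gtNpi2 (w T0).
rewrite -/T1 mulrDr (_ : c * ((pi + 1) / c) = pi + 1); last by field; rewrite gt_eqF.
move: a1 a2; set x := atan _; set y := atan _; set z := c * _; clearbody x y z; clear; lra.
Qed.

Section RiccatiBalance.
Variables (R : realType) (w dw k A B C : R -> R) (a b e sg kappa T0 : R).
Hypothesis T00 : 0 < T0.
Hypothesis e0 : e < 0.
Hypothesis kappa0 : 0 < kappa.
Hypothesis sg1 : sg = 1 \/ sg = -1.
Hypothesis Aa : A @ +oo --> a.
Hypothesis Bb : B @ +oo --> b.
Hypothesis Ce : C @ +oo --> e.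
Hypothesis wD : forall T, T0 <= T -> is_derive T 1 w (dw T).
Hypothesis dwE : forall T, T0 <= T -> dw T = - k T * (A T + B T * w T + C T * w T ^+ 2).
Hypothesis kP : forall T, T0 <= T -> kappa / T <= sg * k T.

Let drift (Out : R -> Prop) (d : R) : 0 < d ->
  (forall z, Out z -> a + b * z + e * z ^+ 2 <= - (2 * d) * (1 + z ^+ 2)) ->
  exists2 T1, T0 <= T1 & forall T, T1 <= T -> Out (w T) ->
    kappa * d / T * (1 + w T ^+ 2) <= sg * dw T.
Proof.
move=> d0 HO.
have [T1 H1] := (near_pinfty_from _).1 (quadratic_perturbation d0 Aa Bb Ce).
exists (Num.max T0 T1); first by rewrite le_max lexx.
move=> T; rewrite ge_max => /andP[TT0 TT1] /HO /(H1 T TT1) H.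
have Tp := lt_le_trans T00 TT0.
rewrite dwE// mulrA mulrN mulNr -mulrN.
have {}H : d * (1 + w T ^+ 2) <= - (A T + B T * w T + C T * w T ^+ 2) by rewrite lerNr -mulNr.
have -> : kappa * d / T * (1 + w T ^+ 2) = kappa / T * (d * (1 + w T ^+ 2)) by ring.
have d1 : 0 <= d * (1 + w T ^+ 2) by rewrite mulr_ge0 ?(ltW d0)// addr_ge0 ?sqr_ge0.
apply: ler_pM => //; first by rewrite divr_ge0// ltW.
exact: kP.
Qed.

Let not_away (Out : R -> Prop) (d : R) : 0 < d ->
  (forall z, Out z -> a + b * z + e * z ^+ 2 <= - (2 * d) * (1 + z ^+ 2)) ->
  ~ exists2 T1, T0 <= T1 & forall T, T1 <= T -> Out (w T).
Proof.
move=> d0 HO [T1 T01 away]; have [T2 T02 H] := drift d0 HO.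
pose T3 := Num.max T1 T2.
have [T13 T23] : T1 <= T3 /\ T2 <= T3 by rewrite !le_max !lexx orbT.
apply: (@drift_unbounded R (fun T => sg * w T) (fun T => sg * dw T) (kappa * d) T3).
- by rewrite mulr_gt0.
- exact: lt_le_trans T00 (le_trans T01 T13).
- move=> T TT; have ? := wD (le_trans (le_trans T01 T13) TT).
  exact: is_deriveZ.
- move=> T TT; have ss : sg ^+ 2 = 1 by case: sg1 => ->; rewrite ?sqrrN expr1n.
  rewrite exprMn ss mul1r; apply: H; first exact: le_trans TT.
  by apply: away; exact: le_trans TT.
Qed.

Lemma riccati_nonreal : ~ b ^+ 2 < 4 * a * e.
Proof.
move=> /(quadratic_gap_nonreal e0)[d d0 H].
apply: (@not_away (fun=> True) d d0 (fun z _ => H z)).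
by exists T0.
Qed.

Lemma riccati_double (phi : R) :
  (forall z, a + b * z + e * z ^+ 2 = e * (z - phi) ^+ 2) -> w @ +oo --> phi.
Proof.
move=> qE; apply/cvgrPdist_le => eta eta0.
have [d d0 H] := quadratic_gap_double phi e0 eta0.
have HO z : eta <= `|z - phi| -> a + b * z + e * z ^+ 2 <= - (2 * d) * (1 + z ^+ 2).
  by move=> /H; rewrite qE.
have [T1 T01 dr] := drift d0 HO.
have kn T : `|sg * w T - sg * phi| = `|w T - phi|.
  by rewrite -mulrBr normrM; case: sg1 => ->; rewrite ?normrN normr1 mul1r.
have T1p := lt_le_trans T00 T01.
have [||[T2 T12 H2]|[T2 T12 H2]] := @trapped_or_away R (fun T => sg * w T) (fun T => sg * dw T) (sg * phi) eta T1 eta0.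
- by move=> T TT; have ? := wD (le_trans T01 TT); exact: is_deriveZ.
- move=> T TT; rewrite kn => /(dr T TT); apply: lt_le_trans.
  have w1 : 0 < 1 + w T ^+ 2 by rewrite ltr_pwDl// sqr_ge0.
  by rewrite mulr_gt0// divr_gt0 ?mulr_gt0// (lt_le_trans T1p).
- by apply/near_pinfty_from; exists T2 => T /H2; rewrite kn distrC.
- case: (not_away d0 HO); exists T2; first exact: le_trans T12.
  by move=> T /H2; rewrite kn.
Qed.

End RiccatiBalance.

(** A solution through the germ, in the parameter [T] with [u = s / T]. *)
Definition asymptotic_solution (R : realType) (Z : vfield R) (s : R) : Prop :=
  exists V dV : R -> R, V @ +oo --> (0 : R) /\
    \forall T \near +oo, is_derive (T : R) 1 V (dV T) /\
      gap Z (s / T) (- (s / T ^+ 2)) (V T) (dV T) = 0.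

Lemma cvg_reciprocal (R : realType) (s : R) : (fun T : R => s / T) @ +oo --> (0 : R).
Proof. by have := @cvg_divX_pinfty R s 1 isT; under eq_fun do rewrite expr1. Qed.

(** The equation for [w = v / u^p], in which the quadratic polynomial of the
    edge appears up to terms that vanish with [u]. *)
Lemma rescaled_equation (R : realType) (U dU V dV w dw A h0 h1 g2 : R) (p M : nat) :
  U != 0 -> A != 0 -> (0 < p)%N ->
  V = U ^+ p * w -> dV = U ^+ p * dw + p%:R * U ^+ p.-1 * dU * w ->
  (U ^+ (2 * p) * h0 + U ^+ p * h1 * V + g2 * V ^+ 2) * dU
    - U ^+ (p + M.+1) * A * dV = 0 ->
  dw = dU / (U ^+ M.+1 * A) * (h0 + (h1 - p%:R * U ^+ M * A) * w + g2 * w ^+ 2).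
Proof.
move=> U0 A0; case: p => // q _ -> ->; rewrite /= => E.
have K0 : U ^+ (2 * q.+1) * (U ^+ M.+1 * A) != 0 by rewrite !mulf_neq0 ?expf_neq0.
apply: (mulfI K0); apply/eqP; rewrite -subr_eq0 -(oppr0 R) -E; apply/eqP.
rewrite mul2n -addnn !(exprD, exprS).
by field; rewrite A0 U0 expf_neq0.
Qed.

Lemma rescaled_curve (R : realType) (s T : R) (p : nat) (V : R -> R) (dV : R) :
  s = 1 \/ s = -1 -> 0 < T -> (0 < p)%N -> is_derive T 1 V dV ->
  exists dw, [/\ is_derive T 1 (fun T => V T * (s * T) ^+ p) dw,
    V T = (s / T) ^+ p * (V T * (s * T) ^+ p)
  & dV = (s / T) ^+ p * dw + p%:R * (s / T) ^+ p.-1 * - (s / T ^+ 2) * (V T * (s * T) ^+ p)].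
Proof.
move=> s1 T0 p0 Vd; have Tn : T != 0 by rewrite gt_eqF.
have ss : s * s = 1 by case: s1 => ->; rewrite ?mulrNN mulr1.
exists (dV * (s * T) ^+ p + V T * (p%:R * s * (s * T) ^+ p.-1)).
have e1 k : (s / T) ^+ k * (s * T) ^+ k = 1.
  by rewrite -exprMn mulrACA ss mul1r mulVf// expr1n.
split.
- have d2 : is_derive T 1 (fun T => (s * T) ^+ p) (p%:R * s * (s * T) ^+ p.-1).
    have -> : (fun T => (s * T) ^+ p) = (fun T => s ^+ p * T ^+ p).
      by apply/funext => x; rewrite exprMn.
    have := is_derive_monomial (s ^+ p) p T.
    by move/is_derive_eq; apply; case: (p) p0 => // q _; rewrite exprMn exprS; ring.
  by apply: is_derive_eq; rewrite /GRing.scale /=; ring.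
- by rewrite mulrCA e1 mulr1.
- case: (p) p0 => // q _.
  rewrite mulrDr (mulrCA _ dV) e1 mulr1.
  have -> : (s / T) ^+ q.+1 * (V T * (q.+1%:R * s * (s * T) ^+ q)) = V T * q.+1%:R / T.
    transitivity (V T * q.+1%:R / T * (s * s) * ((s / T) ^+ q * (s * T) ^+ q)).
      by rewrite exprS; ring.
    by rewrite e1 ss !mulr1.
  have -> : q.+1%:R * (s / T) ^+ q * - (s / T ^+ 2) * (V T * (s * T) ^+ q.+1) =
      - (V T * q.+1%:R / T * (s * s) * ((s / T) ^+ q * (s * T) ^+ q)).
    by rewrite (exprS (s * T)); field.
  by rewrite e1 ss !mulr1 addrK.
Qed.

Lemma asymptotic_solution_blow_up (R : realType) (Z Z' : vfield R) (p k : nat) (s phi : R)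
    (V dV : R -> R) :
  s = 1 \/ s = -1 -> (0 < p)%N ->
  (forall u du v dv,
    gap Z u du (u ^+ p * (phi + v)) (u ^+ p * dv + p%:R * u ^+ p.-1 * du * (phi + v)) =
      u ^+ k * gap Z' u du v dv) ->
  (\forall T \near +oo, is_derive (T : R) 1 V (dV T) /\
      gap Z (s / T) (- (s / T ^+ 2)) (V T) (dV T) = 0) ->
  (fun T => V T * (s * T) ^+ p) @ +oo --> phi -> asymptotic_solution Z' s.
Proof.
move=> s1 p0 gapE VD wphi.
have H : \forall T \near +oo, exists dw, is_derive (T : R) 1 (fun T => V T * (s * T) ^+ p - phi) dw /\
      gap Z' (s / T) (- (s / T ^+ 2)) (V T * (s * T) ^+ p - phi) dw = 0.
  apply: filterS2 (near_pinfty_gt0 R) VD => T T0 [Vd g0].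
  have [dw [wd VE dVE]] := rescaled_curve s1 T0 p0 Vd.
  exists dw; split; first by rewrite -[dw]subr0; apply: is_deriveB.
  have s0 : s != 0 by case: s1 => ->; rewrite ?oppr_eq0 oner_neq0.
  apply: (@mulfI _ ((s / T) ^+ k)); first by rewrite expf_neq0// mulf_neq0// invr_eq0 gt_eqF.
  by rewrite -gapE addrC subrK -VE -dVE g0 mulr0.
exists (fun T => V T * (s * T) ^+ p - phi), (fun T => 'D_1 (fun T => V T * (s * T) ^+ p - phi) T).
split; first by rewrite -(subrr phi); apply: cvgB; [|exact: cvg_cst].
apply: filterS H => T [dw [wd g0]].
have -> : 'D_1 (fun T => V T * (s * T) ^+ p - phi) T = dw by apply: derive_val.
by split.
Qed.

(** In terms of [w = v / u^p] the equation is of Riccati type with speed at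
    least of order [1 / T], so [w] drifts unless it is near a root of the edge
    polynomial.  The sign [eps] makes the leading coefficient negative. *)
Lemma asymptotic_solution_rescaled (R : realType) (N p : nat) (Z : vfield R) (s : R)
    (V dV : R -> R) :
  germ N Z -> edge_condition Z p -> s = 1 \/ s = -1 -> V @ +oo --> (0 : R) ->
  (\forall T \near +oo, is_derive (T : R) 1 V (dV T) /\
      gap Z (s / T) (- (s / T ^+ 2)) (V T) (dV T) = 0) ->
  ~ (forall r, ~~ root (edge_quadratic Z p) r) /\
  forall phi, edge_quadratic Z p = (Z.2)`_0`_2 *: ('X - phi%:P) ^+ 2 ->
    (fun T => V T * (s * T) ^+ p) @ +oo --> phi.
Proof.
move=> gZ eZ s1 V0 VD.
have [A [g2 [h0 [h1 [[ZE A00 pN] GE qE]]]]] := edge_decomposition gZ eZ.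
have [_ _ _ al0] := gZ; have [p0 _ _ _] := eZ.
have al : g2.[0, 0] = (Z.2)`_0`_2.
  have := congr1 (fun q : {poly R} => q`_2) qE; rewrite /edge_quadratic.
  by rewrite !coefD !coefZ !coefXn !coefX !coefC /= !mulr1 !mulr0 !addr0.
pose M := (N - p.+1)%N; have NE : N = (p + M.+1)%N by rewrite /M; lia.
have ss : s * s = 1 by case: s1 => ->; rewrite ?mulrNN mulr1.
have s0 : s != 0 by apply: contra_eq_neq ss => ->; rewrite mul0r eq_sym oner_neq0.
pose w T := V T * (s * T) ^+ p.
have u0 := cvg_reciprocal s.
pose AT T := A.[s / T, V T].
have AT0 : AT @ +oo --> A.[0, 0] by exact: cvg_horner2.
pose sA := Num.sg A.[0, 0].
pose kappa := `|A.[0, 0]|^-1 / 2.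
have kappa0 : 0 < kappa by rewrite divr_gt0// invr_gt0 normr_gt0.
have AN : \forall T \near +oo, kappa < sA / AT T.
  have : (fun T => sA / AT T) @ +oo --> sA / A.[0, 0].
    by apply: cvgM; [exact: cvg_cst | exact: cvgV].
  move=> /cvgr_gt; apply.
  have -> : sA / A.[0, 0] = `|A.[0, 0]|^-1.
    rewrite normrEsg invfM; congr (_ * _); rewrite /sA.
    by move: A00; rewrite neq_lt => /orP[/ltr0_sg|/gtr0_sg] ->; rewrite ?invrN invr1.
  have : 0 < `|A.[0, 0]|^-1 by rewrite invr_gt0 normr_gt0.
  by rewrite /kappa; move: `|_|^-1 => x; clear; lra.
have [T0 HT] : exists T0, forall T, T0 <= T -> [/\ 1 <= T, kappa < sA / AT T,
    is_derive T 1 V (dV T) & gap Z (s / T) (- (s / T ^+ 2)) (V T) (dV T) = 0].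
  apply/near_pinfty_from.
  have n1 : \forall T \near +oo, (1 : R) <= T by apply/near_pinfty_from; exists 1.
  by apply: filterS3 n1 AN VD => T k1 k2 [k3 k4].
have T0p : 0 < T0 by have [h _ _ _] := HT T0 (lexx _); rewrite (lt_le_trans _ h).
have H T : exists dw, T0 <= T -> [/\ is_derive T 1 w dw, V T = (s / T) ^+ p * w T
    & dV T = (s / T) ^+ p * dw + p%:R * (s / T) ^+ p.-1 * - (s / T ^+ 2) * w T].
  have [TT|TT] := leP T0 T; last by exists 0.
  have [T1 _ Vd _] := HT T TT.
  by have [dw Hdw] := rescaled_curve s1 (lt_le_trans ltr01 T1) p0 Vd; exists dw.
have [dw Hdw] := choice H.
have wD T : T0 <= T -> is_derive T 1 w (dw T) by move=> /Hdw[].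
have VE T : T0 <= T -> V T = (s / T) ^+ p * w T by move=> /Hdw[].
have dVE T : T0 <= T ->
    dV T = (s / T) ^+ p * dw T + p%:R * (s / T) ^+ p.-1 * - (s / T ^+ 2) * w T by move=> /Hdw[].
pose eps := - Num.sg g2.[0, 0].
have g20 : g2.[0, 0] != 0 by rewrite al.
have ee : eps * eps = 1 by rewrite /eps mulrNN -expr2 sqr_sg g20.
have e0 : eps * g2.[0, 0] < 0 by rewrite /eps mulNr -normrEsg oppr_lt0 normr_gt0.
have sA1 : sA = 1 \/ sA = -1.
  rewrite /sA; move: A00; rewrite neq_lt => /orP[/ltr0_sg|/gtr0_sg] ->; [by right|by left].
pose sg := eps * s ^+ M * sA.
have sg1 : sg = 1 \/ sg = -1.
  have : sg ^+ 2 == 1.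
    rewrite /sg exprMn exprMn exprAC !expr2 ee ss expr1n.
    by case: sA1 => ->; rewrite ?mulrNN !mulr1.
  by rewrite sqrf_eq1 => /orP[]/eqP ->; [left|right].
pose k T := eps * (s / T ^+ 2) / ((s / T) ^+ M.+1 * AT T).
pose beta := h1.[0] - p%:R * 0 ^+ M * A.[0, 0].
pose AA T := eps * h0.[s / T].
pose BB T := eps * (h1.[s / T] - p%:R * (s / T) ^+ M * AT T).
pose CC T := eps * g2.[s / T, V T].
have AA0 : AA @ +oo --> eps * h0.[0] by apply: cvgM; [exact: cvg_cst | exact: cvg_horner].
have BB0 : BB @ +oo --> eps * beta.
  apply: cvgM; first exact: cvg_cst.
  apply: cvgB; first exact: cvg_horner.
  apply: cvgM => //; apply: cvgM; first exact: cvg_cst.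
  have : (fun T => ('X^M : {poly R}).[s / T]) @ +oo --> ('X^M : {poly R}).[0] by exact: cvg_horner.
  by rewrite hornerXn; under eq_fun do rewrite hornerXn.
have CC0 : CC @ +oo --> eps * g2.[0, 0] by apply: cvgM; [exact: cvg_cst | exact: cvg_horner2].
have dwE T : T0 <= T -> dw T = - k T * (AA T + BB T * w T + CC T * w T ^+ 2).
  move=> TT; have [T1 kA _ g0] := HT T TT.
  have Tn : T != 0 by rewrite gt_eqF// (lt_le_trans _ T1).
  have ATn : AT T != 0.
    by apply: contraTneq kA => ->; rewrite invr0 mulr0 -leNgt ltW.
  have Un : s / T != 0 by rewrite mulf_neq0// invr_eq0.
  rewrite (rescaled_equation (M := M) (h0 := h0.[s / T]) (h1 := h1.[s / T])
     (g2 := g2.[s / T, V T]) Un ATn p0 (VE T TT) (dVE T TT)).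
    rewrite /k /AA /BB /CC -!mulrA -!mulrDr.
    rewrite -[LHS]mul1r -{1}ee; ring.
  by rewrite -g0 /gap ZE GE -NE !horner2E.
have kP T : T0 <= T -> kappa / T <= sg * k T.
  move=> /HT[T1 kA _ _]; have Tp : 0 < T by rewrite (lt_le_trans _ T1).
  have Tn : T != 0 by rewrite gt_eqF.
  have ATn : AT T != 0.
    by apply: contraTneq kA => ->; rewrite invr0 mulr0 -leNgt ltW.
  have -> : sg * k T = sA / AT T * (T ^+ M / T).
    have sM : s ^+ M * s ^+ M = 1 by rewrite -exprMn ss expr1n.
    transitivity ((eps * eps) * (s ^+ M / s ^+ M) * (s / s) * (sA / AT T * (T ^+ M / T))); last first.
      by rewrite ee !mulfV ?expf_neq0// !mul1r.
    rewrite /sg /k expr_div_n !exprS; field.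
    by rewrite s0 Tn ATn !expf_neq0.
  have h1T : 1 <= T ^+ M by exact: exprn_ege1.
  have iT : 0 < T^-1 by rewrite invr_gt0.
  rewrite ler_pM ?(ltW kappa0) ?(ltW kA) ?(ltW iT)//.
  by rewrite ler_peMl// ltW.
have qz z : (edge_quadratic Z p).[z] = h0.[0] + beta * z + g2.[0, 0] * z ^+ 2.
  by rewrite qE !hornerD !hornerZ hornerC hornerXn hornerX -/M -/beta; ring.
split.
- move=> nr; apply: (riccati_nonreal T0p e0 kappa0 sg1 AA0 BB0 CC0 wD dwE kP).
  rewrite exprMn; have -> : 4 * (eps * h0.[0]) * (eps * g2.[0, 0]) =
    eps ^+ 2 * (4 * h0.[0] * g2.[0, 0]) by ring.
  rewrite expr2 ee !mul1r; have -> : 4 * h0.[0] * g2.[0, 0] = 4 * g2.[0, 0] * h0.[0] by ring.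
  by apply/(quadratic_nonroot _ _ g20); rewrite qE in nr.
- move=> phi dE.
  apply: (riccati_double T0p e0 kappa0 sg1 AA0 BB0 CC0 wD dwE kP) => z.
  have := qz z; rewrite dE hornerZ horner_exp hornerD hornerN hornerX hornerC -al => E.
  by rewrite -!mulrA -!mulrDr -E.
Qed.

(** A solution has to follow the double roots through all blow-ups, but at the
    last edge there is no root that it could tend to. *)
Lemma desingularized_no_solution (R : realType) (m N : nat) (Z : vfield R) (s : R) :
  (0 < N)%N -> germ N Z -> desingularizes_at Z m -> s = 1 \/ s = -1 -> ~ asymptotic_solution Z s.
Proof.
move=> + + + s1; elim: m N Z => [|m IH] N Z N0 gZ; have pZ := germ_pregerm N0 gZ.
  move=> /(pregerm_desingularizes_at0 pZ)[p [eZ nr]] [V [dV [V0 VD]]].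
  by have [+ _] := asymptotic_solution_rescaled gZ eZ s1 V0 VD; apply.
move=> /(pregerm_desingularizes_atS pZ)[p [phi [eZ phi0 dE D]]] [V [dV [V0 VD]]].
have [_ /(_ _ dE) wphi] := asymptotic_solution_rescaled gZ eZ s1 V0 VD.
have [gZ' _ gapE] := germ_blow_up gZ eZ dE; have [p0 _ _ _] := eZ.
apply: (IH (N - p)%N _ _ gZ' D); first by rewrite subn_gt0; exact: germ_edge_lt gZ eZ.
exact: asymptotic_solution_blow_up s1 p0 gapE VD wphi.
Qed.

(** * Barriers at germs that cannot be desingularized *)

(** A curve [(u, v)] with [u = s / T^r] along which the gap has a fixed sign.
    The factor in front of the gap is chosen so that, for the germs that come from a
    system with [n] odd, the curve is a barrier for the solutions. *)
Definition has_barrier (R : realType) (Z : vfield R) : Prop :=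
  exists (s : R) (r : nat) (V dV : R -> R),
  [/\ s = 1 \/ s = -1, (0 < r)%N, V @ +oo --> (0 : R)
    & \forall T \near +oo, is_derive (T : R) 1 V (dV T) /\
      0 <= s * (Z.2)`_0`_2 * gap Z (s / T ^+ r) (- (r%:R * s / T ^+ r.+1)) (V T) (dV T)].

Lemma has_barrier_of_limit (R : realType) (Z : vfield R) (s : R) (r : nat)
    (V dV K L : R -> R) (l : R) :
  s = 1 \/ s = -1 -> (0 < r)%N -> V @ +oo --> (0 : R) ->
  (forall T : R, 0 < T -> is_derive T 1 V (dV T)) -> (forall T, 0 < T -> 0 <= K T) ->
  (forall T, 0 < T -> s * (Z.2)`_0`_2 *
     gap Z (s / T ^+ r) (- (r%:R * s / T ^+ r.+1)) (V T) (dV T) = K T * L T) ->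
  L @ +oo --> l -> 0 < l -> has_barrier Z.
Proof.
move=> s1 r0 V0 Vd K0 E Ll l0; exists s, r, V, dV; split=> //.
have L0 : \forall T \near +oo, 0 < L T by exact: (cvgr_gt l Ll).
apply: filterS2 (near_pinfty_gt0 R) L0 => T T0 LT; split; first exact: Vd.
by rewrite E// mulr_ge0// ?K0// ltW.
Qed.

Lemma is_derive_blow_down (R : realType) (s phi T dV : R) (r p : nat) (V : R -> R) :
  T != 0 -> is_derive T 1 V dV ->
  is_derive T 1 (fun T => (s / T ^+ r) ^+ p * (phi + V T))
    ((s / T ^+ r) ^+ p * dV
      + p%:R * (s / T ^+ r) ^+ p.-1 * (- (r%:R * s / T ^+ r.+1)) * (phi + V T)).
Proof.
move=> Tn Vd.
have d1 := is_derive_monomial_quotient s 0 r Tn.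
have d1' : is_derive T 1 (fun T => s / T ^+ r) (- (r%:R * s / T ^+ r.+1)).
  have -> : (fun T => s / T ^+ r) = (fun T => s * T ^+ 0 / T ^+ r).
    by apply/funext => x; rewrite expr0 mulr1.
  by apply: is_derive_eq; rewrite expr0 exprS; field; rewrite Tn expf_neq0.
have d2 : is_derive T 1 (fun T => (s / T ^+ r) ^+ p)
    (p%:R * (s / T ^+ r) ^+ p.-1 * - (r%:R * s / T ^+ r.+1)).
  have -> : (fun T => (s / T ^+ r) ^+ p) = (fun y => 1 * y ^+ p) \o (fun T => s / T ^+ r).
    by apply/funext => x /=; rewrite mul1r.
  have d3 := is_derive_monomial 1 p (s / T ^+ r); rewrite mul1r in d3.
  exact: (@is_derive1_comp R (fun y => 1 * y ^+ p) (fun T => s / T ^+ r) T _ _ d3 d1').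
by apply: is_derive_eq; rewrite /GRing.scale /= add0r; ring.
Qed.

(** By [germ_blow_up] the gaps of a curve and of its image differ by the
    factor [u^(2 p)], which is a square. *)
Lemma barrier_blow_up (R : realType) (Z Z' : vfield R) (p : nat) (phi : R) :
  (0 < p)%N -> (Z'.2)`_0`_2 = (Z.2)`_0`_2 ->
  (forall u du v dv,
    gap Z u du (u ^+ p * (phi + v)) (u ^+ p * dv + p%:R * u ^+ p.-1 * du * (phi + v)) =
      u ^+ (p + p) * gap Z' u du v dv) ->
  has_barrier Z' -> has_barrier Z.
Proof.
move=> p0 al gE [s [r [V [dV [s1 r0 V0 HV]]]]].
have u0 : (fun T : R => s / T ^+ r) @ +oo --> (0 : R) by exact: cvg_divX_pinfty.
have up0 : (fun T : R => (s / T ^+ r) ^+ p) @ +oo --> (0 : R).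
  have : (fun T => ('X^p : {poly R}).[s / T ^+ r]) @ +oo --> ('X^p : {poly R}).[0].
    exact: cvg_horner.
  by rewrite hornerXn expr0n gtn_eqF//; under eq_fun do rewrite hornerXn.
exists s, r, (fun T => (s / T ^+ r) ^+ p * (phi + V T)), (fun T => (s / T ^+ r) ^+ p * dV T
  + p%:R * (s / T ^+ r) ^+ p.-1 * (- (r%:R * s / T ^+ r.+1)) * (phi + V T)); split=> //.
  rewrite -(mul0r (phi + 0)); apply: cvgM => //.
  by apply: cvgD => //; exact: cvg_cst.
apply: filterS2 (near_pinfty_gt0 R) HV => T T0 [Vd HT]; split.
  by apply: is_derive_blow_down; rewrite ?gt_eqF.
rewrite gE mulrCA mulr_ge0//; last by rewrite -al.
by rewrite exprD -expr2 sqr_ge0.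
Qed.

Section Barriers.
Variables (R : realType) (N : nat) (Z : vfield R).
Variables (A g2 : {poly {poly R}}) (g0 g1 : {poly R}).
Hypothesis ZE : Z.1 = 'X^N * A.
Hypothesis A00 : A.[0, 0] != 0.
Hypothesis GE : Z.2 = g0^:P + g1^:P * 'Y + g2 * 'Y ^+ 2.
Hypothesis alE : g2.[0, 0] = (Z.2)`_0`_2.
Hypothesis al0 : g2.[0, 0] != 0.

(** If the terms of degree 0 in [v] have high order in [u], a curve on which
    those of degree 1 dominate is a barrier: its sign can be adapted to theirs. *)
Lemma barrier_linear (M K : nat) (h0 h1 : {poly R}) :
  N = (M + K.+1)%N -> g0 = 'X^((2 * M).+1) * h0 -> g1 = 'X^M * h1 ->
  (h1.[0] != 0 \/ K = 0%N) -> has_barrier Z.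
Proof.
move=> NE g0E g1E HK.
(* For [u = 1 / T^6] and [v = c / T^(6 M + e)] the leading coefficient of the gap
   is [c lam e].  The two terms of [lam] may cancel for one value of [e], but
   then not for another one. *)
pose lam (e : nat) := - 6 * h1.[0] + (6 * M + e)%:R * (A.[0, 0] * 0 ^+ K).
have [e [e' [e0 e'0 ee lam0]]] : exists e e', [/\ (0 < e)%N, (0 < e')%N,
    (e + e' = 6)%N & lam e != 0].
  have [l3|l3] := eqVneq (lam 3%N) 0; last by exists 3%N, 3%N.
  exists 4%N, 2%N; split=> //.
  have -> : lam 4%N = lam 3%N + A.[0, 0] * 0 ^+ K.
    by rewrite /lam (addnS _ 3) -natr1; ring.
  rewrite l3 add0r; case: HK => [h10|->]; last by rewrite expr0 mulr1.
  case: K NE @lam l3 => [|K'] NE lam l3; first by rewrite expr0 mulr1.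
  move: l3; rewrite /lam expr0n /= !mulr0 addr0 => /eqP.
  by rewrite mulf_eq0 (negPf h10) orbF oppr_eq0 pnatr_eq0.
pose al := g2.[0, 0]; pose c := al * lam e.
pose k := (6 * M + e)%N.
pose V T := c * T ^+ 0 / T ^+ k.
pose dV T := c * (0%:R - k%:R) * T ^+ 0 / T ^+ k / T.
have V0 : V @ +oo --> (0 : R).
  have : (fun T => c / T ^+ k) @ +oo --> (0 : R) by apply: cvg_divX_pinfty; rewrite addn_gt0 e0 orbT.
  by apply: cvg_trans; apply: near_eq_cvg; near=> T; rewrite /V expr0 mulr1.
have u0 : (fun T : R => 1 / T ^+ 6) @ +oo --> (0 : R) by exact: cvg_divX_pinfty.
pose L T := al * (- 6 * h0.[1 / T ^+ 6] * (1 / T ^+ e') + - 6 * c * h1.[1 / T ^+ 6]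
  + - 6 * c ^+ 2 * g2.[1 / T ^+ 6, V T] * (1 / T ^+ e)
  + c * k%:R * (A.[1 / T ^+ 6, V T] * (1 / T ^+ 6) ^+ K)).
apply: (@has_barrier_of_limit R Z 1 6 V dV (fun T => 1 / ((T ^+ 6) ^+ M * (T ^+ 6) ^+ M * T ^+ e * T ^+ 7)) L
  (al * (- 6 * h0.[0] * 0 + - 6 * c * h1.[0] + - 6 * c ^+ 2 * g2.[0, 0] * 0
   + c * k%:R * (A.[0, 0] * 0 ^+ K)))).
- by left.
- by [].
- exact: V0.
- by move=> T T0; apply: is_derive_monomial_quotient; rewrite gt_eqF.
- by move=> T T0; rewrite divr_ge0// !mulr_ge0// ?exprn_ge0 ?ltW// exprn_ge0 ?ltW.
- move=> T T0; have Tn : T != 0 by rewrite gt_eqF.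
  rewrite -alE -/al mul1r /L (mulrCA _ al); congr (_ * _).
  rewrite /gap ZE GE g0E g1E NE !horner2E !hornerM !hornerXn.
  have uE : (1 / T ^+ 6) ^+ M = 1 / (T ^+ 6) ^+ M by rewrite expr_div_n expr1n.
  have uE' : (1 / T ^+ 6) ^+ K = 1 / (T ^+ 6) ^+ K by rewrite expr_div_n expr1n.
  rewrite mul2n -addnn !(exprS _ (M + M)) exprD (exprD _ M K.+1) (exprS _ K) uE uE'.
  have -> : dV T = - (c * k%:R) / ((T ^+ 6) ^+ M * T ^+ e) / T.
    by rewrite /dV sub0r expr0 mulr1 mulrN /k exprD exprM.
  have VE : V T = c / ((T ^+ 6) ^+ M * T ^+ e).
    by rewrite /V expr0 mulr1 /k exprD exprM.
  set hh0 := h0.[_]; set hh1 := h1.[_]; set gg := g2.[_, _]; set AA := A.[_, _]; rewrite {}VE.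
  have an : (T ^+ 6) ^+ M != 0 by rewrite !expf_neq0.
  have bn : (T ^+ 6) ^+ K != 0 by rewrite !expf_neq0.
  have en : T ^+ e != 0 by rewrite expf_neq0.
  have en' : T ^+ e' != 0 by rewrite expf_neq0.
  move: an bn; rewrite (exprS T 6) -ee exprD => an bn.
  clearbody hh0 hh1 gg AA; move: ((_ * _) ^+ M) ((_ * _) ^+ K) an bn => a b an bn.
  by field; rewrite Tn an bn en en'.
- apply: cvgM; first exact: cvg_cst.
  apply: cvgD; last first.
    apply: cvgM; first exact: cvg_cst.
    apply: cvgM; first exact: cvg_horner2.
    have : (fun T => ('X^K : {poly R}).[1 / T ^+ 6]) @ +oo --> ('X^K : {poly R}).[0].
      exact: cvg_horner.
    by rewrite hornerXn; under eq_fun do rewrite hornerXn.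
  apply: cvgD; last first.
    apply: cvgM; last exact: cvg_divX_pinfty.
    by apply: cvgM; [exact: cvg_cst | exact: cvg_horner2].
  apply: cvgD; last by apply: cvgM; [exact: cvg_cst | exact: cvg_horner].
  apply: cvgM; last exact: cvg_divX_pinfty.
  by apply: cvgM; [exact: cvg_cst | exact: cvg_horner].
- rewrite (_ : al * _ = (al * lam e) ^+ 2); last by rewrite /c /lam /k; move: (0 ^+ K) => z; ring.
  by rewrite exprn_even_gt0//= mulf_neq0.
Unshelve. all: by end_near. Qed.

(** The terms of degree 0 in [v] have odd order in [u], so the curve [v = 0] is
    a barrier on one of its two sides. *)
Lemma barrier_odd (k : nat) (h0 : {poly R}) :
  odd k -> g0 = 'X^k * h0 -> h0.[0] != 0 -> has_barrier Z.
Proof.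
move=> ok g0E h00; pose s := - Num.sg (g2.[0, 0] * h0.[0]).
have p0 : g2.[0, 0] * h0.[0] != 0 by rewrite mulf_neq0.
have ss : s * s = 1 by rewrite /s mulrNN -expr2 sqr_sg p0.
have s1 : s = 1 \/ s = -1.
  have : s ^+ 2 == 1 by rewrite expr2 ss.
  by rewrite sqrf_eq1 => /orP[]/eqP ->; [left|right].
have sk : s ^+ k = s.
  have : s * s ^+ k = 1.
    by rewrite -exprS; case: s1 => ->; rewrite ?expr1n// -signr_odd /= ok.
  by move=> /(congr1 ( *%R s)); rewrite mulrA ss mul1r mulr1.
have s0 : s != 0 by apply: contra_eq_neq ss => ->; rewrite mul0r eq_sym oner_neq0.
apply: (@has_barrier_of_limit R Z s 1 (fun=> 0) (fun=> 0) (fun T => 1 / (T ^+ k * T ^+ 2))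
  (fun T => - s * g2.[0, 0] * h0.[s / T ^+ 1]) (- s * g2.[0, 0] * h0.[0])).
- exact: s1.
- by [].
- exact: cvg_cst.
- by move=> T T0; rewrite divr_ge0// mulr_ge0// exprn_ge0// ltW.
- move=> T T0; have Tn : T != 0 by rewrite gt_eqF.
  rewrite -alE /gap GE !horner2E g0E hornerM hornerXn !mulr0 subr0 !addr0.
  rewrite expr_div_n expr1 sk.
  transitivity ((s * s) * s * (- g2.[0, 0] * h0.[s / T]) / (T ^+ k * T ^+ 2)).
    by field; rewrite Tn expf_neq0.
  by rewrite ss; field; rewrite Tn expf_neq0.
- apply: cvgM; first exact: cvg_cst.
  apply: cvg_horner; exact: cvg_divX_pinfty.
- by rewrite -mulrA mulNr /s mulNr opprK -normrEsg normr_gt0.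
Qed.

(** Between two real roots the quadratic polynomial has the sign opposite to
    its leading coefficient, and the curve through the midpoint is a barrier. *)
Lemma barrier_real_roots (p M : nat) (h0 h1 : {poly R}) (beta : R) :
  (0 < p)%N -> N = (p + M.+1)%N -> g0 = 'X^(2 * p) * h0 -> g1 = 'X^p * h1 ->
  beta = h1.[0] - p%:R * 0 ^+ M * A.[0, 0] ->
  4 * g2.[0, 0] * h0.[0] < beta ^+ 2 -> has_barrier Z.
Proof.
move=> p0 NE g0E g1E bE disc.
pose al := g2.[0, 0]; pose c := - beta / (2 * al).
pose V T := c * T ^+ 0 / T ^+ p.
pose dV T := c * (0%:R - p%:R) * T ^+ 0 / T ^+ p / T.
have V0 : V @ +oo --> (0 : R).
  have : (fun T => c / T ^+ p) @ +oo --> (0 : R) by exact: cvg_divX_pinfty.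
  by apply: cvg_trans; apply: near_eq_cvg; near=> T; rewrite /V expr0 mulr1.
have u0 : (fun T : R => 1 / T ^+ 1) @ +oo --> (0 : R) by exact: cvg_divX_pinfty.
pose L T := - al * (h0.[1 / T ^+ 1] + c * (h1.[1 / T ^+ 1]
   - p%:R * (1 / T ^+ 1) ^+ M * A.[1 / T ^+ 1, V T]) + c ^+ 2 * g2.[1 / T ^+ 1, V T]).
apply: (@has_barrier_of_limit R Z 1 1 V dV (fun T => 1 / (T ^+ p * T ^+ p * T ^+ 2)) L
  (- al * (h0.[0] + c * (h1.[0] - p%:R * 0 ^+ M * A.[0, 0]) + c ^+ 2 * g2.[0, 0]))).
- by left.
- by [].
- exact: V0.
- by move=> T T0; apply: is_derive_monomial_quotient; rewrite gt_eqF.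
- by move=> T T0; rewrite divr_ge0// !mulr_ge0// ?exprn_ge0 ?ltW// exprn_ge0 ?ltW.
- move=> T T0; have Tn : T != 0 by rewrite gt_eqF.
  rewrite -alE -/al mul1r /L mulNr -mulrN mulrCA; congr (_ * _).
  rewrite /gap ZE GE g0E g1E NE !horner2E !hornerM !hornerXn.
  have uE k : (1 / T ^+ 1) ^+ k = 1 / T ^+ k by rewrite expr1 expr_div_n expr1n.
  rewrite mul2n -addnn exprD (exprD _ p M.+1) (exprS _ M) !uE.
  have -> : dV T = - (c * p%:R) / T ^+ p / T by rewrite /dV sub0r expr0 mulr1 mulrN.
  have VE : V T = c / T ^+ p by rewrite /V expr0 mulr1.
  set hh0 := h0.[_]; set hh1 := h1.[_]; set gg := g2.[_, _]; set AA := A.[_, _]; rewrite {}VE.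
  clearbody hh0 hh1 gg AA.
  by rewrite expr1; field; rewrite Tn !expf_neq0.
- apply: cvgM; first exact: cvg_cst.
  apply: cvgD; last by apply: cvgM; [exact: cvg_cst | exact: cvg_horner2].
  apply: cvgD; first exact: cvg_horner.
  apply: cvgM; first exact: cvg_cst.
  apply: cvgB; first exact: cvg_horner.
  apply: cvgM; last exact: cvg_horner2.
  apply: cvgM; first exact: cvg_cst.
  have : (fun T => ('X^M : {poly R}).[1 / T ^+ 1]) @ +oo --> ('X^M : {poly R}).[0].
    exact: cvg_horner.
  by rewrite hornerXn; under eq_fun do rewrite hornerXn.
- rewrite -bE -/al (_ : - al * _ = (beta ^+ 2 - 4 * al * h0.[0]) / 4); last by rewrite /c; field.
  by rewrite divr_gt0// subr_gt0.
Unshelve. all: by end_near. Qed.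

End Barriers.

(** If no barrier is available, the terms of degree 0 in [v] start with an even
    power [u^(2 p)] and those of degree 1 with a power of at least [u^p], which
    gives an edge; if its polynomial has a double root, the blow-up is a germ of smaller
    order.  Each blow-up lowers [N] by at least 1, and an edge needs [N >= 2],
    whence the bound on the number of blow-ups. *)
Lemma barrier_or_desingularized (R : realType) (N : nat) (Z : vfield R) :
  (0 < N)%N -> germ N Z ->
  has_barrier Z \/ exists m, (m.+2 <= N)%N /\ desingularizes_at Z m.
Proof.
elim/ltn_ind: N Z => N IH Z N0 gZ; have pZ := germ_pregerm N0 gZ.
have [[A ZE A00] G00 G01 G02] := gZ.
have [g0 [g1 [g2 [GE g0E g1E g2E]]]] := split_second_variable Z.2.
have al0 : g2.[0, 0] != 0 by rewrite g2E.
(* [M] is the order of the linear terms in [v] of the equation, where the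
   component [F] contributes a term of order [N - 1]. *)
have exM : exists i, (g1`_i != 0) || (i == N.-1) by exists N.-1; rewrite eqxx orbT.
case: (ex_minnP exM) => M HM Mmin.
have MN : (M <= N.-1)%N by apply: Mmin; rewrite eqxx orbT.
have g1M i : (i < M)%N -> g1`_i = 0.
  move=> iM; apply/eqP; apply: contraT => gi; have := Mmin i; rewrite gi => /(_ isT).
  by rewrite leqNgt iM.
have [h1 h1E h10] := poly_divXn g1M.
have [/existsP[i Hi]|/existsPn H0] := boolP [exists i : 'I_(2 * M).+1, g0`_i != 0]; last first.
  left; have [h0 h0E _] : exists2 h : {poly R}, g0 = 'X^((2 * M).+1) * h & h`_0 = g0`_(2 * M).+1.
    by apply: poly_divXn => i iM; have := H0 (Ordinal iM); rewrite negbK => /eqP.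
  apply: (barrier_linear ZE A00 GE g2E al0 (M := M) (K := (N - M.+1)%N) _ h0E h1E).
    by lia.
  move: HM => /orP[HM|/eqP HM]; [left|right; lia].
  by rewrite horner_coef0 h10.
have exk : exists k, g0`_k != 0 by exists (val i).
case: (ex_minnP exk) => k Hk kmin.
have kM : (k <= 2 * M)%N by rewrite -ltnS (leq_ltn_trans (kmin _ Hi)).
have g0k j : (j < k)%N -> g0`_j = 0.
  move=> jk; apply/eqP; apply: contraT => /kmin; by rewrite leqNgt jk.
have [h0 h0E h00] := poly_divXn g0k.
have h0n : h0.[0] != 0 by rewrite horner_coef0 h00.
have [ok|ek] := boolP (odd k).
  by left; exact: (barrier_odd GE g2E al0 ok h0E h0n).
pose p := k./2; have kE : k = (2 * p)%N by rewrite /p mul2n halfK (negPf ek) subn0.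
have p0 : (0 < p)%N.
  by case: (p) kE Hk => // -> ; rewrite g0E G00 eqxx.
have pM : (p <= M)%N by move: kM; rewrite kE leq_pmul2l.
have pN : (p < N)%N by rewrite -(prednK N0) ltnS (leq_trans pM).
have eZ : edge_condition Z p.
  split=> //.
  - by move=> j jp; rewrite -g0E g0k// kE.
  - by move=> j jp; rewrite -g1E g1M// (leq_trans jp).
  - by move=> j jp; rewrite ZE coef_germ1 (leq_ltn_trans jp pN).
have [h1' h1E' h10'] : exists2 h : {poly R}, g1 = 'X^p * h & h`_0 = g1`_p.
  by apply: poly_divXn => j jp; rewrite g1M// (leq_trans jp).
pose L := (N - p.+1)%N; have NE : N = (p + L.+1)%N by rewrite addnS -addSn subnKC.
pose beta := h1'.[0] - p%:R * 0 ^+ L * A.[0, 0].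
have qE : edge_quadratic Z p = g2.[0, 0] *: 'X^2 + beta *: 'X + h0.[0]%:P.
  rewrite /edge_quadratic g2E (horner_coef0 h0) h00 g0E kE; congr (_ + _ *: _ + _).
  rewrite /beta (horner_coef0 h1') h10' g1E; congr (_ - _); rewrite -mulrA; congr (_ * _).
  rewrite ZE coef_germ1 {1 2}NE; case: (L) => [|L'].
    by rewrite addn1 ltnn subnn -horner2_00 expr0 mul1r.
  by rewrite expr0n /= mul0r !addnS !ltnS leq_addr.
have [dlt|dgt|dE] := ltgtP (beta ^+ 2) (4 * g2.[0, 0] * h0.[0]).
- right; exists 0%N; split; first exact: leq_ltn_trans p0 pN.
  apply/(pregerm_desingularizes_at0 pZ); exists p; split=> //.
  by rewrite qE; apply/quadratic_nonroot.
- left; apply: (@barrier_real_roots _ _ _ _ _ _ _ ZE GE g2E al0 p L h0 h1' beta) => //.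
  by rewrite -kE.
- have [phi phi0 dE'] := quadratic_double_root al0 h0n dE.
  have dbl : edge_quadratic Z p = (Z.2)`_0`_2 *: ('X - phi%:P) ^+ 2 by rewrite qE dE' g2E.
  have [gZ' al' gapE] := germ_blow_up gZ eZ dbl.
  have Np0 : (0 < N - p)%N by rewrite subn_gt0.
  have Np : (N - p < N)%N by rewrite ltn_subrL p0 N0.
  have [HB|[m [mN D]]] := IH _ Np _ Np0 gZ'.
    by left; exact: (barrier_blow_up p0 al' gapE).
  right; exists m.+1; split; first exact: leq_ltn_trans mN Np.
  by apply/(pregerm_desingularizes_atS pZ); exists p, phi; split.
Qed.

(** * The fields at infinity *)

Lemma coef_reversal (R : realType) (n i : nat) (P : {poly R}) :
  (reversal n P)`_i = if (i <= n)%N then P`_(n - i) else 0.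
Proof. by rewrite coef_poly ltnS. Qed.

Lemma size_of_reversal (R : realType) (n k : nat) (P : {poly R}) :
  (size P <= n.+1)%N -> (k <= n.+1)%N ->
  (forall i, (i < k)%N -> (reversal n P)`_i = 0) <-> (size P <= n.+1 - k)%N.
Proof.
move=> sP kn; split=> [H|sk i ik].
  apply/leq_sizeP => j kj; have [jn|jn] := ltnP j n.+1; last first.
    by move/leq_sizeP: sP; apply.
  have := H (n - j)%N; rewrite coef_reversal leq_subr subKn// => -> //; lia.
rewrite coef_reversal; case: ifP => // im.
by apply: (leq_sizeP _ _ sk); lia.
Qed.

Lemma le_of_double (n p : nat) : (2 * p <= n)%N -> (p <= n)%N.
Proof. by apply: leq_trans; rewrite leq_pmull. Qed.

Lemma size_exact (R : realType) (P : {poly R}) (d : nat) :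
  (size P <= d.+1)%N -> P`_d != 0 -> size P = d.+1.
Proof.
move=> sP Pd; apply/eqP; rewrite eqn_leq sP /= ltnNge.
by apply: contra Pd => /leq_sizeP/(_ d (leqnn d)) ->.
Qed.

(** The defect of the equation [y y' = Q0 + Q1 y + Q2 y^2] for the ramified
    coefficients; it is nonnegative on barriers and zero on solutions. *)
Definition slope_gap (R : realType) (P0 P1 P2 : {poly R}) (s : R) (r : nat) (T y dy : R) : R :=
  (ramify s r P0).[T] + (ramify s r P1).[T] * y + (ramify s r P2).[T] * y ^+ 2 - y * dy.

Lemma fieldY1E (R : realType) (n : nat) (P0 P1 P2 : {poly R}) :
  (fieldY n P0 P1 P2).1 = - 'X^(n.+2) * ('Y + (- P1`_n / (2 * P2`_n))%:P%:P).
Proof. by []. Qed.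

Lemma fieldY2E (R : realType) (n : nat) (P0 P1 P2 : {poly R}) (u v : R) :
  let y := v + - P1`_n / (2 * P2`_n) in
  (fieldY n P0 P1 P2).2.[u, v] =
    (reversal n P0).[u] + (reversal n P1).[u] * y + (reversal n P2).[u] * y ^+ 2.
Proof. by move=> y; rewrite /fieldY [_.2]/= !horner2E. Qed.

Section Charts.
Variables (R : realType) (n : nat) (P0 P1 P2 : {poly R}).
Hypothesis sz0 : (size P0 <= n.+1)%N.
Hypothesis sz1 : (size P1 <= n.+1)%N.
Hypothesis sz2 : (size P2 <= n.+1)%N.

Let ramified (s : R) (r : nat) (T : R) (P : {poly R}) :
  s = 1 \/ s = -1 -> (0 < r)%N -> 0 < T -> (size P <= n.+1)%N ->
  (ramify s r P).[T] * (s / T ^+ r) ^+ n.+2 = r%:R * s / T ^+ r.+1 * (reversal n P).[s / T ^+ r].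
Proof.
move=> s1 r0 T0 sP; have Tn : T != 0 by rewrite gt_eqF.
have ss : s * s = 1 by case: s1 => ->; rewrite ?mulrNN mulr1.
have s0 : s != 0 by apply: contra_eq_neq ss => ->; rewrite mul0r eq_sym oner_neq0.
have xE : (s * T ^+ r)^-1 = s / T ^+ r.
  by rewrite invfM; congr (_ * _); rewrite -[LHS]mul1r -ss mulfK.
rewrite horner_ramify (horner_reversal sP) ?mulf_neq0 ?expf_neq0// xE.
have -> : (s / T ^+ r) ^+ n.+2 = (s / T ^+ r) ^+ n * (s * s) / T ^+ r / T ^+ r.
  by rewrite !exprSr; field; rewrite expf_neq0.
have xu : (s * T ^+ r) ^+ n * (s / T ^+ r) ^+ n = 1.
  by rewrite -exprMn mulrACA ss mul1r mulfV ?expf_neq0// expr1n.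
rewrite ss; set f := (reversal n P).[_].
transitivity (((s * T ^+ r) ^+ n * (s / T ^+ r) ^+ n) * (s * r%:R * T ^+ r.-1 * f / T ^+ r / T ^+ r)).
  by ring.
rewrite xu mul1r; case: r r0 {xE xu} @f => // q _ f /=.
by rewrite !exprS; field; rewrite Tn expf_neq0.
Qed.

Lemma gap_fieldX (s : R) (r : nat) (T v dv : R) :
  s = 1 \/ s = -1 -> (0 < r)%N -> 0 < T -> v != 0 ->
  gap (fieldX n P0 P1 P2) (s / T ^+ r) (- (r%:R * s / T ^+ r.+1)) v dv =
  - (s / T ^+ r) ^+ n.+2 * v ^+ 3 * slope_gap P0 P1 P2 s r T v^-1 (- (dv / v ^+ 2)).
Proof.
move=> s1 r0 T0 v0; rewrite /gap /fieldX /= !horner2E /slope_gap.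
have [e0 e1 e2] := And3 (ramified s1 r0 T0 sz0) (ramified s1 r0 T0 sz1) (ramified s1 r0 T0 sz2).
set D := r%:R * s / T ^+ r.+1 in e0 e1 e2 *.
transitivity (- (v ^+ 3 * (D * (reversal n P0).[s / T ^+ r]) + v ^+ 2 * (D * (reversal n P1).[s / T ^+ r])
  + v * (D * (reversal n P2).[s / T ^+ r])) - (s / T ^+ r) ^+ n.+2 * dv); first by ring.
rewrite -e0 -e1 -e2; move: ((_ / _) ^+ _) => U.
by field.
Qed.

Lemma gap_fieldY (s : R) (r : nat) (T v dv : R) :
  s = 1 \/ s = -1 -> (0 < r)%N -> 0 < T ->
  gap (fieldY n P0 P1 P2) (s / T ^+ r) (- (r%:R * s / T ^+ r.+1)) v dv =
  - (s / T ^+ r) ^+ n.+2 * slope_gap P0 P1 P2 s r T (v + - P1`_n / (2 * P2`_n)) dv.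
Proof.
move=> s1 r0 T0; rewrite /gap fieldY1E fieldY2E horner2M horner2N horner2_exp !horner2E /slope_gap.
have [e0 e1 e2] := And3 (ramified s1 r0 T0 sz0) (ramified s1 r0 T0 sz1) (ramified s1 r0 T0 sz2).
set D := r%:R * s / T ^+ r.+1 in e0 e1 e2 *; set y := v + _.
transitivity (- ((D * (reversal n P0).[s / T ^+ r]) + (D * (reversal n P1).[s / T ^+ r]) * y
  + (D * (reversal n P2).[s / T ^+ r]) * y ^+ 2) + (s / T ^+ r) ^+ n.+2 * y * dv).
  by ring.
rewrite -e0 -e1 -e2; ring.
Qed.

End Charts.

(** What it means for the degrees that the support does not reach below the
    edge: that of [P1] is bounded by the mean of [n] and of that of [P]. *)
Definition degree_condition (R : realType) (n : nat) (P1 P : {poly R}) (p : nat) : Prop :=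
  [/\ (0 < p)%N, (2 * p <= n)%N, (size P <= n.+1 - 2 * p)%N & (size P1 <= n.+1 - p)%N].

(** The leading balance of the system along the curves [y = w x^k]; here it is
    the polynomial of the first edge, up to a power of the variable. *)
Definition leading_quadratic (R : realType) (n : nat) (P0 P1 P2 : {poly R}) (p : nat) : {poly R} :=
  P0`_n *: 'X^2 + P1`_(n - p) *: 'X + (P2`_(n - 2 * p))%:P.

Section FieldX.
Variables (R : realType) (n : nat) (P0 P1 P2 : {poly R}).
Hypothesis sz1 : (size P1 <= n.+1)%N.
Hypothesis sz2 : (size P2 <= n.+1)%N.
Hypothesis a0 : P0`_n != 0.
Hypothesis P20 : P2 != 0.

Let X := fieldX n P0 P1 P2.

Let coefX1 i j : (X.1)`_i`_j = ((i == n.+2) && (j == 0%N))%:R.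
Proof.
rewrite /X /= coefXn; case: eqP => _ /=; last by rewrite coef0.
by rewrite coefC; case: eqP.
Qed.

Let coefX2 i j : (X.2)`_i`_j = (reversal n P0)`_i *+ (j == 3%N)
  + (reversal n P1)`_i *+ (j == 2%N) + (reversal n P2)`_i *+ (j == 1%N).
Proof.
rewrite /X [_.2]/= !coefD -!polyC_exp !coefMC !coef_map /= !coefCM !coefXn coefX.
by rewrite !mulr_natr.
Qed.

Let S0 i j : field_support X (i, j) -> 0 <= i /\ 0 <= j.
Proof.
move=> /field_supportE[]; case: i => [i|[|i]]; case: j => [j|[|j]] //=; rewrite ?eqxx//.
- by rewrite subnn coefX1 eqxx.
- by rewrite subnn coefX2 !addr0 eqxx.
Qed.

Let SA : field_support X (0, 0 + 2).
Proof.
apply/field_supportE; right; rewrite add0r [coef2 _ _ _]/= coefX2 !addr0.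
by rewrite coef_reversal subn0.
Qed.

Let q0 p : (leading_quadratic n P0 P1 P2 p)`_0 = P2`_(n - 2 * p).
Proof. by rewrite /leading_quadratic !coefD !coefZ coefXn coefX coefC /= !mulr0 !add0r. Qed.

(** Here [j0 = 0], because the second component is divisible by [v].  The
    monomial [u^(n + 2)] of the first component lies strictly above the edge,
    since [P2] is not zero. *)
Lemma fieldX_unique_edge E p sigma :
  unique_edge X E p sigma <->
  [/\ degree_condition n P1 P2 p, (leading_quadratic n P0 P1 P2 p)`_0 != 0,
      E = edge_segment 0 p & sigma = (2 * p)%N].
Proof.
have z2 : (0 + 2 = 2 :> int) by [].
have np : (p%:Z * 2 = (2 * p)%N :> int) by rewrite mulrC.
rewrite q0; split=> [/(unique_edge_elim S0 SA)|].
  rewrite z2 np => -[p0 -> SB H ->].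
  have S2 i : (reversal n P2)`_i != 0 -> (2 * p <= i)%N.
    move=> r0; have /H : field_support X (i%:Z, 0).
      by apply/field_supportE; right; rewrite add0r [coef2 _ _ _]/= coefX2 /= !add0r.
    by rewrite mulr0 addr0.
  have S1 i : (reversal n P1)`_i != 0 -> (p <= i)%N.
    move=> r0; have /H : field_support X (i%:Z, 1).
      by apply/field_supportE; right; rewrite [coef2 _ _ _]/= coefX2 /= add0r addr0.
    lia.
  have Sn : (2 * p <= n.+1)%N.
    have /H : field_support X (n.+1%:Z, 0).
      by apply/field_supportE; left; rewrite -PoszD addn1 [coef2 _ _ _]/= coefX1 !eqxx oner_eq0.
    by rewrite mulr0 addr0.
  have s2 : (size P2 <= n.+1 - 2 * p)%N.
    apply/(size_of_reversal sz2 Sn) => i ip; apply/eqP; apply: contraT => /S2.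
    by rewrite leqNgt ip.
  have pn : (2 * p <= n)%N.
    rewrite -ltnS ltn_neqAle Sn andbT; apply: contraNneq P20 => pE.
    by move: s2; rewrite pE subnn leqn0 size_poly_eq0.
  split=> //; first split=> //.
    apply/(size_of_reversal sz1 (leqW (le_of_double pn))) => i ip.
    by apply/eqP; apply: contraT => /S1; rewrite leqNgt ip.
  move: SB => /field_supportE[].
    rewrite -PoszD addn1 [coef2 _ _ _]/= coefX1 => h; exfalso; move: h.
    have -> : (((2 * p).+1 == n.+2) = false)%N by apply: ltn_eqF; rewrite !ltnS.
    by rewrite /= eqxx.
  by rewrite add0r [coef2 _ _ _]/= coefX2 /= !add0r coef_reversal pn.
have np' : ((2 * p)%N = p%:Z * (0 + 2) :> int) by rewrite -np.
move=> [[p0 pn s2 s1] c0 -> ->]; rewrite np'.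
have r2 := (size_of_reversal sz2 (leqW pn)).2 s2.
have r1 : forall i, (i < p)%N -> (reversal n P1)`_i = 0.
  exact: (size_of_reversal sz1 (leqW (le_of_double pn))).2 s1.
apply: (unique_edge_intro S0 SA p0).
  apply/field_supportE; right; rewrite add0r [coef2 _ _ _]/= coefX2 /= !add0r.
  by rewrite coef_reversal pn.
move=> i j Sij; have [i0 j0] := S0 Sij; rewrite z2.
move/field_supportE: Sij; case: i i0 => // i _; case: j j0 => // j _.
rewrite -!PoszD !addn1 [coef2 X.1 _ _]/= [coef2 X.2 _ _]/= coefX1 coefX2.
rewrite np lez_nat.
case: j => [|[|j]]; last by move=> _; nia.
- rewrite /= !add0r => -[|/eqP r].
    by have [[->] _|_] := eqVneq i.+1 n.+2; [lia|rewrite /= eqxx].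
  by rewrite leqNgt; apply/negP => ip; apply: r; apply: r2; lia.
- rewrite andbF /= add0r addr0 => -[|/eqP r]; first by rewrite eqxx.
  by rewrite leqNgt; apply/negP => ip; apply: r; apply: r1; lia.
Qed.

Lemma fieldX_edge_poly p : degree_condition n P1 P2 p ->
  edge_poly X (edge_segment 0 p) p 1 = 'X^1 * leading_quadratic n P0 P1 P2 p.
Proof.
move=> [p0 pn s2 s1]; rewrite edge_polyE// !add0r.
have -> : (1 + 1 = 2 :> int) by []. have -> : (2 + 1 = 3 :> int) by [].
have c2 (F : {poly {poly R}}) (i j : nat) : coef2 F i j = F`_i`_j by [].
rewrite -!PoszD !addn1 !c2 !coefX1 !coefX2 !coef_reversal.
rewrite /= !andbF !mulr0 !subr0 !add0r !addr0 pn subn0.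
rewrite (le_of_double pn).
have -> : (((2 * p).+1 == n.+2) = false)%N by apply: ltn_eqF; rewrite !ltnS.
rewrite mulr0 subr0 /leading_quadratic !mulrDr -!scalerAr -!exprS expr1.
by rewrite ['X * _%:P]mulrC mul_polyC addrC [X in _ + X]addrC addrA -expr2.
Qed.

Let qE p : exists b c, leading_quadratic n P0 P1 P2 p = P0`_n *: 'X^2 + b *: 'X + c%:P.
Proof. by eexists; eexists. Qed.

Lemma fieldX_desingularizes_at0 :
  desingularizes_at X 0 <-> exists p, degree_condition n P1 P2 p /\
    forall r, ~~ root (leading_quadratic n P0 P1 P2 p) r.
Proof.
apply: (desingularizes_at0_quadratic fieldX_unique_edge (e := 1%N)) => p Cp _.
exact: fieldX_edge_poly.
Qed.

Lemma fieldX_desingularizes_atS (m : nat) :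
  desingularizes_at X m.+1 <-> exists p phi, [/\ degree_condition n P1 P2 p, phi != 0,
    leading_quadratic n P0 P1 P2 p = P0`_n *: ('X - phi%:P) ^+ 2
  & desingularizes_at (blow_up X p 1 (2 * p)%N phi) m].
Proof.
apply: (desingularizes_atS_quadratic fieldX_unique_edge (e := 1%N) _ a0 qE) => p Cp _.
exact: fieldX_edge_poly.
Qed.

(** The second component of the field is divisible by [v], which becomes
    [phi + v] up to a power of [u] and accounts for the factor [phi]. *)
Lemma fieldX_blow_up p phi : degree_condition n P1 P2 p -> phi != 0 ->
  leading_quadratic n P0 P1 P2 p = P0`_n *: ('X - phi%:P) ^+ 2 ->
  let Z' := blow_up X p 1 (2 * p)%N phi in
  [/\ germ (n.+2 - 2 * p) Z', (Z'.2)`_0`_2 = phi * P0`_n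
    & forall u du v dv,
      gap X u du (u ^+ p * (phi + v)) (u ^+ p * dv + p%:R * u ^+ p.-1 * du * (phi + v)) =
      u ^+ (2 * p + p) * gap Z' u du v dv].
Proof.
move=> [p0 pn s2 s1] phi0 dE Z'.
have [|h2 h2E h20] := @poly_divXn R (reversal n P2) (2 * p).
  exact: (size_of_reversal sz2 (leqW pn)).2 s2.
have [|h1 h1E h10] := @poly_divXn R (reversal n P1) p.
  exact: (size_of_reversal sz1 (leqW (le_of_double pn))).2 s1.
pose W : {poly {poly R}} := phi%:P%:P + 'Y.
pose F' : {poly {poly R}} := 'X^(n.+1 - 2 * p).
pose G' := (reversal n P0)^:P * W ^+ 3 + h1^:P * W ^+ 2 + h2^:P * W.
have FE u v : X.1.[u, u ^+ p * (phi + v)] = u ^+ (2 * p).+1 * F'.[u, v].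
  by rewrite /X /F' [_.1]/= !horner2_exp !horner2_X -exprD addSn subnKC// leqW.
have GE u v : X.2.[u, u ^+ p * (phi + v)] = u ^+ (2 * p + p) * G'.[u, v].
  rewrite /X /G' /W [_.2]/= h1E h2E !rmorphM /= !map_polyXn.
  by rewrite !horner2D !horner2M !horner2_exp !horner2E mul2n -addnn !exprD; ring.
have gapE := blow_up_gap FE GE.
have Z'E : Z' = ('X * F', G' - p%:R * W * F') by exact: blow_upE.
rewrite -/Z' in gapE; clearbody Z'.
have E0 : (0 : R) ^+ p = 0 by rewrite expr0n gtn_eqF.
have E1 : (0 : R) ^+ (n.+1 - 2 * p) = 0 by rewrite expr0n subn_eq0 leqNgt ltnS pn.
have Z'0 v : Z'.2.[0, v] = P0`_n * ((phi + v) * v ^+ 2).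
  have E : (leading_quadratic n P0 P1 P2 p).[phi + v] = P0`_n * v ^+ 2.
    by rewrite dE hornerZ horner_exp hornerD hornerN hornerX hornerC addrC addKr.
  rewrite Z'E [_.2]/= /G' /W /F' !(horner2D, horner2N, horner2M, horner2_exp) !horner2E E1 mulr0 subr0.
  rewrite (mulrCA P0`_n) -E /leading_quadratic !hornerD !hornerZ hornerC hornerXn hornerX.
  rewrite !horner_coef0 h10 h20 !coef_reversal leq0n subn0 pn.
  rewrite (le_of_double pn).
  by ring.
have Z'2 : (Z'.2)`_0 = (P0`_n * phi) *: 'X^2 + P0`_n *: 'X^3.
  by apply: poly_ext => v; rewrite -horner2_0y Z'0 hornerD !hornerZ !hornerXn; ring.
split; last exact: gapE.
- split; rewrite ?Z'2 ?coefD ?coefZ ?coefXn /= ?mulr0 ?mulr1 ?addr0 ?mulf_neq0//.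
  exists 1; last by rewrite !hornerC oner_eq0.
  by rewrite Z'E /= /F' mulr1 -exprS -subSn// leqW.
- by rewrite Z'2 coefD !coefZ !coefXn /= mulr1 mulr0 addr0 mulrC.
Qed.

End FieldX.

Section FieldY.
Variables (R : realType) (n : nat) (P0 P1 P2 : {poly R}).
Hypothesis sz0 : (size P0 <= n.+1)%N.
Hypothesis sz1 : (size P1 <= n.+1)%N.
Hypothesis c0 : P2`_n != 0.
Hypothesis P00 : P0 != 0.

Let Y := fieldY n P0 P1 P2.

(** At [u = 0] the second component is the leading quadratic of the system,
    translated to its double root. *)
Lemma fieldY_germ : P1`_n != 0 -> P1`_n ^+ 2 - 4 * P0`_n * P2`_n = 0 ->
  germ n.+2 Y /\ (Y.2)`_0`_2 = P2`_n.
Proof.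
move=> b0 disc.
have Y20 : (Y.2)`_0 = P2`_n *: 'X^2.
  apply: poly_ext => v; rewrite -horner2_0y /Y fieldY2E !reversal0 hornerZ hornerXn.
  transitivity (P2`_n * v ^+ 2 - (P1`_n ^+ 2 - 4 * P0`_n * P2`_n) / (4 * P2`_n)); first by field.
  by rewrite disc mul0r subr0.
have al : (Y.2)`_0`_2 = P2`_n by rewrite Y20 coefZ coefXn mulr1.
split=> //; split; rewrite ?al// ?Y20 ?coefZ ?coefXn ?mulr0//.
exists (- ('Y + (- P1`_n / (2 * P2`_n))%:P%:P)).
  by rewrite /Y fieldY1E mulNr mulrN.
rewrite !horner2E add0r oppr_eq0 mulf_neq0 ?oppr_eq0 ?invr_eq0 ?mulf_neq0//.
Qed.

Section CenteredBase.
Hypothesis b0 : P1`_n = 0.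

Let Y1E : Y.1 = 'X^(n.+2) * - 'Y.
Proof. by rewrite /Y fieldY1E b0 oppr0 mul0r !polyC0 addr0 mulNr mulrN. Qed.

Let coefY1 i : (Y.1)`_i`_0 = 0.
Proof. by rewrite Y1E coef_germ1; case: ifP => // _; rewrite coefN coefC; case: eqP => _; rewrite ?oppr0 ?coef0// coefN coefX oppr0. Qed.

Let coefY2 i j : (Y.2)`_i`_j = (reversal n P0)`_i *+ (j == 0%N)
  + (reversal n P1)`_i *+ (j == 1%N) + (reversal n P2)`_i *+ (j == 2%N).
Proof.
rewrite /Y /fieldY [_.2]/= b0 oppr0 mul0r !polyC0 addr0.
rewrite !coefD -!polyC_exp !coefMC !coef_map /= !coefCM !coefXn coefX coefC.
by rewrite !mulr_natr; case: (j == 0%N).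
Qed.

Lemma fieldY_pregerm : pregerm Y /\ (Y.2)`_0`_2 = P2`_n.
Proof.
have al : (Y.2)`_0`_2 = P2`_n by rewrite coefY2 !coef_reversal subn0 /= !add0r.
split=> //; split; rewrite ?al//.
  by rewrite Y1E coefXnM.
by move=> _; rewrite Y1E coefXnM.
Qed.

Lemma fieldY_edge_condition p : edge_condition Y p <-> degree_condition n P1 P0 p.
Proof.
have r0E i : (Y.2)`_i`_0 = (reversal n P0)`_i by rewrite coefY2 !addr0.
have r1E i : (Y.2)`_i`_1 = (reversal n P1)`_i by rewrite coefY2 add0r addr0.
split=> [[p0 H0 H1 _]|[p0 pn s0 s1]].
  have pn : (2 * p <= n)%N.
    rewrite leqNgt; apply/negP => np.
    have : (size P0 <= n.+1 - n.+1)%N.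
      by apply/(size_of_reversal sz0) => // i ip; rewrite -r0E H0// (leq_trans ip).
    by rewrite subnn leqn0 size_poly_eq0 (negPf P00).
  split=> //.
    by apply/(size_of_reversal sz0 (leqW pn)) => i ip; rewrite -r0E H0.
  by apply/(size_of_reversal sz1 (leqW (le_of_double pn))) => i ip; rewrite -r1E H1.
split=> // i ip; first by rewrite r0E; exact: (size_of_reversal sz0 (leqW pn)).2 s0 i ip.
by rewrite r1E; exact: (size_of_reversal sz1 (leqW (le_of_double pn))).2 s1 i ip.
Qed.

Lemma fieldY_edge_quadratic p : degree_condition n P1 P0 p ->
  edge_quadratic Y p = leading_quadratic n P2 P1 P0 p.
Proof.
move=> [p0 pn _ _]; rewrite /edge_quadratic /leading_quadratic coefY1 !coefY2 !coef_reversal.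
rewrite (le_of_double pn).
by rewrite pn subn0 !add0r !addr0 mulr0 subr0.
Qed.

(** If [P1`_n = 0] the first component is divisible by [v], so the field itself
    is not a germ in the above sense; after one blow-up at [phi != 0] it is one,
    and [N] has not decreased. *)
Lemma fieldY_blow_up p phi : degree_condition n P1 P0 p -> phi != 0 ->
  leading_quadratic n P2 P1 P0 p = P2`_n *: ('X - phi%:P) ^+ 2 ->
  let Z' := blow_up Y p 1 p phi in
  [/\ germ n.+2 Z', (Z'.2)`_0`_2 = P2`_n
    & forall u du v dv,
      gap Y u du (u ^+ p * (phi + v)) (u ^+ p * dv + p%:R * u ^+ p.-1 * du * (phi + v)) =
      u ^+ (p + p) * gap Z' u du v dv].
Proof.
move=> [p0 pn s0 s1] phi0 dE Z'.
have [|h0 h0E h00] := @poly_divXn R (reversal n P0) (2 * p).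
  exact: (size_of_reversal sz0 (leqW pn)).2 s0.
have [|h1 h1E h10] := @poly_divXn R (reversal n P1) p.
  exact: (size_of_reversal sz1 (leqW (le_of_double pn))).2 s1.
pose W : {poly {poly R}} := phi%:P%:P + 'Y.
pose F' : {poly {poly R}} := 'X^(n.+1) * - W.
pose G' := h0^:P + h1^:P * W + (reversal n P2)^:P * W ^+ 2.
have FE u v : Y.1.[u, u ^+ p * (phi + v)] = u ^+ p.+1 * F'.[u, v].
  by rewrite Y1E /F' /W !(horner2_exp, horner2M, horner2N) !horner2E !exprS; ring.
have GE u v : Y.2.[u, u ^+ p * (phi + v)] = u ^+ (p + p) * G'.[u, v].
  rewrite /Y fieldY2E /G' /W b0 oppr0 mul0r addr0 h0E h1E !hornerM !hornerXn.
  by rewrite !(horner2_exp, horner2D, horner2M) !horner2E mul2n -addnn !exprD; ring.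
have gapE := blow_up_gap FE GE.
have Z'E : Z' = ('X * F', G' - p%:R * W * F') by exact: blow_upE.
rewrite -/Z' in gapE; clearbody Z'.
have Z'0 v : Z'.2.[0, v] = P2`_n * v ^+ 2.
  have <- : (leading_quadratic n P2 P1 P0 p).[phi + v] = P2`_n * v ^+ 2.
    by rewrite dE hornerZ horner_exp hornerD hornerN hornerX hornerC addrC addKr.
  rewrite Z'E [_.2]/= /G' /W /F' !(horner2_exp, horner2D, horner2N, horner2M) !horner2E (exprS 0 n).
  rewrite /leading_quadratic !hornerD !hornerZ hornerC hornerXn hornerX.
  rewrite !horner_coef0 h00 h10 !coef_reversal leq0n subn0 pn.
  rewrite (le_of_double pn).
  by ring.
have Z'2 : (Z'.2)`_0 = P2`_n *: 'X^2.
  by apply: poly_ext => v; rewrite -horner2_0y Z'0 hornerZ !hornerXn.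
split; last exact: gapE.
- split; rewrite ?Z'2 ?coefZ ?coefXn /= ?mulr0 ?mulr1//.
  exists (- W); first by rewrite Z'E /= /F' mulrA -exprS.
  by rewrite /W !horner2E addr0 oppr_eq0.
- by rewrite Z'2 coefZ coefXn mulr1.
Qed.

End CenteredBase.
End FieldY.

(** * Between the plane and the blown-up germs *)

Lemma sign_of_odd_power (R : realType) (s T : R) (r k : nat) :
  s = 1 \/ s = -1 -> 0 < T -> odd k -> 0 < s * (s / T ^+ r) ^+ k.
Proof.
move=> s1 T0 ok; have -> : s * (s / T ^+ r) ^+ k = s ^+ k.+1 / (T ^+ r) ^+ k.
  by rewrite expr_div_n exprS mulrA.
have -> : s ^+ k.+1 = 1.
  by case: s1 => ->; rewrite ?expr1n// -signr_odd /= ok.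
by rewrite divr_gt0// !exprn_gt0.
Qed.

Lemma ramify_eventually_neg (R : realType) (P : {poly R}) (d r : nat) (s : R) :
  size P = d.+1 -> odd d -> lead_coef P < 0 -> s = 1 \/ s = -1 -> (0 < r)%N ->
  \forall T \near +oo, (ramify s r P).[T] <= 0.
Proof.
move=> sP od lP s1 r0.
have ss : s * s = 1 by case: s1 => ->; rewrite ?mulrNN mulr1.
have s0 : s != 0 by apply: contra_eq_neq ss => ->; rewrite mul0r eq_sym oner_neq0.
have : (fun T => (reversal d P).[s / T ^+ r]) @ +oo --> (reversal d P).[0].
  by apply: cvg_horner; exact: cvg_divX_pinfty.
rewrite reversal0 (_ : P`_d = lead_coef P); last by rewrite lead_coefE sP.
move=> /cvgr_lt/(_ _ lP) H; apply: filterS2 (near_pinfty_gt0 R) H => T T0 HT.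
have Tn : T != 0 by rewrite gt_eqF.
have xE : (s * T ^+ r)^-1 = s / T ^+ r.
  by rewrite invfM; congr (_ * _); rewrite -[LHS]mul1r -ss mulfK.
rewrite horner_ramify (horner_reversal (n := d)) ?sP ?mulf_neq0 ?expf_neq0// xE.
have -> : s * r%:R * T ^+ r.-1 * ((s * T ^+ r) ^+ d * (reversal d P).[s / T ^+ r]) =
    s ^+ d.+1 * (r%:R * T ^+ r.-1 * (T ^+ r) ^+ d) * (reversal d P).[s / T ^+ r].
  by rewrite exprMn exprS; ring.
have -> : s ^+ d.+1 = 1.
  by case: s1 => ->; rewrite ?expr1n// -signr_odd /= od.
by rewrite mul1r mulr_ge0_le0 ?(ltW HT)// !mulr_ge0// ?exprn_ge0 ?ltW// exprn_gt0.
Qed.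

Lemma escaping_of_slope_gap (R : realType) (P0 P1 P2 : {poly R}) (s : R) (r : nat) (c : R)
    (Y dY : R -> R) :
  (\forall T \near +oo, (ramify s r P0).[T] <= 0) ->
  (\forall T \near +oo, [/\ is_derive (T : R) 1 Y (dY T), 0 < c * Y T &
     0 <= slope_gap P0 P1 P2 s r T (Y T) (dY T)]) ->
  escaping P0 P1 P2 s r.
Proof.
move=> neg H; have [T0 HT] : exists T0, forall T, T0 <= T ->
    (ramify s r P0).[T] <= 0 /\ [/\ is_derive (T : R) 1 Y (dY T), 0 < c * Y T &
     0 <= slope_gap P0 P1 P2 s r T (Y T) (dY T)].
  by apply/near_pinfty_from; apply: filterS2 neg H.
apply: (@escaping_above R P0 P1 P2 s r c T0 Y dY) => T /HT[n0 [Yd cY]].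
by rewrite /slope_gap subr_ge0.
Qed.

Section FromBarriers.
Variables (R : realType) (n : nat) (P0 P1 P2 : {poly R}).
Hypothesis sz0 : (size P0 <= n.+1)%N.
Hypothesis sz1 : (size P1 <= n.+1)%N.
Hypothesis sz2 : (size P2 <= n.+1)%N.
Hypothesis on : odd n.
Hypothesis neg : forall s r, s = 1 \/ s = -1 -> (0 < r)%N ->
  \forall T \near +oo, (ramify s r P0).[T] <= 0.

Let near_sign (phi : R) (V : R -> R) : phi != 0 -> V @ +oo --> (0 : R) ->
  \forall T \near +oo, 0 < phi * (phi + V T).
Proof.
move=> phi0 V0.
have : (fun T => phi * (phi + V T)) @ +oo --> phi * (phi + 0).
  by apply: cvgM; [exact: cvg_cst|apply: cvgD => //; exact: cvg_cst].
by move=> /cvgr_gt; apply; rewrite addr0 -expr2 exprn_even_gt0.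
Qed.

(** Because [n] is odd, the sign of [s u^(n + 2)] does not depend on [s]; this
    is where the sign in [has_barrier] comes from. *)
Lemma escaping_of_barrier_Y : P2`_n < 0 -> P1`_n != 0 ->
  ((fieldY n P0 P1 P2).2)`_0`_2 = P2`_n -> has_barrier (fieldY n P0 P1 P2) ->
  exists s r, [/\ s = 1 \/ s = -1, (0 < r)%N & escaping P0 P1 P2 s r].
Proof.
move=> c0 b0 al [s [r [V [dV [s1 r0 V0 VD]]]]]; exists s, r; split=> //.
pose y0 := - P1`_n / (2 * P2`_n).
have y00 : y0 != 0 by rewrite mulf_neq0 ?oppr_eq0// invr_eq0 mulf_neq0// lt_eqF.
apply: (@escaping_of_slope_gap _ _ _ _ _ _ y0 (fun T => V T + y0) dV); first exact: neg.
apply: filterS3 (near_pinfty_gt0 R) (near_sign y00 V0) VD => T T0 yT [Vd HT]; split.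
- by rewrite -[dV T]addr0; apply: is_deriveD.
- by rewrite (addrC (V T)).
- move: HT; rewrite gap_fieldY// al -/y0.
  have -> : s * P2`_n * (- (s / T ^+ r) ^+ n.+2 * slope_gap P0 P1 P2 s r T (V T + y0) (dV T)) =
     (- P2`_n) * (s * (s / T ^+ r) ^+ n.+2) * slope_gap P0 P1 P2 s r T (V T + y0) (dV T) by ring.
  by rewrite pmulr_rge0// mulr_gt0 ?oppr_gt0// sign_of_odd_power//= negbK.
Qed.

Lemma escaping_of_barrier_Y_blow_up (Z' : vfield R) (p : nat) (phi : R) :
  P2`_n < 0 -> P1`_n = 0 -> phi != 0 -> (Z'.2)`_0`_2 = P2`_n ->
  (forall u du v dv,
    gap (fieldY n P0 P1 P2) u du (u ^+ p * (phi + v))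
      (u ^+ p * dv + p%:R * u ^+ p.-1 * du * (phi + v)) = u ^+ (p + p) * gap Z' u du v dv) ->
  has_barrier Z' ->
  exists s r, [/\ s = 1 \/ s = -1, (0 < r)%N & escaping P0 P1 P2 s r].
Proof.
move=> c0 b0 phi0 al gapE [s [r [V [dV [s1 r0 V0 VD]]]]]; exists s, r; split=> //.
apply: (@escaping_of_slope_gap _ _ _ _ _ _ (phi * s ^+ p)
  (fun T => (s / T ^+ r) ^+ p * (phi + V T))
  (fun T => (s / T ^+ r) ^+ p * dV T
      + p%:R * (s / T ^+ r) ^+ p.-1 * (- (r%:R * s / T ^+ r.+1)) * (phi + V T))); first exact: neg.
apply: filterS3 (near_pinfty_gt0 R) (near_sign phi0 V0) VD => T T0 yT [Vd HT]; split.
- by apply: is_derive_blow_down; rewrite ?gt_eqF.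
- have -> : phi * s ^+ p * ((s / T ^+ r) ^+ p * (phi + V T)) =
    (s * s) ^+ p / (T ^+ r) ^+ p * (phi * (phi + V T)).
    by rewrite expr_div_n exprMn; ring.
  have -> : s * s = 1 by case: s1 => ->; rewrite ?mulrNN mulr1.
  by rewrite expr1n mulr_gt0// divr_gt0// !exprn_gt0.
- set Y := _ * (phi + V T); set dY := _ + _ * _.
  have := gapE (s / T ^+ r) (- (r%:R * s / T ^+ r.+1)) (V T) (dV T).
  rewrite gap_fieldY// b0 oppr0 mul0r addr0 -/Y -/dY => E.
  have K0 : 0 < - P2`_n * (s * (s / T ^+ r) ^+ n.+2).
    by rewrite mulr_gt0 ?oppr_gt0// sign_of_odd_power//= negbK.
  rewrite -(pmulr_rge0 _ K0).
  have -> : - P2`_n * (s * (s / T ^+ r) ^+ n.+2) * slope_gap P0 P1 P2 s r T Y dY =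
    (s / T ^+ r) ^+ (p + p) * (s * P2`_n *
      gap Z' (s / T ^+ r) (- (r%:R * s / T ^+ r.+1)) (V T) (dV T)).
    transitivity (s * P2`_n * (- (s / T ^+ r) ^+ n.+2 * slope_gap P0 P1 P2 s r T Y dY)); first by ring.
    by rewrite E; ring.
  by rewrite mulr_ge0//; [rewrite exprD -expr2 sqr_ge0|rewrite -al].
Qed.

(** The curve is translated by [y = 1 / v]; the gap acquires the factor [v^3],
    whose sign is that of [phi] and is matched by the coefficient of [v^2]. *)
Lemma escaping_of_barrier_X_blow_up (Z' : vfield R) (p : nat) (phi : R) :
  P0`_n < 0 -> phi != 0 -> (Z'.2)`_0`_2 = phi * P0`_n ->
  (forall u du v dv,
    gap (fieldX n P0 P1 P2) u du (u ^+ p * (phi + v))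
      (u ^+ p * dv + p%:R * u ^+ p.-1 * du * (phi + v)) = u ^+ (2 * p + p) * gap Z' u du v dv) ->
  has_barrier Z' ->
  exists s r, [/\ s = 1 \/ s = -1, (0 < r)%N & escaping P0 P1 P2 s r].
Proof.
move=> a0 phi0 al gapE [s [r [V [dV [s1 r0 V0 VD]]]]]; exists s, r; split=> //.
have s0 : s != 0 by case: s1 => ->; rewrite ?oppr_eq0 oner_neq0.
pose v T := (s / T ^+ r) ^+ p * (phi + V T).
pose dv T := (s / T ^+ r) ^+ p * dV T
      + p%:R * (s / T ^+ r) ^+ p.-1 * (- (r%:R * s / T ^+ r.+1)) * (phi + V T).
apply: (@escaping_of_slope_gap _ _ _ _ _ _ (phi * s ^+ p)
  (fun T => (v T)^-1) (fun T => - (dv T / v T ^+ 2))); first exact: neg.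
apply: filterS3 (near_pinfty_gt0 R) (near_sign phi0 V0) VD => T T0 yT [Vd HT].
have Tn : T != 0 by rewrite gt_eqF.
have w0 : phi + V T != 0 by apply: contraTneq yT => ->; rewrite mulr0 ltxx.
have u0 : s / T ^+ r != 0 by rewrite mulf_neq0// invr_eq0 expf_neq0.
have v0 : v T != 0 by rewrite mulf_neq0// expf_neq0.
split.
- have vd : is_derive T 1 v (dv T) by exact: is_derive_blow_down.
  have := is_deriveV v0 vd.
  by move/is_derive_eq; apply; rewrite /GRing.scale /= mulNr mulrC.
- have -> : phi * s ^+ p * (v T)^-1 = (phi * s ^+ p * v T) / v T ^+ 2 by field.
  rewrite divr_gt0//; last by rewrite exprn_even_gt0.
  have -> : phi * s ^+ p * v T = (s * s) ^+ p / (T ^+ r) ^+ p * (phi * (phi + V T)).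
    by rewrite /v expr_div_n exprMn; ring.
  have -> : s * s = 1 by case: s1 => ->; rewrite ?mulrNN mulr1.
  by rewrite expr1n mulr_gt0// divr_gt0// !exprn_gt0.
- have := gapE (s / T ^+ r) (- (r%:R * s / T ^+ r.+1)) (V T) (dV T).
  rewrite -/(v T) -/(dv T) gap_fieldX//; set SG := slope_gap _ _ _ _ _ _ _ _ => E.
  have K0 : 0 < - P0`_n * (s * (s / T ^+ r) ^+ n.+2) * (phi * (phi + V T) ^+ 3).
    rewrite mulr_gt0//; first by rewrite mulr_gt0 ?oppr_gt0// sign_of_odd_power//= negbK.
    by rewrite exprS mulrA mulr_gt0// exprn_even_gt0.
  rewrite -(pmulr_rge0 _ K0).
  have -> : - P0`_n * (s * (s / T ^+ r) ^+ n.+2) * (phi * (phi + V T) ^+ 3) * SG =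
    s * (phi * P0`_n) * gap Z' (s / T ^+ r) (- (r%:R * s / T ^+ r.+1)) (V T) (dV T).
    apply: (@mulfI _ ((s / T ^+ r) ^+ (2 * p + p))); first by rewrite expf_neq0.
    rewrite [RHS]mulrCA -E /v mul2n -addnn !exprD exprMn.
    move: (_ ^+ n.+2) => U; move: ((s / T ^+ r) ^+ p) => u; ring.
  by rewrite -al.
Qed.

End FromBarriers.

Lemma slope_gap_solution (R : realType) (P0 P1 P2 : {poly R}) (s T y : R) (r : nat) :
  y != 0 ->
  slope_gap P0 P1 P2 s r T y
    (cherkas_slope (ramify s r P0) (ramify s r P1) (ramify s r P2) T y) = 0.
Proof. by move=> y0; rewrite /slope_gap /cherkas_slope; field. Qed.

Lemma degree_condition_sizes (R : realType) (n p : nat) (P1 P : {poly R}) :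
  degree_condition n P1 P p -> P`_(n - 2 * p) != 0 ->
  [/\ size P = (n - 2 * p).+1, lead_coef P = P`_(n - 2 * p), (size P1 <= (n - p).+1)%N,
      ((n - p) + (n - p) = (n - 2 * p) + n)%N & odd (n - 2 * p) = odd n].
Proof.
move=> [p0 pn s0 s1] c0.
have sP : size P = (n - 2 * p).+1 by apply: size_exact => //; rewrite -subSn.
split=> //.
- by rewrite lead_coefE sP.
- by rewrite -subSn//; lia.
- lia.
- by rewrite oddB// oddM /= addbF.
Qed.

Lemma sqr_sign_pow (R : realType) (s : R) (k : nat) :
  s = 1 \/ s = -1 -> s ^+ k * s ^+ k = 1.
Proof. by move=> s1; rewrite -exprMn (_ : s * s = 1) ?expr1n//; case: s1 => ->; rewrite ?mulrNN mulr1. Qed.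

Section FromSolutions.
Variables (R : realType) (n : nat) (P0 P1 P2 : {poly R}) (s : R).
Hypothesis sz0 : (size P0 <= n.+1)%N.
Hypothesis sz1 : (size P1 <= n.+1)%N.
Hypothesis sz2 : (size P2 <= n.+1)%N.
Hypothesis on : odd n.
Hypothesis s1 : s = 1 \/ s = -1.
Hypothesis esc : escaping P0 P1 P2 s 1.

Let s_even : s ^+ n.+1 = 1.
Proof. by case: s1 => ->; rewrite ?expr1n// -signr_odd /= on. Qed.

Let ratio (p k : nat) (y T : R) : T != 0 -> y * (1 * T ^+ (k + p) / T ^+ k) = y * T ^+ p.
Proof. by move=> T0; rewrite mul1r exprD mulrAC mulfV ?mul1r// expf_neq0. Qed.

(** By [leading_double] a solution over a half-line tends to the double root. *)
Lemma asymptotic_solution_Y : P2`_n < 0 -> P1`_n != 0 ->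
  P1`_n ^+ 2 - 4 * P0`_n * P2`_n = 0 -> asymptotic_solution (fieldY n P0 P1 P2) s.
Proof.
move=> c0 b0 disc; have [c [T0 [y [T00 yP]]]] := esc.
have cn : P2`_n != 0 by rewrite lt_eqF.
have a0 : P0`_n != 0.
  apply: contraNneq b0 => a0; move: disc; rewrite a0 mulr0 mul0r subr0 => /eqP.
  by rewrite expf_eq0.
have sP0 := size_exact sz0 a0; have sP2 := size_exact sz2 cn.
have l0 : lead_coef P0 = P0`_n by rewrite lead_coefE sP0.
have l2 : lead_coef P2 = P2`_n by rewrite lead_coefE sP2.
have lc2 : lead_coef P2 < 0 by rewrite l2.
pose y0 := - P1`_n / (2 * P2`_n).
have yy0 : y @ +oo --> y0.
  have := leading_double sP0 sP2 sz1 erefl on on lc2 s1 T00 yP (phi := y0).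
  move=> H; apply: cvg_trans (H _).
    apply: near_eq_cvg; apply: filterS (near_pinfty_gt0 R) => T Tp.
    by rewrite mul1r mulfV ?mulr1// expf_neq0// gt_eqF.
  move=> z; rewrite s_even mul1r l0 l2 /y0.
  transitivity (P2`_n * (z - - P1`_n / (2 * P2`_n)) ^+ 2
     - (P1`_n ^+ 2 - 4 * P0`_n * P2`_n) / (4 * P2`_n)); first by field.
  by rewrite disc mul0r subr0.
exists (fun T => y T - y0), (fun T => cherkas_slope (ramify s 1 P0) (ramify s 1 P1) (ramify s 1 P2) T (y T)).
split; first by rewrite -(subrr y0); apply: cvgB => //; exact: cvg_cst.
apply/near_pinfty_from; exists T0 => T TT; have [cy yd] := yP T TT.
have Tp := lt_le_trans T00 TT.
have yn : y T != 0 by apply: contraTneq cy => ->; rewrite mulr0 ltxx.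
split; first by rewrite -[cherkas_slope _ _ _ _ _]subr0; apply: is_deriveB.
have := gap_fieldY sz0 sz1 sz2 (y T - y0) (cherkas_slope (ramify s 1 P0) (ramify s 1 P1) (ramify s 1 P2) T (y T)) s1 (ltn0Sn 0) Tp.
by rewrite mul1r expr1 => ->; rewrite -/y0 subrK slope_gap_solution// mulr0.
Qed.

(** By [leading_double] a solution over a half-line is asymptotic to a multiple
    of [|x|^(- p)]; the factor is the double root, up to a sign for [x < 0]. *)
Lemma asymptotic_solution_Y_blow_up (Z' : vfield R) (p : nat) (phi : R) :
  P2`_n < 0 -> P1`_n = 0 -> phi != 0 -> degree_condition n P1 P0 p ->
  leading_quadratic n P2 P1 P0 p = P2`_n *: ('X - phi%:P) ^+ 2 ->
  (forall u du v dv,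
    gap (fieldY n P0 P1 P2) u du (u ^+ p * (phi + v))
      (u ^+ p * dv + p%:R * u ^+ p.-1 * du * (phi + v)) = u ^+ (p + p) * gap Z' u du v dv) ->
  asymptotic_solution Z' s.
Proof.
move=> c0 b0 phi0 dc dE gapE; have [c [T0 [y [T00 yP]]]] := esc.
have cn : P2`_n != 0 by rewrite lt_eqF.
have qz z : P2`_n * z ^+ 2 + P1`_(n - p) * z + P0`_(n - 2 * p) = P2`_n * (z - phi) ^+ 2.
  have := congr1 (fun q : {poly R} => q.[z]) dE.
  by rewrite /leading_quadratic /= !hornerE /= => ->; ring.
have a0 : P0`_(n - 2 * p) != 0.
  have := qz 0; rewrite expr0n /= !mulr0 !add0r sqrrN => ->.
  by rewrite mulf_neq0// expf_neq0.
have [p0 pn _ _] := dc.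
have [sP0 l0 sP1 m2 od0] := degree_condition_sizes dc a0.
have sP2 := size_exact sz2 cn.
have l2 : lead_coef P2 = P2`_n by rewrite lead_coefE sP2.
have lc2 : lead_coef P2 < 0 by rewrite l2.
rewrite on in od0.
have pnE : (p + (n - p).+1 = n.+1)%N by rewrite addnS (subnKC (le_of_double pn)).
have mE : (n - p = (n - 2 * p) + p)%N.
  rewrite mul2n -addnn subnDA subnK// -(leq_add2l p) subnKC ?addnn -?mul2n//.
  exact: le_of_double pn.
pose si := s ^+ (n - p).+1.
have wc : (fun T => y T * T ^+ p) @ +oo --> si * phi.
  have := leading_double sP0 sP2 sP1 m2 od0 on lc2 s1 T00 yP (phi := si * phi).
  move=> H; apply: cvg_trans (H _).
    apply: near_eq_cvg; apply: filterS (near_pinfty_gt0 R) => T Tp.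
    by rewrite mE ratio// gt_eqF.
  have sis : si * si = 1 by exact: sqr_sign_pow.
  move=> z; rewrite l0 l2 -/si.
  transitivity (P2`_n * (si * z) ^+ 2 + P1`_(n - p) * (si * z) + P0`_(n - 2 * p)).
    by rewrite exprMn (expr2 si) sis; ring.
  rewrite qz; transitivity ((si * si) * (P2`_n * (z - si * phi) ^+ 2) + P2`_n * (1 - si * si) * (- (2 * si * z * phi) + phi ^+ 2 * (1 + si * si))).
    by ring.
  by rewrite sis subrr mulr0 mul0r mul1r addr0.
pose dy T := cherkas_slope (ramify s 1 P0) (ramify s 1 P1) (ramify s 1 P2) T (y T).
apply: (asymptotic_solution_blow_up (V := y) (dV := dy) s1 p0 gapE).
  apply/near_pinfty_from; exists T0 => T TT; have [cy yd] := yP T TT.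
  have Tp := lt_le_trans T00 TT; split=> //.
  have yn : y T != 0 by apply: contraTneq cy => ->; rewrite mulr0 ltxx.
  have := gap_fieldY sz0 sz1 sz2 (y T) (dy T) s1 (ltn0Sn 0) Tp.
  by rewrite mul1r expr1 => ->; rewrite b0 oppr0 mul0r addr0 slope_gap_solution// mulr0.
have -> : phi = s ^+ p * (si * phi).
  by rewrite mulrA /si -exprD pnE s_even mul1r.
under eq_fun do rewrite exprMn mulrCA.
by apply: cvgM => //; exact: cvg_cst.
Qed.

(** Now [leading_double] gives [y] asymptotic to a multiple of [|x|^p], whose
    factor is the inverse of the double root, up to a sign for [x < 0]. *)
Lemma asymptotic_solution_X_blow_up (Z' : vfield R) (p : nat) (phi : R) :
  P0`_n < 0 -> phi != 0 -> degree_condition n P1 P2 p ->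
  leading_quadratic n P0 P1 P2 p = P0`_n *: ('X - phi%:P) ^+ 2 ->
  (forall u du v dv,
    gap (fieldX n P0 P1 P2) u du (u ^+ p * (phi + v))
      (u ^+ p * dv + p%:R * u ^+ p.-1 * du * (phi + v)) = u ^+ (2 * p + p) * gap Z' u du v dv) ->
  asymptotic_solution Z' s.
Proof.
move=> a0 phi0 dc dE gapE; have [c [T0 [y [T00 yP]]]] := esc.
have an : P0`_n != 0 by rewrite lt_eqF.
have qz z : P0`_n * z ^+ 2 + P1`_(n - p) * z + P2`_(n - 2 * p) = P0`_n * (z - phi) ^+ 2.
  have := congr1 (fun q : {poly R} => q.[z]) dE.
  by rewrite /leading_quadratic /= !hornerE /= => ->; ring.
have cE : P2`_(n - 2 * p) = P0`_n * phi ^+ 2.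
  by have := qz 0; rewrite expr0n /= !mulr0 !add0r sqrrN.
have bE : P1`_(n - p) = - 2 * P0`_n * phi.
  have E := qz 1; rewrite cE expr1n !mulr1 in E.
  have -> : P1`_(n - p) = (P0`_n + P1`_(n - p) + P0`_n * phi ^+ 2) - P0`_n - P0`_n * phi ^+ 2.
    by ring.
  by rewrite E; ring.
have c0 : P2`_(n - 2 * p) != 0 by rewrite cE mulf_neq0// expf_neq0.
have [p0 pn _ _] := dc.
have [sP2 l2 sP1 m2 od2] := degree_condition_sizes dc c0.
have sP0 := size_exact sz0 an.
have l0 : lead_coef P0 = P0`_n by rewrite lead_coefE sP0.
have lc2 : lead_coef P2 < 0 by rewrite l2 cE nmulr_rlt0// exprn_even_gt0.
rewrite on in od2.
pose si := s ^+ (n - p).+1.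
have sis : si * si = 1 by exact: sqr_sign_pow.
have wc : (fun T => y T / T ^+ p) @ +oo --> si / phi.
  have m2' : ((n - p) + (n - p) = n + (n - 2 * p))%N by rewrite m2 addnC.
  have := leading_double sP0 sP2 sP1 m2' on od2 lc2 s1 T00 yP (phi := si / phi).
  move=> H; apply: cvg_trans (H _).
    apply: near_eq_cvg; apply: filterS (near_pinfty_gt0 R) => T Tp.
    have Tn : T != 0 by rewrite gt_eqF.
    have {2}-> : n = (n - p + p)%N by rewrite (subnK (le_of_double pn)).
    by rewrite mul1r exprD; field; rewrite !expf_neq0.
  move=> z; rewrite l0 l2 -/si bE cE.
  transitivity (P0`_n * phi ^+ 2 * (z - si / phi) ^+ 2 + P0`_n * (1 - si * si)); first by field.
  by rewrite sis subrr mulr0 addr0.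
pose dy T := cherkas_slope (ramify s 1 P0) (ramify s 1 P1) (ramify s 1 P2) T (y T).
apply: (asymptotic_solution_blow_up (V := fun T => (y T)^-1)
  (dV := fun T => - (dy T / y T ^+ 2)) s1 p0 gapE).
  apply/near_pinfty_from; exists T0 => T TT; have [cy yd] := yP T TT.
  have Tp := lt_le_trans T00 TT.
  have yn : y T != 0 by apply: contraTneq cy => ->; rewrite mulr0 ltxx.
  split.
    have := is_deriveV yn yd.
    by move/is_derive_eq; apply; rewrite /GRing.scale /= mulNr mulrC.
  have yi : (y T)^-1 != 0 by rewrite invr_eq0.
  have := gap_fieldX sz0 sz1 sz2 (- (dy T / y T ^+ 2)) s1 (ltn0Sn 0) Tp yi.
  rewrite mul1r expr1 => ->; rewrite invrK.
  have -> : - (- (dy T / y T ^+ 2) / (y T)^-1 ^+ 2) = dy T by field.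
  by rewrite slope_gap_solution// mulr0.
have -> : phi = s ^+ p * (si / phi)^-1.
  have -> : s ^+ p = si.
    have : s ^+ p * si = 1.
      by rewrite /si -exprD addnS (subnKC (le_of_double pn)) s_even.
    by move=> E; rewrite -[LHS]mulr1 -sis mulrA E mul1r.
  by rewrite invf_div mulrCA divff ?mulr1//; apply: contra_eq_neq sis => ->; rewrite mul0r eq_sym oner_neq0.
have : (fun T => s ^+ p * (y T / T ^+ p)^-1) @ +oo --> s ^+ p * (si / phi)^-1.
  apply: cvgM; first exact: cvg_cst.
  apply: cvgV => //; rewrite mulf_neq0 ?invr_eq0//.
  by apply: contra_eq_neq sis => ->; rewrite mul0r eq_sym oner_neq0.
by apply: cvg_trans; apply: near_eq_cvg; near=> T; rewrite exprMn invf_div; ring.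
Unshelve. all: by end_near. Qed.

End FromSolutions.

Lemma blow_up_count (n p m : nat) :
  (0 < p)%N -> (2 * p <= n)%N -> (m.+2 <= n.+2 - 2 * p)%N -> (m.+1 <= n - 1)%N.
Proof. lia. Qed.

Lemma half_degrees (n d p : nat) : (d <= n)%N -> (n - d = 2 * p)%N ->
  [/\ (d + n)./2 = (n - p)%N, (2 * p <= n)%N, (n - 2 * p = d)%N, (n.+1 - 2 * p = d.+1)%N
    & (n.+1 - p = (n - p).+1)%N].
Proof.
move=> dn pE; have -> : (d + n = (n - p).*2)%N by lia.
by rewrite doubleK; split=> //; lia.
Qed.

(** The three cases are distinguished by the degrees of [P0] and [P2], one of
    which is [n].  A negative discriminant of the leading quadratic gives the second
    case or [istar = 0]; if it vanishes, the germ at its double root has no barrier. *)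
Lemma monodromic_conditions (R : realType) (n : nat) (P0 P1 P2 : {poly R}) :
  (size P0 <= n.+1)%N -> (size P1 <= n.+1)%N -> (size P2 <= n.+1)%N ->
  P0`_n ^+ 2 + P1`_n ^+ 2 + P2`_n ^+ 2 != 0 -> P0 != 0 -> P2 != 0 ->
  monodromic_at_infinity (cherkas P0 P1 P2) ->
  odd n /\
  [\/ [/\ P2`_n = 0, P1`_n = 0, P0`_n < 0 &
          exists istar : nat,
            (istar <= n - 1)%N /\
            desingularizes_at (fieldX n P0 P1 P2) istar],
      P2`_n < 0 /\ P1`_n ^+ 2 - 4 * P0`_n * P2`_n < 0 |
      [/\ P2`_n < 0, P1`_n ^+ 2 - 4 * P0`_n * P2`_n = 0 &
          exists istar : nat,
            [/\ P1`_n != 0 -> (istar <= n)%N, P1`_n = 0 -> (istar <= n.+1)%N &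
                desingularizes_at (fieldY n P0 P1 P2) istar]]].
Proof.
move=> sz0 sz1 sz2 lead_neq0 P00 P20 mono.
have nescr s r : s = 1 \/ s = -1 -> (0 < r)%N -> ~ escaping P0 P1 P2 s r.
  by move=> s1 r0 esc; exact: escaping_not_monodromic P20 s1 r0 esc mono.
have nesc : ~ exists s r, [/\ s = 1 \/ s = -1, (0 < r)%N & escaping P0 P1 P2 s r].
  by move=> [s [r [s1 r0]]]; exact: nescr.
have sP0 : size P0 = (size P0).-1.+1 by rewrite prednK// size_poly_gt0.
have sP2 : size P2 = (size P2).-1.+1 by rewrite prednK// size_poly_gt0.
set d0 := (size P0).-1 in sP0; set d2 := (size P2).-1 in sP2.
have [[od0 od2] [l0 l2] sP1 disc] := not_escaping_leading sP0 sP2 erefl (fun s s1 => nescr s 1%N s1 isT).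
have l0E : lead_coef P0 = P0`_d0 by [].
have l2E : lead_coef P2 = P2`_d2 by [].
have dn0 : (d0 <= n)%N by rewrite -ltnS -sP0.
have dn2 : (d2 <= n)%N by rewrite -ltnS -sP2.
have neg s r : s = 1 \/ s = -1 -> (0 < r)%N -> \forall T \near +oo, (ramify s r P0).[T] <= 0.
  exact: ramify_eventually_neg sP0 od0 l0.
have top (P : {poly R}) d : size P = d.+1 -> (d <= n)%N -> (P`_n != 0) = (d == n).
  move=> sP dn; have [E|/eqP dN] := eqVneq d n.
    by rewrite -E -[d]/(d.+1.-1) -sP -lead_coefE lead_coef_eq0 -size_poly_eq0 sP.
  by apply/negbTE; rewrite negbK nth_default// sP ltn_neqAle dn andbT; apply/eqP.
have cnE := top _ _ sP2 dn2; have anE := top _ _ sP0 dn0.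
have [c0|c0] := eqVneq P2`_n 0; last first.
- have d2n : d2 = n by apply/eqP; rewrite -cnE.
  have on : odd n by rewrite -d2n.
  have cneg : P2`_n < 0 by rewrite -{1}d2n -l2E.
  split=> //.
  have [a0|a0] := eqVneq P0`_n 0; last first.
    have d0n : d0 = n by apply/eqP; rewrite -anE.
    have mn : (d0 + d2)./2 = n by rewrite d0n d2n addnn doubleK.
    rewrite mn l0E d0n l2E d2n in disc.
    move: disc; rewrite le_eqVlt => /orP[/eqP disc|disc]; last first.
      by apply: Or32; rewrite subr_lt0.
    have disc0 : P1`_n ^+ 2 - 4 * P0`_n * P2`_n = 0 by rewrite disc subrr.
    have b0 : P1`_n != 0.
      have := disc; apply: contra_eq_neq => ->.
      by rewrite expr0n /= eq_sym !mulf_neq0.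
    apply: Or33; split=> //.
    have [gY al] := fieldY_germ c0 b0 disc0.
    have [HB|[m [mn' D]]] := barrier_or_desingularized (ltn0Sn n.+1) gY.
      by case: nesc; exact: escaping_of_barrier_Y sz0 sz1 sz2 on neg cneg b0 al HB.
    by exists m; split=> // /eqP; rewrite (negPf b0).
  have d0n : (d0 < n)%N by rewrite ltn_neqAle dn0 andbT -anE a0 eqxx.
  pose p := (n - d0)./2.
  have pE : (n - d0 = 2 * p)%N.
    by rewrite mul2n halfK oddB// on od0 subn0.
  have [mE p2n pn s2p sp] := half_degrees dn0 pE; rewrite -{1}d2n in mE.
  rewrite mE in disc sP1; rewrite l2E d2n in disc.
  have dc : degree_condition n P1 P0 p.
    by split; rewrite ?sP0 ?s2p ?sp//; case: (p) pE => //; rewrite muln0 => /eqP; rewrite subn_eq0 leqNgt d0n.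
  have [p0 _ _ s1p] := dc.
  have b0 : P1`_n = 0.
    by rewrite nth_default//; apply: leq_trans s1p _; rewrite leq_subLR -add1n leq_add2r.
  have disc0 : P1`_n ^+ 2 - 4 * P0`_n * P2`_n = 0 by rewrite b0 a0 mulr0 mul0r expr0n subrr.
  apply: Or33; split=> //.
  have lE : leading_quadratic n P2 P1 P0 p = P2`_n *: 'X^2 + P1`_(n - p) *: 'X + (lead_coef P0)%:P.
    by rewrite /leading_quadratic pn l0E.
  have [pY al] := fieldY_pregerm P0 c0 b0.
  have eC := (fieldY_edge_condition P2 sz0 sz1 P00 b0 p).2 dc.
  have qE := fieldY_edge_quadratic P2 b0 dc.
  have ln : lead_coef P0 != 0 by rewrite lt_eqF.
  have {}disc : P1`_(n - p) ^+ 2 <= 4 * P2`_n * lead_coef P0 by rewrite mulrAC.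
  move: disc; rewrite le_eqVlt => /orP[/eqP disc|disc]; last first.
    exists 0%N; split=> //; apply/(pregerm_desingularizes_at0 pY); exists p; split=> //.
    by rewrite qE lE; apply/quadratic_nonroot.
  have [phi phi0 dE] := quadratic_double_root c0 ln disc; rewrite -lE in dE.
  have [gZ' al' gapE] := fieldY_blow_up sz0 sz1 c0 b0 dc phi0 dE.
  have [HB|[m [mn' D]]] := barrier_or_desingularized (ltn0Sn n.+1) gZ'.
    case: nesc.
    exact: (escaping_of_barrier_Y_blow_up sz0 sz1 sz2 on neg (p := p) cneg b0 phi0 al' gapE HB).
  exists m.+1; split=> //; first by rewrite b0 eqxx.
  by apply/(pregerm_desingularizes_atS pY); exists p, phi; split; rewrite ?qE ?al.
- have d2n : (d2 < n)%N by rewrite ltn_neqAle dn2 andbT -cnE c0 eqxx.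
  have b0 : P1`_n = 0.
    by rewrite nth_default//; apply: leq_trans sP1 _; rewrite ltn_half_double -addnn -addnS leq_add.
  have a0 : P0`_n != 0.
    by apply: contraNneq lead_neq0 => ->; rewrite b0 c0 expr0n !addr0.
  have d0n : d0 = n by apply/eqP; rewrite -anE.
  have on : odd n by rewrite -d0n.
  have aneg : P0`_n < 0 by rewrite -{1}d0n -l0E.
  split=> //; apply: Or31; split=> //.
  pose p := (n - d2)./2.
  have pE : (n - d2 = 2 * p)%N.
    by rewrite mul2n halfK oddB// on od2 subn0.
  have [mE p2n pn s2p sp] := half_degrees dn2 pE; rewrite addnC -{1}d0n in mE.
  rewrite mE l0E d0n in disc sP1.
  have dc : degree_condition n P1 P2 p.
    by split; rewrite ?sP2 ?s2p ?sp//; case: (p) pE => //; rewrite muln0 => /eqP; rewrite subn_eq0 leqNgt d2n.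
  have lE : leading_quadratic n P0 P1 P2 p = P0`_n *: 'X^2 + P1`_(n - p) *: 'X + (lead_coef P2)%:P.
    by rewrite /leading_quadratic pn l2E.
  have ln : lead_coef P2 != 0 by rewrite lt_eqF.
  move: disc; rewrite le_eqVlt => /orP[/eqP disc|disc]; last first.
    exists 0%N; split=> //; apply/(fieldX_desingularizes_at0 sz1 sz2 a0 P20); exists p; split=> //.
    by rewrite lE; apply/quadratic_nonroot.
  have [phi phi0 dE] := quadratic_double_root a0 ln disc; rewrite -lE in dE.
  have [gZ' al' gapE] := fieldX_blow_up sz1 sz2 a0 dc phi0 dE.
  have N0 : (0 < n.+2 - 2 * p)%N by rewrite subn_gt0 ltnS leqW//; case: dc.
  have [HB|[m [mn' D]]] := barrier_or_desingularized N0 gZ'.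
    case: nesc.
    exact: (escaping_of_barrier_X_blow_up sz0 sz1 sz2 on neg (p := p) aneg phi0 al' gapE HB).
  exists m.+1; split; first by case: dc => p0 _ _ _; exact: blow_up_count mn'.
  by apply/(fieldX_desingularizes_atS sz1 sz2 a0 P20); exists p, phi; split.
Qed.

(** The conditions on the first edge are conditions on the degrees and on the
    leading quadratic.  If this has no real root, the leading terms exclude
    solutions over a half-line; if it has a double root, such a solution would
    give one through the germ at that root. *)
Lemma conditions_monodromic (R : realType) (n : nat) (P0 P1 P2 : {poly R}) :
  (size P0 <= n.+1)%N -> (size P1 <= n.+1)%N -> (size P2 <= n.+1)%N ->
  P0 != 0 -> P2 != 0 -> odd n ->
  [\/ [/\ P2`_n = 0, P1`_n = 0, P0`_n < 0 &
          exists istar : nat, desingularizes_at (fieldX n P0 P1 P2) istar],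
      P2`_n < 0 /\ P1`_n ^+ 2 - 4 * P0`_n * P2`_n < 0 |
      [/\ P2`_n < 0, P1`_n ^+ 2 - 4 * P0`_n * P2`_n = 0 &
          exists istar : nat, desingularizes_at (fieldY n P0 P1 P2) istar]] ->
  monodromic_at_infinity (cherkas P0 P1 P2).
Proof.
move=> sz0 sz1 sz2 P00 P20 on H.
have [//|/(not_monodromic_escaping P00 P20)[s [s1 esc]]] := pselect (monodromic_at_infinity (cherkas P0 P1 P2)).
exfalso; have [c [T0 [y [T00 yP]]]] := esc.
case: H => [[c0 b0 aneg [[|m] D]]|[cneg disc]|[cneg disc [m D]]].
- have a0 : P0`_n != 0 by rewrite lt_eqF.
  have [p [dc nr]] := (fieldX_desingularizes_at0 sz1 sz2 a0 P20).1 D.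
  have /(quadratic_nonroot _ _ a0) disc := nr.
  have cneg : P2`_(n - 2 * p) < 0.
    have := le_lt_trans (sqr_ge0 _) disc.
    by rewrite nmulr_rgt0// nmulr_llt0// pmulr_rlt0.
  have [sP2 l2 sP1 m2 od2] := degree_condition_sizes dc (ltr0_neq0 cneg).
  have sP0 := size_exact sz0 a0.
  have l0 : lead_coef P0 = P0`_n by rewrite lead_coefE sP0.
  rewrite on in od2.
  have m2' : ((n - p) + (n - p) = n + (n - 2 * p))%N by rewrite m2 addnC.
  have lc2 : lead_coef P2 < 0 by rewrite l2.
  apply: (leading_nonreal sP0 sP2 sP1 m2' on od2 lc2 s1 T00 yP).
  by rewrite exprMn expr2 sqr_sign_pow// mul1r l0 l2.
- have a0 : P0`_n != 0 by rewrite lt_eqF.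
  have [p [phi [dc phi0 dE D']]] := (fieldX_desingularizes_atS sz1 sz2 a0 P20 m).1 D.
  have [gZ' al' gapE] := fieldX_blow_up sz1 sz2 a0 dc phi0 dE.
  have N0 : (0 < n.+2 - 2 * p)%N by rewrite subn_gt0 ltnS leqW//; case: dc.
  apply: (desingularized_no_solution N0 gZ' D' s1).
  exact: (asymptotic_solution_X_blow_up sz0 sz1 sz2 on s1 esc (p := p) aneg phi0 dc dE gapE).
- have cn : P2`_n != 0 by rewrite lt_eqF.
  have {}disc : P1`_n ^+ 2 < 4 * P0`_n * P2`_n by rewrite -subr_lt0.
  have a0 : P0`_n != 0.
    by apply: contraTneq disc => ->; rewrite mulr0 mul0r -leNgt sqr_ge0.
  have sP0 := size_exact sz0 a0; have sP2 := size_exact sz2 cn.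
  have l0 : lead_coef P0 = P0`_n by rewrite lead_coefE sP0.
  have l2 : lead_coef P2 = P2`_n by rewrite lead_coefE sP2.
  have lc2 : lead_coef P2 < 0 by rewrite l2.
  apply: (leading_nonreal sP0 sP2 sz1 erefl on on lc2 s1 T00 yP).
  by rewrite exprMn expr2 sqr_sign_pow// mul1r l0 l2.
have cn : P2`_n != 0 by rewrite lt_eqF.
have [b0|b0] := eqVneq P1`_n 0; last first.
  have [gY al] := fieldY_germ cn b0 disc.
  apply: (desingularized_no_solution (ltn0Sn n.+1) gY D s1).
  exact: asymptotic_solution_Y sz0 sz1 sz2 on s1 esc cneg b0 disc.
have [pY al] := fieldY_pregerm P0 cn b0.
case: m D => [|m] D.
  have [p [eC nr]] := (pregerm_desingularizes_at0 pY).1 D.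
  have dc := (fieldY_edge_condition P2 sz0 sz1 P00 b0 p).1 eC.
  have := nr; rewrite (fieldY_edge_quadratic P2 b0 dc) => /(quadratic_nonroot _ _ cn) {}disc.
  have aneg : P0`_(n - 2 * p) < 0.
    have := le_lt_trans (sqr_ge0 _) disc.
    by rewrite nmulr_rgt0// pmulr_rlt0.
  have [sP0 l0 sP1 m2 od0] := degree_condition_sizes dc (ltr0_neq0 aneg).
  have sP2 := size_exact sz2 cn.
  have l2 : lead_coef P2 = P2`_n by rewrite lead_coefE sP2.
  have lc2 : lead_coef P2 < 0 by rewrite l2.
  rewrite on in od0.
  apply: (leading_nonreal sP0 sP2 sP1 m2 od0 on lc2 s1 T00 yP).
  by rewrite exprMn expr2 sqr_sign_pow// mul1r l0 l2 mulrAC.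
have [p [phi [eC phi0 dE D']]] := (pregerm_desingularizes_atS pY m).1 D.
have dc := (fieldY_edge_condition P2 sz0 sz1 P00 b0 p).1 eC.
rewrite (fieldY_edge_quadratic P2 b0 dc) al in dE.
have [gZ' al' gapE] := fieldY_blow_up sz0 sz1 cn b0 dc phi0 dE.
apply: (desingularized_no_solution (ltn0Sn n.+1) gZ' D' s1).
exact: (asymptotic_solution_Y_blow_up sz0 sz1 sz2 on s1 esc (p := p) cneg b0 phi0 dc dE gapE).
Qed.

Local Close Scope classical_set_scope.

Theorem lemma2p2 (R : realType) (n : nat) (P0 P1 P2 : {poly R})
    (sz0 : (size P0 <= n.+1)%N) (sz1 : (size P1 <= n.+1)%N)
    (sz2 : (size P2 <= n.+1)%N)
    (lead_neq0 : P0`_n ^+ 2 + P1`_n ^+ 2 + P2`_n ^+ 2 != 0)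
    (P0_neq0 : P0 != 0) (P2_neq0 : P2 != 0) :
  monodromic_at_infinity (cherkas P0 P1 P2) <->
  odd n /\
  [\/ [/\ P2`_n = 0, P1`_n = 0, P0`_n < 0 &
          exists istar : nat,
            (istar <= n - 1)%N /\
            desingularizes_at (fieldX n P0 P1 P2) istar],
      P2`_n < 0 /\ P1`_n ^+ 2 - 4 * P0`_n * P2`_n < 0 |
      [/\ P2`_n < 0, P1`_n ^+ 2 - 4 * P0`_n * P2`_n = 0 &
          exists istar : nat,
            [/\ P1`_n != 0 -> (istar <= n)%N, P1`_n = 0 -> (istar <= n.+1)%N &
                desingularizes_at (fieldY n P0 P1 P2) istar]]].
Proof.
split; first exact: monodromic_conditions.
move=> [on H]; apply: (conditions_monodromic sz0 sz1 sz2 P0_neq0 P2_neq0 on).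
case: H => [[c0 b0 a0 [i [_ D]]]|H|[c0 disc [i [_ _ D]]]].
- by apply: Or31; split=> //; exists i.
- exact: Or32.
- by apply: Or33; split=> //; exists i.
Qed.
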